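(* Let $Y$ be a real random variable, $\mathbf{X}$ an $\mathbb{R}^p$-valued random vector and $\mathbf{Z}$ an $\mathbb{R}^q$-valued random vector ($p\ge 0$, $q\ge 1$) on the same probability space. Suppose that $Y$ is not almost surely equal to a measurable function of $\mathbf{X}$ (when $p=0$: $Y$ is not almost surely a constant). Let $T=T(Y,\mathbf{Z}|\mathbf{X})$ be the conditional dependence measure, and let $T_n=T_n(Y,\mathbf{Z}|\mathbf{X})$ be its estimator computed from $n$ i.i.d. copies of $(Y,\mathbf{X},\mathbf{Z})$, both as defined in the context. Then, as $n\to\infty$, $T_n\to T$ almost surely.
   Context: The case $p=0$ means that $\mathbf{X}$ has no components; conditional expectations, variances and probabilities given $\mathbf{X}$ are then unconditional ones. Let $\mu$ be the law of $Y$ and $$T(Y,\mathbf{Z}|\mathbf{X}) := \frac{\int \mathbb{E}(\mathrm{Var}(\mathbb{P}(Y\ge t|\mathbf{Z},\mathbf{X})|\mathbf{X}))\, d\mu(t)}{\int \mathbb{E}(\mathrm{Var}(1_{\{Y\ge t\}}|\mathbf{X}))\,d\mu(t)}.$$ Let $(Y_1,\mathbf{X}_1,\mathbf{Z}_1),(Y_2,\mathbf{X}_2,\mathbf{Z}_2),\ldots$ be i.i.d. copies of $(Y,\mathbf{X},\mathbf{Z})$; for $n\ge 2$, $T_n$ is computed from the first $n$ of them. For $1\le i\le n$, let $R_i$ be the number of $j\in\{1,\dots,n\}$ with $Y_j\le Y_i$, and $L_i$ the number of $j\in\{1,\dots,n\}$ with $Y_j\ge Y_i$. If $p\ge1$: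 $N(i)$ is the index $j\ne i$ such that $\mathbf{X}_j$ is the nearest neighbor of $\mathbf{X}_i$ among $\{\mathbf{X}_k: k\neq i\}$ in the Euclidean metric on $\mathbb{R}^p$, and $M(i)$ is the index $j\neq i$ such that $(\mathbf{X}_j,\mathbf{Z}_j)$ is the nearest neighbor of $(\mathbf{X}_i,\mathbf{Z}_i)$ in $\mathbb{R}^{p+q}$, ties being broken uniformly at random (independently of the data and independently for different $i$), and $$T_n := \frac{\sum_{i=1}^n (\min\{R_i,R_{M(i)}\}-\min\{R_i,R_{N(i)}\})}{\sum_{i=1}^n (R_i-\min\{R_i,R_{N(i)}\})}.$$ If $p=0$: $M(i)$ is the index $j\ne i$ such that $\mathbf{Z}_j$ is the nearest neighbor of $\mathbf{Z}_i$ (ties broken uniformly at random in the same way), and $$T_n := \frac{\sum_{i=1}^n (n\min\{R_i,R_{M(i)}\}-L_i^2)}{\sum_{i=1}^n L_i(n-L_i)}.$$ In both cases $T_n$ is undefined if the denominator is zero. *)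

(* Defs.v *)
From mathcomp Require Import all_boot all_order all_algebra finmap.
From mathcomp Require Import all_classical all_reals all_analysis.
From mathcomp Require Import measurable_realfun.

Set Implicit Arguments.
Unset Strict Implicit.
Unset Printing Implicit Defensive.

Import Order.TTheory GRing.Theory Num.Theory.
Import numFieldNormedType.Exports.

Local Open Scope classical_set_scope.
Local Open Scope ring_scope.

(* V is a version of E(W | X), i.e. of E(W | sigma(X)). *)
Definition is_cond_exp d (Omega : measurableType d) (R : realType)
    (P : probability Omega R) d' (S : measurableType d')
    (X : Omega -> S) (W V : Omega -> R) : Prop :=
  [/\ measurable_fun [set: g_sigma_algebra_preimageType X]
        (V : g_sigma_algebra_preimageType X -> R),
      P.-integrable [set: Omega] (EFin \o V) &
      forall A, g_sigma_algebra_preimage X A ->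
        \int[P]_(w in A) (V w)%:E = \int[P]_(w in A) (W w)%:E]%E.

(* An arbitrary version of E(W | X); by cond_expP below, it is indeed one as
   soon as W is integrable. *)
Definition cond_exp d (Omega : measurableType d) (R : realType)
    (P : probability Omega R) d' (S : measurableType d')
    (X : Omega -> S) (W : Omega -> R) : Omega -> R :=
  xget (cst 0) [set V | is_cond_exp P X W V].

Lemma cond_expP d (Omega : measurableType d) (R : realType)
    (P : probability Omega R) d' (S : measurableType d')
    (X : {mfun Omega >-> S}) (W : Omega -> R) :
  P.-integrable [set: Omega] (EFin \o W) ->
  is_cond_exp P X W (cond_exp P X W).
Proof.
move=> iW.
have mX : measurable_fun [set: Omega] X by [].
pose nu : {charge set S -> \bar R} :=
  @measure_function_pushforward__canonical__charge_Charge
    _ _ _ _ X _ (induced_charge iW) mX.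
pose mu : probability S R := distribution P X.
have numu : nu `<< mu.
  apply: (dominates_pushforward mX).
  apply/null_content_dominatesP => A mA PA0.
  apply: null_set_integral => //.
  by apply: measurable_funTS; exact: measurable_int iW.
have ig := Radon_Nikodym_integrable numu.
have mg := measurable_int _ ig.
set g := Radon_Nikodym nu mu in ig mg.
have fg x : g x \is a fin_num by exact: Radon_Nikodym_fin_num.
have iV : P.-integrable [set: Omega] (g \o X).
  apply/integrableP; split; first exact: measurableT_comp.
  move/integrableP : ig => [_]; rewrite ge0_integral_pushforward//.
  exact: measurableT_comp.
suff : exists V, is_cond_exp P X W V by exact: (xgetPex (cst 0)).
exists (fine \o g \o X); split.
- move=> _ B mB; rewrite setTI.
  exists ((fine \o g) @^-1` B); last by rewrite setTI.
  by rewrite -[X in measurable X]setTI; exact: measurableT_comp mB.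
- rewrite (_ : _ \o _ = g \o X)//.
  by apply/funext => w /=; rewrite fineK.
- move=> _ [B mB <-]; rewrite setTI.
  under eq_integral do rewrite /= fineK//.
  have /= <- := @integral_pushforward _ _ _ _ _ _ mX P B g mg _ mB.
    by rewrite -(Radon_Nikodym_integral numu mB).
  apply: (integrableS _ _ _ iV) => //.
  exact: measurable_funPTI.
Qed.

Definition cond_var d (Omega : measurableType d) (R : realType)
    (P : probability Omega R) d' (S : measurableType d')
    (X : Omega -> S) (W : Omega -> R) : Omega -> R :=
  cond_exp P X (fun w => (W w - cond_exp P X W w) ^+ 2).

(* P(Y >= t | X) *)
Definition cond_prob_ge d (Omega : measurableType d) (R : realType)
    (P : probability Omega R) d' (S : measurableType d')
    (Y : Omega -> R) (X : Omega -> S) (t : R) : Omega -> R :=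
  cond_exp P X \1_[set w | t <= Y w].

(* T(Y, Z | X) *)
Definition cond_dep d (Omega : measurableType d) (R : realType)
    (P : probability Omega R) d1 (S1 : measurableType d1)
    d2 (S2 : measurableType d2)
    (Y : {RV P >-> R}) (Z : Omega -> S2) (X : Omega -> S1) : R :=
  fine (\int[distribution P Y]_t
     'E_P[cond_var P X (cond_prob_ge P Y (fun w => (X w, Z w)) t)])%E
  / fine (\int[distribution P Y]_t
     'E_P[cond_var P X \1_[set w | (t <= Y w)%R]])%E.

Definition iid_copies d0 (Omega0 : measurableType d0) d (Omega : measurableType d)
    (R : realType) (P0 : probability Omega0 R) (P : probability Omega R)
    d' (S : measurableType d') (W0 : Omega0 -> S) (W : nat -> Omega -> S) : Prop :=
  (forall i B, measurable B -> P (W i @^-1` B) = P0 (W0 @^-1` B)) /\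
  (forall (I : {fset nat}) (B : nat -> set S), (forall i, measurable (B i)) ->
     P (\bigcap_(i in [set` I]) (W i @^-1` B i)) =
     (\prod_(i <- I) P (W i @^-1` B i))%E).

Definition eucl_dist (R : realType) k (u v : k.-tuple R) : R :=
  Num.sqrt (\sum_(i < k) (tnth u i - tnth v i) ^+ 2).

Definition nearest (R : realType) k n (x : 'I_n -> k.-tuple R) (i : 'I_n) :
    {set 'I_n} :=
  [set j | (j != i) &&
     [forall k, (k != i) ==> (eucl_dist (x i) (x j) <= eucl_dist (x i) (x k))]]%SET.

(* nu i is a nearest neighbour of x i, ties being broken uniformly at random:
   conditionally on the data D, the indices nu i are independent, and nu i is
   uniformly distributed on the set of nearest neighbours of x i. *)
Definition uniform_nearest d (Omega : measurableType d) (R : realType)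
    (P : probability Omega R) d' (S : measurableType d') (D : Omega -> S)
    k n (x : 'I_n -> Omega -> k.-tuple R) (nu : 'I_n -> Omega -> 'I_n) : Prop :=
  (forall i j, measurable [set w | nu i w = j]) /\
  (forall (B : set S) (f : 'I_n -> 'I_n), measurable B ->
     P ((D @^-1` B) `&` [set w | forall i, nu i w = f i]) =
     \int[P]_(w in D @^-1` B)
       (\prod_(i < n)
          let A := nearest (fun j => x j w) i in
          if f i \in A then (#|A|%:R)^-1 else 0)%R%:E)%E.

Definition rankR (R : realType) n (y : 'I_n -> R) (i : 'I_n) : nat :=
  #|[set j : 'I_n | y j <= y i]%SET|.

Definition rankL (R : realType) n (y : 'I_n -> R) (i : 'I_n) : nat :=
  #|[set j : 'I_n | y i <= y j]%SET|.

(* Numerator and denominator of T_n; N is not used when p = 0. *)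
Definition Tn_num (R : realType) (p n : nat) (y : 'I_n -> R)
    (N M : 'I_n -> 'I_n) : R :=
  if p == 0%N then
    \sum_(i < n) (n%:R * (minn (rankR y i) (rankR y (M i)))%:R
                  - (rankL y i)%:R ^+ 2)
  else
    \sum_(i < n) ((minn (rankR y i) (rankR y (M i)))%:R
                  - (minn (rankR y i) (rankR y (N i)))%:R).

Definition Tn_den (R : realType) (p n : nat) (y : 'I_n -> R)
    (N : 'I_n -> 'I_n) : R :=
  if p == 0%N then
    \sum_(i < n) ((rankL y i)%:R * (n%:R - (rankL y i)%:R))
  else
    \sum_(i < n) ((rankR y i)%:R - (minn (rankR y i) (rankR y (N i)))%:R).

(* Main.v *)
Require Import Defs.
From HB Require Import structures.
From mathcomp Require Import all_boot all_order all_algebra finmap.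
From mathcomp Require Import all_classical all_reals all_analysis.
From mathcomp Require Import measurable_realfun ring lra zify.

Set Implicit Arguments.
Unset Strict Implicit.
Unset Printing Implicit Defensive.

Import Order.TTheory GRing.Theory Num.Theory.
Import numFieldNormedType.Exports.

Local Open Scope classical_set_scope.
Local Open Scope ring_scope.

(** Write [V] for the concatenation of [X] and [Z], and for a level [t] let
    [S(t) = P(Y >= t)], [G_V(t) = E(P(Y >= t | V)^2)] and
    [G_X(t) = E(P(Y >= t | X)^2)]. By the orthogonality of conditional
    expectations, numerator and denominator of [T] are the means of
    [G_V(Y) - G_X(Y)] and of [S(Y) - G_X(Y)] ([cond_depE]). On the other side
    [min(R_i, R_k)] counts the sample levels [Y_j] below both [Y_i] and [Y_k];
    after exchanging sums, numerator and denominator of [T_n] are, up to a common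
    factor, the same differences with [S] replaced by the empirical survival
    function and [G_V(t)] by the frequency of the indices [i] such that [Y_i] and
    [Y_M(i)] are both at least [t], averaged over the sample levels [t = Y_j]
    ([sum_min_rank]). If [X] has no components, then [G_X = S^2], which explains
    the different formula for the estimator.

    For a fixed level, let [e_i] be the indicator of [Y_i >= t] and [g] the
    conditional probability of this event as a function of [V]. Given the points,
    the labels [e_i] are independent Bernoulli variables with parameters [g(V_i)]
    and the chosen neighbours are independent of them, so that the sum of the
    [e_i e_M(i)] has a conditional exponential moment that can be bounded
    coordinate by coordinate ([bern_mgf], [graph_mgf]). The bound requires that
    no point be the nearest neighbour of too many others, which is Stone's
    geometric lemma ([in_weight_le]). The sum therefore concentrates
    exponentially ([nn_pair_tail]) around [sum_ij w_ij g(V_i) g(V_j)], where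
    [w_ij] is the probability that [j] is chosen for [i]. It remains to replace
    [g(V_j)] by [g(V_i)], that is, to show that the average of
    [w_ij |g(V_i) - g(V_j)|] tends to zero. This holds for Lipschitz functions of
    one coordinate, since by packing only few bounded points are far from their
    neighbours, and by Stone's lemma again it is stable under approximation in
    mean; hence it holds for all measurable [g] ([nn_continuous_measurable]). The
    law of large numbers, itself a consequence of the exponential bound, gives
    the convergence at each level ([nn_pair_cvg]).

    Since the levels are sample values, convergence has to be uniform in the
    level. Finitely many levels approximate all the others up to sets of small
    probability ([small_cover]), and the oscillation of the statistic over such a
    set is bounded by the frequency of the points and neighbours in it, which is
    asymptotically twice its probability ([nn_count_cvg], [level_avg_cvg]).

    Finally the limit of the denominator is positive ([surv_cond_sqr_gt0]):
    otherwise, for almost every level [t], the event [Y >= t] is almost surely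
    determined by [X]; these levels suffice to determine [Y], which would be a
    measurable function of [X]. *)

(** * Exponential moments of multi-affine functions of Bernoulli variables *)

Lemma expR_le_quad (R : realType) (x : R) : `|x| <= 2^-1 ->
  expR x <= 1 + x + 2 * x ^+ 2.
Proof.
rewrite ler_norml => /andP[x1 x2].
have h : 1 - x <= expR (- x) by exact: expR_ge1Dx.
have e0 := expR_gt0 x.
have e1 : expR x * (1 - x) <= 1.
  by rewrite -[leRHS](expRxMexpNx_1 x) ler_wpM2l// ltW.
have x0 : 0 < 1 - x by lra.
rewrite -(ler_pM2r x0); apply: (le_trans e1).
rewrite -subr_ge0 (_ : _ - 1 = x ^+ 2 * (1 - 2 * x)); last by ring.
by rewrite mulr_ge0 ?sqr_ge0//; lra.
Qed.

Section bernoulli.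
Context (R : realType) (n : nat).
Implicit Types (q x : 'I_n -> R) (s : {ffun 'I_n -> bool}).

(** Weight of an outcome under a product of Bernoulli laws. If all
    parameters are 0 or 1 it is the indicator of one outcome, which turns an
    event on labels into a polynomial of the label indicators. *)
Definition bern q s : R := \prod_i (if s i then q i else 1 - q i).

Definition upd x (i : 'I_n) (a : R) : 'I_n -> R :=
  fun j => if j == i then a else x j.

(** Along every coordinate, such a function sees only the mean of a Bernoulli
    variable, up to a second-order error in [c]. *)
Definition affine_slope (c : R) (Psi : ('I_n -> R) -> R) :=
  forall x i, (forall j, 0 <= x j <= 1) -> exists2 b, `|b| <= c &
    forall a, Psi (upd x i a) = Psi (upd x i 0) + b * a.

Let flip (i : 'I_n) s : {ffun 'I_n -> bool} :=
  [ffun j => if j == i then ~~ s j else s j].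

Let flipK i : involutive (flip i).
Proof.
by move=> s; apply/ffunP => j; rewrite !ffunE; case: (j == i); rewrite ?negbK.
Qed.

Lemma bern_ge0 q s : (forall i, 0 <= q i <= 1) -> 0 <= bern q s.
Proof.
move=> q01; apply: prodr_ge0 => i _; have /andP[q0 q1] := q01 i.
by case: ifP => // _; rewrite subr_ge0.
Qed.

Lemma sum_bern q : \sum_s bern q s = 1.
Proof.
rewrite -(bigA_distr_bigA (fun i b => if b then q i else 1 - q i)) /=.
by rewrite big1// => i _; rewrite big_bool/= addrC subrK.
Qed.

(** Once [h] ignores coordinate [i], the centred variable averages to zero:
    flipping the coordinate changes the sign of each term. *)
Lemma bern_flip q i (h : {ffun 'I_n -> bool} -> R) :
  (forall s, h (flip i s) = h s) ->
  \sum_s bern q s * (h s * ((s i)%:R - q i)) = 0.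
Proof.
move=> hflip; set S := LHS.
suff : S = - S by move=> /eqP; rewrite -addr_eq0 -mulr2n mulrn_eq0/= => /eqP.
rewrite /S [LHS](reindex_inj (inv_inj (flipK i)))/= -sumrN.
apply: eq_bigr => t _; rewrite hflip.
have bE u : bern q u = (if u i then q i else 1 - q i) *
    \prod_(j | j != i) (if u j then q j else 1 - q j) by rewrite /bern (bigD1 i).
rewrite !bE (eq_bigr (fun j => if t j then q j else 1 - q j)); last first.
  by move=> j ji; rewrite ffunE (negbTE ji).
by rewrite ffunE eqxx; case: (t i) => /=; ring.
Qed.

(** Chernoff's method for a multi-affine function of independent Bernoulli
    variables: coordinates are replaced by their means one at a time. *)
Lemma bern_mgf q (Psi : ('I_n -> R) -> R) (c : R) :
  (forall i, 0 <= q i <= 1) -> c <= 2^-1 -> affine_slope c Psi ->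
  \sum_s bern q s * expR (Psi (fun i => (s i)%:R)) <=
  expR (2 * c ^+ 2 * n%:R + Psi q).
Proof.
move=> q01 c12 aff.
(* the first [m] coordinates are random, the others are at their means *)
pose x m s : 'I_n -> R := fun j => if (j < m)%N then (s j)%:R else q j.
have x01 m s j : 0 <= x m s j <= 1.
  by rewrite /x; case: ifP => // _; case: (s j); rewrite ?lexx ?ler01.
pose Z m := \sum_s bern q s * expR (Psi (x m s)).
have Z0 : Z 0%N = expR (Psi q).
  rewrite /Z -[RHS]mul1r -(sum_bern q) mulr_suml; apply: eq_bigr => s _.
  by congr (_ * expR (Psi _)); apply/funext => j.
have -> : \sum_s bern q s * expR (Psi (fun i => (s i)%:R)) = Z n.
  apply: eq_bigr => s _.
  by congr (_ * expR (Psi _)); apply/funext => j; rewrite /x ltn_ord.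
suff ind m : (m <= n)%N -> Z m <= expR (2 * c ^+ 2 * m%:R + Psi q) by exact: ind.
elim: m => [_|m ih mn]; first by rewrite Z0 mulr0 add0r.
have {ih} ih := ih (ltnW mn).
pose i := Ordinal mn.
have xi s a : upd (x m (flip i s)) i a = upd (x m s) i a.
  apply/funext => j; rewrite /upd; case: ifPn => // ji.
  by rewrite /x ffunE (negbTE ji).
have xm s : x m s = upd (x m s) i (q i).
  by apply/funext => j; rewrite /upd; case: eqP => // ->; rewrite /x ltnn.
have xm1 s : x m.+1 s = upd (x m s) i (s i)%:R.
  apply/funext => j; rewrite /upd /x ltnS leq_eqVlt.
  have [->/=|ji] := eqVneq j i; first by rewrite eqxx.
  by rewrite (_ : val j == m = false)//; apply/negbTE; rewrite -val_eqE in ji.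
pose b s := Psi (upd (x m s) i 1) - Psi (upd (x m s) i 0).
have bP s a : Psi (upd (x m s) i a) = Psi (upd (x m s) i 0) + b s * a.
  have [b' _ h] := aff (x m s) i (x01 m s).
  by rewrite /b h [Psi (upd _ _ 1)]h mulr1 [_ + b']addrC addrK.
have bc s : `|b s| <= c.
  have [b' h1 h] := aff (x m s) i (x01 m s).
  by rewrite /b h mulr1 [_ + b']addrC addrK.
have -> : 2 * c ^+ 2 * m.+1%:R + Psi q =
    2 * c ^+ 2 + (2 * c ^+ 2 * m%:R + Psi q) by rewrite -natr1; ring.
rewrite expRD; apply: (@le_trans _ _ (expR (2 * c ^+ 2) * Z m)); last first.
  by rewrite ler_wpM2l// expR_ge0.
apply: (@le_trans _ _ ((1 + 2 * c ^+ 2) * Z m)); last first.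
  rewrite ler_wpM2r//; last exact: expR_ge1Dx.
  by apply: sumr_ge0 => s _; rewrite mulr_ge0 ?bern_ge0 ?expR_ge0.
have -> : (1 + 2 * c ^+ 2) * Z m = \sum_s bern q s *
    (expR (Psi (x m s)) * (1 + b s * ((s i)%:R - q i) + 2 * c ^+ 2)).
  transitivity ((1 + 2 * c ^+ 2) * Z m + \sum_s bern q s *
     (expR (Psi (x m s)) * b s * ((s i)%:R - q i))).
    rewrite (@bern_flip q i (fun s => expR (Psi (x m s)) * b s)) ?addr0// => s.
    by rewrite /b !xi xm xi -xm.
  rewrite mulr_sumr -big_split/=; apply: eq_bigr => s _; ring.
apply: ler_sum => s _; rewrite ler_wpM2l ?bern_ge0//.
have -> : Psi (x m.+1 s) = Psi (x m s) + b s * ((s i)%:R - q i).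
  have e2 : Psi (x m s) = Psi (upd (x m s) i 0) + b s * q i by rewrite {1}xm bP.
  by rewrite xm1 bP e2; ring.
rewrite expRD ler_wpM2l ?expR_ge0//.
have d1 : `|(s i)%:R - q i| <= 1.
  have /andP[q0 q1] := q01 i.
  by rewrite ler_norml; case: (s i) => /=; lra.
have bd : `|b s * ((s i)%:R - q i)| <= c.
  by rewrite normrM -[leRHS]mulr1 ler_pM.
apply: (le_trans (expR_le_quad (le_trans bd c12))).
rewrite lerD2l ler_wpM2l// -real_normK ?num_real//.
by rewrite lerXn2r// ?nnegrE// (le_trans (normr_ge0 _) bd).
Qed.

(** The two-sided tail bound that results from optimizing the exponent. *)
Lemma mgf_tail (T : finType) (p : T -> R) (D : T -> R) (c e : R) :
  (forall t, 0 <= p t) -> 0 < c -> 0 < e -> e <= 4 * c ->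
  (forall l, `|l| * c <= 2^-1 ->
     \sum_t p t * expR (l * D t) <= expR (4 * (l * c) ^+ 2 * n%:R)) ->
  \sum_t p t * (n%:R * e <= `|D t|)%R%:R <= 2 * expR (- (e / (4 * c)) ^+ 2 * n%:R).
Proof.
move=> p0 c0 e0 e4c H.
(* the minimizer of [4 (l c)^2 - l e] *)
pose l := e / (8 * c ^+ 2).
have l0 : 0 < l by rewrite divr_gt0// mulr_gt0// exprn_gt0.
have lc : l * c = e / (4 * c) / 2.
  by rewrite /l; field; rewrite gt_eqF.
have elc : l * e = 2 * (e / (4 * c)) ^+ 2.
  by rewrite /l; field; rewrite gt_eqF.
have lc12 : l * c <= 2^-1.
  rewrite lc -[leRHS]mul1r ler_wpM2r//.
  by rewrite ler_pdivrMr ?mul1r// mulr_gt0.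
have H1 := H l; have H2 := H (- l).
rewrite normrN !gtr0_norm// in H1 H2.
have {H1} H1 := H1 lc12; have {H2} H2 := H2 lc12.
have E : expR (- (e / (4 * c)) ^+ 2 * n%:R) =
    expR (4 * (l * c) ^+ 2 * n%:R) * expR (- (l * (n%:R * e))).
  rewrite -expRD; congr expR.
  by rewrite (mulrCA l) elc lc; field; rewrite gt_eqF.
rewrite mulNr sqrrN in H2.
rewrite E mulrA (mulrC 2).
have {H1 H2} H12 : \sum_t p t * (expR (l * D t) + expR (- l * D t)) <=
   expR (4 * (l * c) ^+ 2 * n%:R) * 2.
  rewrite (_ : \sum_ _ _ =
    \sum_t p t * expR (l * D t) + \sum_t p t * expR (- l * D t)).
    by rewrite mulr2n mulrDr !mulr1 lerD.
  by rewrite -big_split/=; apply: eq_bigr => t _; rewrite mulrDr.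
apply: (@le_trans _ _ ((\sum_t p t * (expR (l * D t) + expR (- l * D t))) *
    expR (- (l * (n%:R * e))))); last by rewrite ler_wpM2r// expR_ge0.
rewrite mulr_suml; apply: ler_sum => t _; rewrite -mulrA ler_wpM2l//.
case: (leP (n%:R * e)) => /= [ned|_]; last by rewrite mulr0n mulr_ge0// ?addr_ge0 ?expR_ge0.
rewrite mulr1n mulrDl -!expRD.
case: (leP 0 (D t)) ned => D0 ned.
- rewrite ger0_norm// in ned; apply: ler_wpDr; first exact: expR_ge0.
  by rewrite -[leLHS]expR0 ler_expR subr_ge0 ler_pM2l.
- rewrite ltr0_norm// in ned; apply: ler_wpDl; first exact: expR_ge0.
  by rewrite -[leLHS]expR0 ler_expR mulNr -mulrN subr_ge0 ler_pM2l.
Qed.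

End bernoulli.

(** * Geometry of nearest-neighbour graphs *)

Section packing.
Context (R : realType) (k : nat).

Definition pack_bound (C e : R) : nat :=
  let m := (Num.truncn (k%:R / e)).+1 in
  ((Num.truncn (2 * C * m%:R)).+1 ^ k)%N.

(** Two points in the same cell of a grid of mesh [1/m] are at squared distance
    at most [k / m^2 < e], so that the points lie in distinct cells. *)
Lemma packing (T : finType) (A : {set T}) (u : T -> 'I_k -> R) (C e : R) :
  0 < e -> (forall t l, t \in A -> `|u t l| <= C) ->
  (forall t t', t \in A -> t' \in A -> t != t' ->
     e <= \sum_l (u t l - u t' l) ^+ 2) ->
  (#|A| <= pack_bound C e)%N.
Proof.
move=> e0 uC sep; rewrite /pack_bound.
set m := (Num.truncn (k%:R / e)).+1; set B := Num.truncn _.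
have m0 : 0 < m%:R :> R by rewrite ltr0n.
have mke : k%:R / e < m%:R by exact: truncnS_gt.
pose y t l := (u t l + C) * m%:R.
pose c t : {ffun 'I_k -> 'I_B.+1} := [ffun l => inord (Num.truncn (y t l))].
have y0 t l : t \in A -> 0 <= y t l.
  move=> tA; rewrite mulr_ge0 ?(ltW m0)//.
  by have := uC t l tA; rewrite ler_norml => /andP[h _]; rewrite -lerBlDr sub0r.
have cE t l : t \in A -> c t l = Num.truncn (y t l) :> nat.
  move=> tA; rewrite ffunE inordK// ltnS; apply: Num.Theory.le_truncn.
  rewrite ler_wpM2r ?(ltW m0)//.
  by have := uC t l tA; rewrite ler_norml => /andP[_ h]; lra.
have cinj : {in A &, injective c}.
  move=> t t' tA t'A ct; apply/eqP; apply/negPn/negP => tt'.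
  have := sep _ _ tA t'A tt'; apply/negP; rewrite -ltNge.
  have H l : (u t l - u t' l) ^+ 2 <= (m%:R ^+ 2)^-1.
    have e1 : Num.truncn (y t l) = Num.truncn (y t' l).
      by rewrite -!cE// ct.
    have /andP[h1 h2] := truncn_itv (y0 t l tA).
    have /andP[h3 h4] := truncn_itv (y0 t' l t'A).
    rewrite e1 -natr1 in h1 h2; rewrite -natr1 in h4.
    have : `|y t l - y t' l| <= 1 by rewrite ler_norml; lra.
    rewrite /y -mulrBl opprD addrACA subrr addr0 normrM (gtr0_norm m0) => h.
    rewrite -exprVn -real_normK ?num_real// lerXn2r ?nnegrE ?normr_ge0 ?invr_ge0 ?ler0n//.
    by rewrite -[leRHS]mul1r ler_pdivlMr.
  apply: (@le_lt_trans _ _ (k%:R / m%:R ^+ 2)).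
    apply: le_trans (ler_sum _ (fun l _ => H l)) _.
    by rewrite sumr_const card_ord mulr_natl.
  rewrite ltr_pdivrMr ?exprn_gt0//.
  apply: (@lt_le_trans _ _ (e * m%:R)).
    by rewrite mulrC -ltr_pdivrMr.
  by rewrite ler_pM2l// ler_eXnr// ler1n.
rewrite -(card_in_imset cinj); apply: (leq_trans (max_card _)).
by rewrite card_ffun !card_ord.
Qed.

Lemma eucl_dist_ge0 (u v : k.-tuple R) : 0 <= eucl_dist u v.
Proof. exact: sqrtr_ge0. Qed.

Lemma sqr_eucl_dist (u v : k.-tuple R) :
  eucl_dist u v ^+ 2 = \sum_(i < k) (tnth u i - tnth v i) ^+ 2.
Proof. by rewrite sqr_sqrtr// sumr_ge0// => i _; exact: sqr_ge0. Qed.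

Lemma le_coord_eucl_dist (u v : k.-tuple R) l :
  `|tnth u l - tnth v l| <= eucl_dist u v.
Proof.
rewrite -sqrtr_sqr ler_wsqrtr// (bigD1 l)//= lerDl.
by rewrite sumr_ge0// => i _; exact: sqr_ge0.
Qed.

Lemma eucl_dist_eq0 (u v : k.-tuple R) : (eucl_dist u v == 0) = (u == v).
Proof.
apply/idP/eqP => [/eqP uv0|->].
  apply: eq_from_tnth => l; apply/eqP; rewrite -subr_eq0 -normr_le0 -uv0.
  exact: le_coord_eucl_dist.
by rewrite /eucl_dist big1 ?sqrtr0// => i _; rewrite subrr expr0n.
Qed.

End packing.

Section weights.
Context (R : realType) (k n : nat).
Implicit Types (x : 'I_n -> k.-tuple R).

(** The conditional probability, given the points, that the neighbour chosen for
    [i] is [j]. *)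
Definition nn_weight x (i j : 'I_n) : R :=
  let A := nearest x i in if j \in A then (#|A|%:R)^-1 else 0.

Lemma nearestP x i j : reflect
  (j != i /\ forall l, l != i -> eucl_dist (x i) (x j) <= eucl_dist (x i) (x l))
  (j \in nearest x i).
Proof.
rewrite inE; apply: (iffP andP) => [[ji /forallP h]|[ji h]]; split => //.
  by move=> l li; have := h l; rewrite li.
by apply/forallP => l; apply/implyP; exact: h.
Qed.

Lemma nearest_neq0 x i : (2 <= n)%N -> nearest x i != finset.set0.
Proof.
move=> n2; have [j0 j0i] : exists j, j != i.
  have : (1 < #|[set: 'I_n]%SET|)%N by rewrite cardsT card_ord.
  case/card_gt1P => a [b [_ _ ab]].
  by have [ai|] := eqVneq a i; [exists b; rewrite -ai eq_sym|exists a].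
case: (@arg_minP _ _ _ j0 (fun j => j != i) (fun j => eucl_dist (x i) (x j)) j0i).
move=> j ji h.
by apply/finset.set0Pn; exists j; apply/nearestP.
Qed.

Lemma nn_weight_ge0 x i j : 0 <= nn_weight x i j.
Proof. by rewrite /nn_weight; case: ifP => // _; rewrite invr_ge0. Qed.

Lemma nn_weight_diag x i : nn_weight x i i = 0.
Proof. by rewrite /nn_weight; case: ifP => // /nearestP[]; rewrite eqxx. Qed.

Lemma nn_weight_le1 x i j : nn_weight x i j <= 1.
Proof.
rewrite /nn_weight; case: ifPn => // ij; rewrite invf_le1 ?ler1n ?ltr0n.
all: by apply/card_gt0P; exists j.
Qed.

Lemma sum_nn_weight x i : (2 <= n)%N -> \sum_j nn_weight x i j = 1.
Proof.
move=> n2; rewrite /nn_weight -big_mkcond/= sumr_const.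
by rewrite -[LHS]mulr_natr mulVf// pnatr_eq0 cards_eq0 nearest_neq0.
Qed.

(** Coincident points: the nearest neighbours of both are the other points at
    that location, so that the weights are symmetric. *)
Lemma nn_weight_sym x i j : x i = x j -> nn_weight x i j = nn_weight x j i.
Proof.
move=> xij; have [->//|ij] := eqVneq i j.
have d0 (a b : 'I_n) : x a = x b -> eucl_dist (x a) (x b) = 0.
  by move=> ab; apply/eqP; rewrite eucl_dist_eq0 ab.
have N a b : a != b -> x a = x b ->
    nearest x a = ([set l | x l == x b] :\ a)%SET.
  move=> ab xab; apply/setP => l.
  apply/nearestP/setD1P => -[la]; rewrite inE => h; split => //.
    rewrite -xab eq_sym -eucl_dist_eq0 eq_le eucl_dist_ge0 andbT.
    by rewrite -(d0 _ _ xab) h// eq_sym.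
  by move=> c _; rewrite d0 ?eucl_dist_ge0// (eqP h).
have ji : j != i by rewrite eq_sym.
rewrite /nn_weight (N i j)// (N j i)// !in_setD1 !inE xij !eqxx ij ji/=.
set S := [set l | x l == x j]%SET.
have iS : i \in S by rewrite inE xij.
have jS : j \in S by rewrite inE.
congr (_%:R^-1); apply/eqP; rewrite -(eqn_add2l 1).
by have := cardsD1 i S; have := cardsD1 j S; rewrite iS jS => -> ->.
Qed.

(** Coincident points contribute at most one, the others at most the size of a
    family of unit vectors at mutual distances at least one. *)
Definition indeg : nat := (1 + pack_bound k (1 : R) 1)%N.

(** Stone's geometric lemma: seen from [x j], two points that have [x j] as a
    nearest neighbour lie in directions at distance at least one, since
    otherwise the farther one would be closer to the other point. *)
Lemma in_weight_le x j : (2 <= n)%N -> \sum_i nn_weight x i j <= indeg%:R.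
Proof.
move=> n2; rewrite (bigID (fun i => x i == x j))/= natrD; apply: lerD.
  apply: (@le_trans _ _ (\sum_i nn_weight x j i)); last by rewrite sum_nn_weight.
  rewrite [leRHS](bigID (fun i => x i == x j))/= -[leLHS]addr0 lerD//.
    by apply: ler_sum => i /eqP/nn_weight_sym ->.
  by apply: sumr_ge0 => i _; exact: nn_weight_ge0.
pose S := [set i | (x i != x j) && (j \in nearest x i)]%SET.
apply: (@le_trans _ _ (\sum_(i | x i != x j) (i \in S)%:R)).
  apply: ler_sum => i xij; rewrite inE xij/=.
  have [jN|jN] := boolP (j \in _); first exact: nn_weight_le1.
  by rewrite /nn_weight (negbTE jN).
apply: (@le_trans _ _ #|S|%:R).
  rewrite -sum1_card natr_sum [leRHS]big_mkcond/= [leLHS]big_mkcond/=.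
  by apply: ler_sum => i _; case: ifP => _; case: ifP => //; rewrite ?ler01.
rewrite ler_nat.
pose v i l := tnth (x i) l - tnth (x j) l.
pose r i := eucl_dist (x i) (x j).
have r2 i : r i ^+ 2 = \sum_l v i l ^+ 2 by exact: sqr_eucl_dist.
have r0 i : i \in S -> 0 < r i.
  by rewrite inE => /andP[xij _]; rewrite lt_def eucl_dist_ge0 eucl_dist_eq0 xij.
apply: (@packing _ _ _ S (fun i l => v i l / r i)) => //.
  move=> i l iS; rewrite normrM normfV (gtr0_norm (r0 _ iS)).
  by rewrite ler_pdivrMr ?r0// mul1r; exact: le_coord_eucl_dist.
(* by symmetry, [i'] is the point farther from [x j] *)
suff main i i' : i \in S -> i' \in S -> i != i' -> r i <= r i' ->
    1 <= \sum_l (v i l / r i - v i' l / r i') ^+ 2.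
  move=> i i' iS i'S ii'; case: (leP (r i) (r i')) => [|/ltW] rr.
    exact: main.
  rewrite (eq_bigr (fun l => (v i' l / r i' - v i l / r i) ^+ 2)).
    by apply: main => //; rewrite eq_sym.
  by move=> l _; rewrite -sqrrN opprB.
move=> iS i'S ii' rr.
have a0 := r0 _ iS; have b0 := r0 _ i'S.
have : j \in nearest x i' by move: i'S; rewrite inE => /andP[].
case/nearestP => _ /(_ i ii'); rewrite -/(r i') => h.
have {h} : r i' ^+ 2 <= eucl_dist (x i') (x i) ^+ 2.
  by rewrite lerXn2r// nnegrE ?eucl_dist_ge0// ltW.
pose d := \sum_l v i l * v i' l.
have -> : eucl_dist (x i') (x i) ^+ 2 = r i' ^+ 2 + r i ^+ 2 - 2 * d.
  rewrite sqr_eucl_dist !r2 /d mulr_sumr -sumrN -!big_split/=.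
  by apply: eq_bigr => l _; rewrite /v; ring.
have -> : \sum_l (v i l / r i - v i' l / r i') ^+ 2 =
    (r i)^-2 * r i ^+ 2 + (r i')^-2 * r i' ^+ 2 - 2 / (r i * r i') * d.
  have e i0 : (r i0)^-2 * r i0 ^+ 2 = \sum_l (v i0 l / r i0) ^+ 2.
    rewrite {2}r2 mulr_sumr; apply: eq_bigr => l _.
    by rewrite exprMn exprVn mulrC.
  rewrite !e /d !mulr_sumr -sumrN -!big_split/=.
  apply: eq_bigr => l _; field.
  by rewrite !gt_eqF.
rewrite !mulVf ?expf_neq0 ?gt_eqF// => h.
have hd : 2 * d <= r i * r i'.
  by apply: (@le_trans _ _ (r i ^+ 2)); [lra|rewrite expr2 ler_pM2l].
suff : 2 / (r i * r i') * d <= 1 by lra.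
by rewrite mulrAC ler_pdivrMr ?mul1r// mulr_gt0.
Qed.

(** Lipschitz functions that increase to the indicator of the half-space
    [tnth v l < c] as [m] grows. *)
Definition clip_coord (m c : R) (l : 'I_k) (v : k.-tuple R) : R :=
  Num.min 1 (Num.max 0 (m * (c - tnth v l))).

Lemma clip_coord_lip (m c : R) l v v' : 0 <= m ->
  `|clip_coord m c l v - clip_coord m c l v'| <= m * `|tnth v l - tnth v' l|.
Proof.
move=> m0; rewrite /clip_coord.
have -> : m * `|tnth v l - tnth v' l| =
   `|m * (c - tnth v l) - m * (c - tnth v' l)|.
  rewrite -mulrBr normrM (ger0_norm m0) -normrN; congr (_ * `|_|); ring.
move: (m * (c - tnth v l)) (m * (c - tnth v' l)) => a b.
rewrite /Num.min /Num.max !(fun_if, if_arg).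
have -> : (1 < 0 :> R) = false by rewrite ltNge ler01.
case: (ltP 0 a) => ?; case: (ltP 0 b) => ?; case: (ltP 1 a) => ?;
  case: (ltP 1 b) => ? //=;
  by rewrite ler_norml; case: (ger0P (a - b)) => ?; apply/andP; split; lra.
Qed.

(** Few bounded points can be far from all the others, by packing. *)
Lemma disp_clip_le x (m c C e : R) l : (2 <= n)%N -> 0 <= m -> 0 < e ->
  \sum_i \sum_j nn_weight x i j *
     `|clip_coord m c l (x i) - clip_coord m c l (x j)| <=
  n%:R * (m * e) + (pack_bound k C (e ^+ 2))%:R +
  \sum_i (~~ [forall a, `|tnth (x i) a| <= C]%R)%:R.
Proof.
move=> n2 m0 e0.
(* the isolated points, and the bounded ones *)
pose iso := [set i | [forall j, (j != i) ==> (e < eucl_dist (x i) (x j))] ]%SET.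
pose bd := [set i | [forall a, `|tnth (x i) a| <= C]%R]%SET.
have clip01 v : 0 <= clip_coord m c l v <= 1.
  by rewrite /clip_coord ge_min le_min lexx ler01 le_max lexx.
have H i : \sum_j nn_weight x i j *
     `|clip_coord m c l (x i) - clip_coord m c l (x j)| <=
     m * e + (i \in iso :&: bd)%SET%:R + (i \notin bd)%:R.
  have [iI|iI] := boolP (i \in iso).
    apply: (@le_trans _ _ 1).
      rewrite -(sum_nn_weight x i n2); apply: ler_sum => j _.
      rewrite -[leRHS]mulr1 ler_wpM2l ?nn_weight_ge0//.
      by have /andP[? ?] := clip01 (x i); have /andP[? ?] := clip01 (x j);
        rewrite ler_norml; lra.
    rewrite inE iI/=; have me : 0 <= m * e by rewrite mulr_ge0// ltW.
    by case: (i \in bd) => /=; rewrite ?mulr1n ?mulr0n; lra.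
  apply: (@le_trans _ _ (m * e)); last by rewrite -addrA lerDl addr_ge0.
  rewrite -[leRHS]mul1r -(sum_nn_weight x i n2) mulr_suml; apply: ler_sum => j _.
  have [jN|jN] := boolP (j \in nearest x i); last first.
    by rewrite /nn_weight (negbTE jN) !mul0r.
  rewrite ler_wpM2l ?nn_weight_ge0//.
  apply: (le_trans (clip_coord_lip _ _ _ _ m0)); rewrite ler_wpM2l//.
  apply: (le_trans (le_coord_eucl_dist _ _ _)).
  move: iI; rewrite inE negb_forall => /existsP[a].
  rewrite negb_imply -leNgt => /andP[ai]; apply: le_trans.
  by move/nearestP : jN => [_]; exact.
apply: (le_trans (ler_sum _ (fun i _ => H i))).
rewrite !big_split/= sumr_const card_ord mulr_natl -[leRHS]addrA -[leLHS]addrA lerD2l.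
apply: lerD; last by apply: ler_sum => i _; rewrite inE.
rewrite -natr_sum ler_nat.
have -> : (\sum_(i < n) (i \in iso :&: bd)%SET)%N = #|(iso :&: bd)%SET|.
  by rewrite -sum1_card [RHS]big_mkcond; apply: eq_bigr => i _; case: (_ \in _).
apply: (@packing _ _ _ _ (fun i a => tnth (x i) a)) => [|i a|i j]; first 1 last.
- by rewrite inE => /andP[_]; rewrite inE => /forallP.
- rewrite inE => /andP[+ _] _; rewrite inE => /forallP h.
  rewrite eq_sym => ji; have := h j; rewrite ji/= => /ltW d.
  by rewrite -sqr_eucl_dist lerXn2r// nnegrE ?eucl_dist_ge0// ltW.
- exact: exprn_gt0.
Qed.
End weights.

(** * Expectations of bounded functions *)

Section bounded_measurable.
Context d (T : measurableType d) (R : realType).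
Implicit Types f g : T -> R.

Definition bmeas f :=
  measurable_fun [set: T] f /\ exists M : R, forall x, `|f x| <= M.

Lemma bmeas_cst (c : R) : bmeas (fun=> c).
Proof. by split; [exact: measurable_cst|exists `|c|]. Qed.

Lemma bmeasD f g : bmeas f -> bmeas g -> bmeas (fun x => f x + g x).
Proof.
move=> [mf [M fM]] [mg [N gN]]; split; first exact: measurable_funD.
by exists (M + N) => x; rewrite (le_trans (ler_normD _ _))// lerD.
Qed.

Lemma bmeasM f g : bmeas f -> bmeas g -> bmeas (fun x => f x * g x).
Proof.
move=> [mf [M fM]] [mg [N gN]]; split; first exact: measurable_funM.
by exists (M * N) => x; rewrite normrM ler_pM.
Qed.

Lemma bmeasN f : bmeas f -> bmeas (fun x => - f x).
Proof.
move=> [mf [M fM]]; split; first exact: measurableT_comp.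
by exists M => x; rewrite normrN.
Qed.

Lemma bmeasB f g : bmeas f -> bmeas g -> bmeas (fun x => f x - g x).
Proof. by move=> bf bg; apply: bmeasD => //; exact: bmeasN. Qed.

Lemma bmeasZ c f : bmeas f -> bmeas (fun x => c * f x).
Proof. by move=> bf; apply: bmeasM => //; exact: bmeas_cst. Qed.

Lemma bmeasX f n : bmeas f -> bmeas (fun x => f x ^+ n).
Proof.
move=> bf; elim: n => [|n ih]; first by rewrite (_ : (fun=> _) = fun=> 1)//; exact: bmeas_cst.
rewrite (_ : (fun _ => _) = fun x => f x * f x ^+ n); first exact: bmeasM.
by apply/funext => x; rewrite exprS.
Qed.

Lemma bmeas_norm f : bmeas f -> bmeas (fun x => `|f x|).
Proof.
move=> [mf [M fM]]; split; first exact: measurableT_comp.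
by exists M => x; rewrite normr_id.
Qed.

Lemma bmeas_sum I (s : seq I) (p : pred I) (f : I -> T -> R) :
  (forall i, bmeas (f i)) -> bmeas (fun x => \sum_(i <- s | p i) f i x).
Proof.
move=> bf; elim: s => [|i s ih].
  by under eq_fun do rewrite big_nil; exact: bmeas_cst.
under eq_fun do rewrite big_cons.
by case: (p i) => //; exact: bmeasD.
Qed.

Lemma bmeas_prod I (s : seq I) (p : pred I) (f : I -> T -> R) :
  (forall i, bmeas (f i)) -> bmeas (fun x => \prod_(i <- s | p i) f i x).
Proof.
move=> bf; elim: s => [|i s ih].
  by under eq_fun do rewrite big_nil; exact: bmeas_cst.
under eq_fun do rewrite big_cons.
by case: (p i) => //; exact: bmeasM.
Qed.

Lemma bmeas_indic (A : set T) : measurable A -> bmeas (\1_A : T -> R).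
Proof.
move=> mA; split; first exact: measurable_indic.
by exists 1 => x; rewrite indicE; case: (_ \in _); rewrite ?normr1 ?normr0.
Qed.

Lemma bmeas01 f : measurable_fun [set: T] f -> (forall x, 0 <= f x <= 1) ->
  bmeas f.
Proof.
move=> mf f01; split => //; exists 1 => x.
by have /andP[f0 f1] := f01 x; rewrite ger0_norm.
Qed.

End bounded_measurable.

Lemma bmeas_comp d (T : measurableType d) d' (S : measurableType d')
  (R : realType) (h : S -> R) (U : T -> S) :
  measurable_fun [set: T] U -> bmeas h -> bmeas (h \o U).
Proof.
move=> mU [mh [M hM]]; split; first exact: measurableT_comp.
by exists M => x; exact: hM.
Qed.

Definition Ex d (T : measurableType d) (R : realType) (P : probability T R)
  (f : T -> R) : R := (\int[P]_x f x)%R.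

Section expectation.
Context d (T : measurableType d) (R : realType) (P : probability T R).
Implicit Types f g : T -> R.

Lemma bmeas_integrable f : bmeas f -> P.-integrable [set: T] (EFin \o f).
Proof.
move=> [mf [M fM]]; apply: measurable_bounded_integrable => //.
  by rewrite (le_lt_trans (probability_le1 P _))// ltry.
by exists M; split; [rewrite num_real|move=> y My x _ /=; rewrite (le_trans (fM x))// ltW].
Qed.

Lemma EFin_Ex f : bmeas f -> (Ex P f)%:E = (\int[P]_x (f x)%:E)%E.
Proof.
move=> bf; rewrite fineK//; apply: integrable_fin_num => //.
exact: bmeas_integrable.
Qed.

Lemma ExD f g : bmeas f -> bmeas g ->
  Ex P (fun x => f x + g x) = Ex P f + Ex P g.
Proof. by move=> bf bg; apply: RintegralD => //; exact: bmeas_integrable. Qed.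

Lemma ExB f g : bmeas f -> bmeas g ->
  Ex P (fun x => f x - g x) = Ex P f - Ex P g.
Proof. by move=> bf bg; apply: RintegralB => //; exact: bmeas_integrable. Qed.

Lemma ExZ c f : bmeas f -> Ex P (fun x => c * f x) = c * Ex P f.
Proof. by move=> bf; apply: RintegralZl => //; exact: bmeas_integrable. Qed.

Lemma Ex_cst c : Ex P (fun=> c) = c.
Proof. by rewrite /Ex Rintegral_cst//= probability_setT mulr1. Qed.

Lemma Ex_ge0 f : (forall x, 0 <= f x) -> 0 <= Ex P f.
Proof. by move=> f0; apply: Rintegral_ge0 => x _. Qed.

Lemma Ex_le f g : bmeas f -> bmeas g -> (forall x, f x <= g x) ->
  Ex P f <= Ex P g.
Proof.
by move=> bf bg fg; apply: le_Rintegral => //; exact: bmeas_integrable.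
Qed.

Lemma Ex_norm f : bmeas f -> `|Ex P f| <= Ex P (fun x => `|f x|).
Proof. by move=> bf; apply: le_normr_Rintegral => //; exact: bmeas_integrable. Qed.

Lemma Ex_sum I (s : seq I) (p : pred I) (f : I -> T -> R) :
  (forall i, bmeas (f i)) ->
  Ex P (fun x => \sum_(i <- s | p i) f i x) = \sum_(i <- s | p i) Ex P (f i).
Proof.
move=> bf; elim: s => [|i s ih].
  by rewrite big_nil; under eq_fun do rewrite big_nil; exact: Ex_cst.
rewrite big_cons; under eq_fun do rewrite big_cons.
case: (p i) => //; rewrite ExD ?ih//.
exact: bmeas_sum.
Qed.

Lemma Ex_indic (A : set T) : measurable A -> Ex P \1_A = fine (P A).
Proof. by move=> mA; rewrite /Ex /Rintegral integral_indic// setIT. Qed.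

Lemma EFin_Ex_indic (A : set T) : measurable A -> (Ex P \1_A)%:E = P A.
Proof. by move=> mA; rewrite Ex_indic// fineK// fin_num_measure. Qed.

Lemma integral_restr (f : T -> R) (D : set T) :
  (\int[P]_(x in D) (f x)%:E = \int[P]_x (f x * \1_D x)%:E)%E.
Proof.
rewrite integral_mkcond; apply: eq_integral => x _.
by rewrite patchE indicE; case: (_ \in _); rewrite ?mulr1 ?mulr0.
Qed.

End expectation.

Section level_sets.
Context (R : realType).

Definition level_sum (N : nat) (y : R) : R :=
  N.+1%:R^-1 * \sum_(i < N.+1) (i.+1%:R / N.+1%:R <= y)%R%:R.

(** Layer cake: this reduces functions with values in the unit interval to
    indicators of their level sets, uniformly. *)
Lemma level_sum_approx N (y : R) : 0 <= y <= 1 ->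
  `|y - level_sum N y| <= N.+1%:R^-1.
Proof.
move=> /andP[y0 y1]; rewrite /level_sum.
have N0 : 0 < N.+1%:R :> R by rewrite ltr0n.
set t := Num.truncn (y * N.+1%:R).
have yN : 0 <= y * N.+1%:R by rewrite mulr_ge0// ltW.
have tN : (t <= N.+1)%N.
  rewrite -(ler_nat R); apply: (@le_trans _ _ (y * N.+1%:R)).
    by have /andP[] := truncn_itv yN.
  by rewrite ger_pMl.
have -> : \sum_(i < N.+1) (i.+1%:R / N.+1%:R <= y)%R%:R = t%:R :> R.
  rewrite -natr_sum; congr (_%:R).
  rewrite (eq_bigr (fun i : 'I_N.+1 => nat_of_bool (i < t)%N)); last first.
    by move=> i _; rewrite ler_pdivrMr// -truncn_gt_nat.
  have -> m : (\sum_(i < m) (i < t) = minn m t)%N.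
    elim: m => [|m ih]; first by rewrite big_ord0 min0n.
    by rewrite big_ord_recr/= ih; lia.
  exact/minn_idPr.
have /andP[t1 t2] := truncn_itv yN.
rewrite -/t in t1 t2; rewrite -/t -[t.+1%:R]natr1 in t2; rewrite mulrC.
rewrite -(@ler_pM2r _ N.+1%:R)// mulVf ?gt_eqF// -[X in _ * X](gtr0_norm N0).
rewrite -normrM mulrBl divfK ?gt_eqF// ger0_norm ?subr_ge0//.
by rewrite lerBlDl ltW.
Qed.

End level_sets.

Section weighted_laws.
Context (R : realType) d1 (T1 : measurableType d1) (P1 : probability T1 R)
  d2 (T2 : measurableType d2) (P2 : probability T2 R)
  dS (S : measurableType dS) (U1 : T1 -> S) (U2 : T2 -> S)
  (a1 : T1 -> R) (a2 : T2 -> R).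
Hypotheses (mU1 : measurable_fun [set: T1] U1) (mU2 : measurable_fun [set: T2] U2).
Hypotheses (ba1 : bmeas a1) (ba2 : bmeas a2).
Hypotheses (a10 : forall x, 0 <= a1 x) (a20 : forall x, 0 <= a2 x).

Let same (C : set S) := Ex P1 (fun x => a1 x * \1_C (U1 x)) =
                        Ex P2 (fun x => a2 x * \1_C (U2 x)).

(** Dynkin's pi-lambda argument; the densities [a1] and [a2] stand for the part
    of an event that does not depend on [U1] and [U2]. *)
Lemma eq_weighted_pi (G : set (set S)) :
  @measurable _ S = <<s G >> -> setI_closed G -> G [set: S] ->
  (forall C, G C -> same C) -> forall C, measurable C -> same C.
Proof.
move=> GE GI GT GP C; rewrite GE; apply: (dynkin_induction GE GI) => //.
- exact: GP.
- move=> {}C mC CP.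
  have ET d (T : measurableType d) (P : probability T R) (U : T -> S) (a : T -> R) :
      measurable_fun [set: T] U -> bmeas a ->
      Ex P (fun x => a x * \1_(~` C) (U x)) =
      Ex P (fun x => a x * \1_[set: S] (U x)) - Ex P (fun x => a x * \1_C (U x)).
    move=> mU ba.
    have bC (B : set S) : measurable B -> bmeas (fun x => a x * \1_B (U x)).
      by move=> mB; apply: bmeasM => //; apply: bmeas_comp => //; exact: bmeas_indic.
    rewrite -ExB//; try exact: bC.
    congr Ex; apply/funext => x; rewrite -mulrBr !indicE in_setC in_setT.
    by case: (_ \in _); rewrite ?subrr ?subr0.
  by rewrite /same !ET// CP (GP _ GT).
- move=> F mF tF FP; rewrite /same.
  have EU d (T : measurableType d) (P : probability T R) (U : T -> S) (a : T -> R) :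
      measurable_fun [set: T] U -> bmeas a -> (forall x, 0 <= a x) ->
      (Ex P (fun x => a x * \1_(\bigcup_k F k) (U x)))%:E =
      (\sum_(k <oo) (Ex P (fun x => a x * \1_(F k) (U x)))%:E)%E.
    move=> mU ba a0.
    have bC (B : set S) : measurable B ->
        (Ex P (fun x => a x * \1_B (U x)))%:E = (\int[P]_(x in U @^-1` B) (a x)%:E)%E.
      move=> mB; rewrite [RHS]integral_restr EFin_Ex//.
      by apply: bmeasM => //; apply: bmeas_comp => //; exact: bmeas_indic.
    rewrite bC; last exact: bigcup_measurable.
    rewrite preimage_bigcup ge0_integral_bigcup//=.
    - by apply: eq_eseriesr => k _; rewrite bC.
    - by move=> k; rewrite -[_ @^-1` _]setTI; exact: mU.
    - by apply: measurable_funTS; apply/measurable_EFinP; case: ba.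
    - by move=> x _; rewrite lee_fin.
    - by move=> i j _ _ [x [Fi Fj]]; apply: tF => //; exists (U x).
  apply: EFin_inj; rewrite !EU//.
  by apply: eq_eseriesr => k _; rewrite FP.
Qed.

(** The passage from events to functions is by layers. *)
Lemma eq_weighted_Ex (f : S -> R) : measurable_fun [set: S] f ->
  (forall s, 0 <= f s <= 1) -> (forall C, measurable C -> same C) ->
  Ex P1 (fun x => a1 x * f (U1 x)) = Ex P2 (fun x => a2 x * f (U2 x)).
Proof.
move=> mf f01 sm.
have bl N : bmeas (fun s => level_sum N (f s)).
  apply: bmeasZ; apply: bmeas_sum => i.
  rewrite (_ : (fun _ => _) = \1_(f @^-1` `[i.+1%:R / N.+1%:R, +oo[)).
    by apply: bmeas_indic; rewrite -[_ @^-1` _]setTI; exact: mf.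
  apply/funext => s; rewrite indicE; congr (_%:R); congr nat_of_bool.
  by apply/idP/idP => [h|]; [rewrite inE/= in_itv/= h|rewrite inE/= in_itv/= andbT].
have ET N d (T : measurableType d) (P : probability T R) (U : T -> S) (a : T -> R) :
    measurable_fun [set: T] U -> bmeas a -> (forall x, 0 <= a x) ->
    `|Ex P (fun x => a x * f (U x)) - Ex P (fun x => a x * level_sum N (f (U x)))|
    <= Ex P a * N.+1%:R^-1.
  move=> mU ba a0.
  have b1 : bmeas (fun x => a x * f (U x)).
    by apply: bmeasM => //; apply: bmeas_comp => //; exact: bmeas01.
  have b2 : bmeas (fun x => a x * level_sum N (f (U x))).
    by apply: bmeasM => //; apply: (bmeas_comp mU (bl N)).
  rewrite -ExB//; apply: (le_trans (Ex_norm _ _)); first exact: bmeasB.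
  rewrite mulrC -ExZ//; apply: Ex_le; [exact/bmeas_norm/bmeasB|exact: bmeasZ|].
  move=> x; rewrite -mulrBr normrM (ger0_norm (a0 x)) mulrC ler_wpM2r//.
  exact: level_sum_approx.
have EL N d (T : measurableType d) (P : probability T R) (U : T -> S) (a : T -> R) :
    measurable_fun [set: T] U -> bmeas a ->
    Ex P (fun x => a x * level_sum N (f (U x))) =
    N.+1%:R^-1 * \sum_(i < N.+1)
      Ex P (fun x => a x * \1_(f @^-1` `[i.+1%:R / N.+1%:R, +oo[) (U x)).
  move=> mU ba.
  have b1 i : bmeas (fun x => a x * \1_(f @^-1` `[i.+1%:R / N.+1%:R, +oo[) (U x)).
    apply: bmeasM => //; apply: bmeas_comp => //; apply: bmeas_indic.
    by rewrite -[_ @^-1` _]setTI; exact: mf.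
  rewrite -Ex_sum// -ExZ//; last exact: bmeas_sum.
  congr Ex; apply/funext => x; rewrite /level_sum mulrCA mulr_sumr; congr (_ * _).
  apply: eq_bigr => i _; rewrite indicE; congr (_ * _%:R); congr nat_of_bool.
  by apply/idP/idP => [h|]; [rewrite inE/= in_itv/= h|rewrite inE/= in_itv/= andbT].
have key N : `|Ex P1 (fun x => a1 x * f (U1 x)) - Ex P2 (fun x => a2 x * f (U2 x))|
    <= (Ex P1 a1 + Ex P2 a2) * N.+1%:R^-1.
  have h1 := ET N _ _ P1 _ _ mU1 ba1 a10; have h2 := ET N _ _ P2 _ _ mU2 ba2 a20.
  rewrite mulrDl; apply: le_trans (lerD h1 h2).
  have -> : Ex P1 (fun x => a1 x * level_sum N (f (U1 x))) =
            Ex P2 (fun x => a2 x * level_sum N (f (U2 x))).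
    rewrite !EL//; congr (_ * _); apply: eq_bigr => i _; apply: sm.
    by rewrite -[_ @^-1` _]setTI; exact: mf.
  rewrite [X in _ <= _ + X]distrC; exact: (ler_distD (Ex P2 (fun x => a2 x * level_sum N (f (U2 x))))).
apply/eqP; rewrite -subr_eq0 -normr_le0; apply/ler_addgt0Pl => e e0.
rewrite addr0; set B := Ex P1 a1 + Ex P2 a2 in key.
have B0 : 0 <= B by rewrite addr_ge0// Ex_ge0.
apply: (le_trans (key (Num.truncn (B / e)))).
rewrite ler_pdivrMr// mulrC -ler_pdivrMr// ltW//; exact: truncnS_gt.
Qed.

End weighted_laws.

(** * Independent copies *)

Section iid.
Context (R : realType) d0 (Omega0 : measurableType d0) (P0 : probability Omega0 R)
  d (Omega : measurableType d) (P : probability Omega R)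
  dS (S : measurableType dS) (W0 : Omega0 -> S) (W : nat -> Omega -> S).
Hypotheses (mW0 : measurable_fun [set: Omega0] W0)
  (mW : forall i, measurable_fun [set: Omega] (W i)).
Hypothesis iidW : iid_copies P0 P W0 W.

Lemma iid_prod_indic n (C : nat -> set S) : (forall i, measurable (C i)) ->
  Ex P (fun w => \prod_(i < n) \1_(C i) (W i w)) =
  \prod_(i < n) Ex P0 (\1_(C i) \o W0).
Proof.
move=> mC; case: iidW => [same indep].
have mP i : measurable (W i @^-1` C i) by rewrite -[_ @^-1` _]setTI; exact: mW.
have mP0 i : measurable (W0 @^-1` C i) by rewrite -[_ @^-1` _]setTI; exact: mW0.
pose I := seq_fset tt (iota 0 n).
have Iin i : (i \in I) = (i < n)%N by rewrite seq_fsetE mem_iota.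
rewrite (_ : (fun _ => _) = \1_(\bigcap_(i in [set` I]) (W i @^-1` C i))); last first.
  apply/funext => w; rewrite indicE; have [h|h] := boolP (_ \in _).
    rewrite big1// => i _; rewrite indicE mem_set//.
    by have := set_mem h; apply; rewrite /= Iin.
  apply/eqP; rewrite prodf_seq_eq0; apply/hasP.
  apply: contrapT => h'; move/negP : h; apply; rewrite inE => i /=.
  rewrite Iin => ni; apply: contrapT => Ci; apply: h'.
  exists (Ordinal ni); rewrite ?mem_index_enum//= indicE memNset//.
apply: EFin_inj; rewrite EFin_Ex_indic; last first.
  by apply: fin_bigcap_measurable => // i _; exact: mP.
rewrite indep// -prodEFin.
rewrite (eq_bigr (fun i => (Ex P0 (\1_(C i) \o W0))%:E)); last first.
  move=> i _; rewrite same// (_ : _ \o _ = \1_(W0 @^-1` C i)) ?EFin_Ex_indic//.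
rewrite !prodEFin; congr EFin.
rewrite (perm_big (iota 0 n)) /=; last first.
  by have := seq_fset_perm tt (iota 0 n); rewrite undup_id ?iota_uniq.
by rewrite -(big_mkord xpredT (fun i => Ex P0 (\1_(C i) \o W0))) /index_iota subn0.
Qed.

(** Indicators are replaced by functions one coordinate at a time, the product
    of the other coordinates serving as a density. *)
Lemma iid_prod n (f : nat -> S -> R) :
  (forall i, measurable_fun [set: S] (f i)) -> (forall i s, 0 <= f i s <= 1) ->
  Ex P (fun w => \prod_(i < n) f i (W i w)) = \prod_(i < n) Ex P0 (f i \o W0).
Proof.
move=> mf f01.
suff main (m : nat) (h : nat -> S -> R) : (forall i, measurable_fun [set: S] (h i)) ->
    (forall i s, 0 <= h i s <= 1) ->
    (forall i, (m <= i < n)%N -> exists2 C : set S, measurable C & h i = \1_C) ->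
    Ex P (fun w => \prod_(i < n) h i (W i w)) = \prod_(i < n) Ex P0 (h i \o W0).
  by apply: (main n) => // i; case: ltngtP.
elim: m h => [|m ih] h mh h01 hC.
  have /choice[C HC] : forall i, exists C : set S,
      measurable C /\ ((i < n)%N -> h i = \1_C).
    move=> i; have [/hC[C mC hE]|ni] := boolP (0 <= i < n)%N; first by exists C.
    by exists setT; split => // ni'; rewrite leq0n ni' in ni.
  have hE (i : 'I_n) : h i = \1_(C i) by case: (HC i) => _; exact.
  under eq_fun do under eq_bigr do rewrite hE.
  under [RHS]eq_bigr do rewrite hE.
  by rewrite iid_prod_indic// => i; case: (HC i).
have [nm|mn] := leqP n m.
  by apply: ih => // i /andP[mi]; rewrite ltnNge (leq_trans nm mi).
pose j := Ordinal mn.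
pose a1 w := \prod_(i < n | i != j) h i (W i w).
pose kappa := \prod_(i < n | i != j) Ex P0 (h i \o W0).
have b01 i : bmeas (h i \o W i).
  by apply: bmeas_comp => //; exact: bmeas01.
have kappa0 : 0 <= kappa.
  by apply: prodr_ge0 => i _; apply: Ex_ge0 => w; have /andP[] := h01 i (W0 w).
rewrite (_ : (fun w => \prod_(i < n) h i (W i w)) =
  (fun w => a1 w * h m (W m w))); last first.
  by apply/funext => w; rewrite (bigD1 j)//= mulrC.
rewrite (@eq_weighted_Ex R _ _ P _ _ P0 _ _ (W m) W0 a1 (fun=> kappa))//.
- rewrite ExZ; first by rewrite [RHS](bigD1 j)//= mulrC.
  by apply: bmeas_comp => //; exact: bmeas01.
- by apply: bmeas_prod => i; exact: b01.
- exact: bmeas_cst.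
- by move=> w; apply: prodr_ge0 => i _; have /andP[] := h01 i (W i w).
- move=> C mC.
  pose h' i := if i == m then \1_C else h i.
  have h'j (i : 'I_n) : i != j -> h' i = h i.
    by move=> ij; rewrite /h' -[m]/(nat_of_ord j) val_eqE (negbTE ij).
  have h'm : h' m = \1_C by rewrite /h' eqxx.
  have := ih h'; rewrite (_ : (fun w => \prod_(i < n) h' i (W i w)) =
    (fun w => a1 w * \1_C (W m w))); last first.
    apply/funext => w; rewrite (bigD1 j)//= mulrC h'm; congr (_ * _).
    by apply: eq_bigr => i ij; rewrite h'j.
  move=> ->.
  - rewrite (bigD1 j)//= mulrC h'm ExZ; last first.
      by apply: bmeas_comp => //; exact: bmeas_indic.
    by congr (_ * _); apply: eq_bigr => i ij; rewrite h'j.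
  - by move=> i; rewrite /h'; case: ifP => // _; exact: measurable_indic.
  - move=> i s; rewrite /h'; case: ifP => // _.
    by rewrite indicE; case: (_ \in _); rewrite lexx ler01.
  - move=> i /andP[mi ni]; rewrite /h'; case: eqP => [_|/eqP im]; first by exists C.
    by apply: hC; rewrite ltn_neqAle eq_sym im mi.
Qed.

End iid.

Section tuple_boxes.
Context d (T : measurableType d) (n : nat).

Definition boxes : set (set (n.-tuple T)) :=
  [set C | exists2 B : 'I_n -> set T, (forall i, measurable (B i)) &
     C = [set v | forall i, B i (tnth v i)]].

Lemma boxes_setI : setI_closed boxes.
Proof.
move=> _ _ [B mB ->] [B' mB' ->]; exists (fun i => B i `&` B' i).
  by move=> i; exact: measurableI.
apply/seteqP; split => [v [h h'] i|v h]; first by split.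
by split => i; have [] := h i.
Qed.

Lemma boxes_setT : boxes [set: n.-tuple T].
Proof. by exists (fun=> setT) => //; apply/seteqP; split. Qed.

Lemma boxes_measurable : boxes `<=` measurable.
Proof.
move=> _ [B mB ->].
rewrite (_ : [set _ | _] = \bigcap_(i in [set: 'I_n]) [set v | B i (tnth v i)]).
  apply: fin_bigcap_measurable => // i _.
  by rewrite -[[set _ | _]]setTI; exact: measurable_tnth.
by apply/seteqP; split => [v h i _|v h i]; exact: h.
Qed.

(** Boxes form a pi-system on which independence gives product formulas. *)
Lemma measurable_tuple_boxes : @measurable _ (n.-tuple T) = <<s boxes >>.
Proof.
apply/seteqP; split; last first.
  apply: smallest_sub; first exact: sigma_algebra_measurable.
  exact: boxes_measurable.
apply: smallest_sub; first exact: smallest_sigma_algebra.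
move=> C; rewrite -bigcup_seq/= => -[i _ [B mB <-]].
apply: sub_gen_smallest.
exists (fun j => if j == i then B else setT) => [j|]; first by case: ifP.
rewrite setTI; apply/seteqP; split => v /= h; last first.
  by have := h i; rewrite eqxx.
by move=> j; case: eqP => // ->.
Qed.

End tuple_boxes.

(** * The quadratic form of the nearest-neighbour graph *)

Section finite_valued.
Context d (T : measurableType d) (R : realType).

Lemma measurable_finite_valued (K : finType) (F : T -> K) (h : K -> R) :
  (forall a, measurable [set x | F x = a]) ->
  measurable_fun [set: T] (fun x => h (F x)).
Proof.
move=> mF _ C mC; rewrite setTI.
rewrite (_ : _ @^-1` C = \bigcup_(a in [set a | C (h a)]) [set x | F x = a]).
  by apply: fin_bigcup_measurable => [|a _]; [exact: finite_finset|exact: mF].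
by apply/seteqP; split => [x Cx|x [a Ca /= Fa]]; [exists (F x)|rewrite /= Fa].
Qed.

Lemma measurable_asbool (Q : T -> bool) :
  measurable_fun [set: T] Q -> measurable [set x | Q x].
Proof. by move=> mQ; rewrite -[[set _ | _]]setTI; exact: (mQ _ [set true]). Qed.

End finite_valued.

Section weights_measurable.
Context (R : realType) (k n : nat).
Local Notation V := (n.-tuple (k.-tuple R)).

Lemma measurable_eucl_dist (i j : 'I_n) :
  measurable_fun [set: V] (fun v => eucl_dist (tnth v i) (tnth v j)).
Proof.
apply: (@measurableT_comp _ _ _ _ _ _ (@Num.sqrt R)).
  by apply: continuous_measurable_fun; exact: sqrt_continuous.
apply: measurable_sum => l; apply: measurable_funX; apply: measurable_funB.
all: apply: (@measurableT_comp _ _ _ _ _ _ (fun x : k.-tuple R => tnth x l)).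
all: exact: measurable_tnth.
Qed.

Lemma measurable_nearest (i : 'I_n) (A : {set 'I_n}) :
  measurable [set v : V | nearest (tnth v) i = A].
Proof.
have mj j : measurable [set v : V | j \in nearest (tnth v) i].
  have [->|ji] := eqVneq j i.
    rewrite (_ : [set _ | _] = set0)//; apply/seteqP; split => // v /=.
    by move/nearestP => []; rewrite eqxx.
  rewrite (_ : [set _ | _] = \bigcap_(l in [set l | l != i]) [set v : V |
      eucl_dist (tnth v i) (tnth v j) <= eucl_dist (tnth v i) (tnth v l)]).
    apply: fin_bigcap_measurable => [|l _]; first exact: finite_finset.
    apply: measurable_asbool; apply: measurable_fun_ler; exact: measurable_eucl_dist.
  apply/seteqP; split => v /=; first by move/nearestP => [_ h] l /=; exact: h.
  by move=> h; apply/nearestP; split => // l; exact: h.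
rewrite (_ : [set _ | _] = \bigcap_(j in [set: 'I_n])
    (if j \in A then [set v : V | j \in nearest (tnth v) i]
     else ~` [set v : V | j \in nearest (tnth v) i])).
  apply: fin_bigcap_measurable => [|j _]; first exact: finite_finset.
  by case: ifP => // _; exact: measurableC.
apply/seteqP; split => v /=.
  by move=> <- j _; case: ifPn => //= /negP.
move=> h; apply/setP => j; have := h j I; case: (j \in A) => //=.
by move/negP/negbTE.
Qed.

Lemma measurable_nn_weight (i j : 'I_n) :
  measurable_fun [set: V] (fun v => nn_weight (tnth v) i j).
Proof.
apply: (@measurable_finite_valued _ _ _ _ (fun v : V => nearest (tnth v) i)
  (fun A : {set 'I_n} => if j \in A then (#|A|%:R)^-1 else 0)).
exact: measurable_nearest.
Qed.

End weights_measurable.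

Section quadratic.
Context (R : realType) (n : nat).
Implicit Types (w : 'I_n -> 'I_n -> R) (x : 'I_n -> R).

(** With [w] the neighbour weights and [x] the conditional probabilities of the
    labels, this is the conditional mean of the number of points that carry the
    label together with their chosen neighbour. *)
Definition quad w x : R := \sum_i \sum_j w i j * x i * x j.

(** The slope in a coordinate involves the weights of the edges at that vertex
    only; this is where a bound on in-degrees is needed. *)
Lemma quad_slope w (c : R) l : (forall i j, 0 <= w i j) -> (forall i, w i i = 0) ->
  (forall i, \sum_j w i j + \sum_j w j i <= c) ->
  affine_slope (`|l| * c) (fun x => l * quad w x).
Proof.
move=> w0 wd wc x i x01.
exists (l * \sum_j (w i j + w j i) * x j).
  rewrite normrM ler_wpM2l// (le_trans (ler_norm_sum _ _ _))//.
  apply: le_trans (wc i); rewrite -big_split/=; apply: ler_sum => j _.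
  have /andP[xj0 xj1] := x01 j.
  by rewrite normrM !ger0_norm ?addr_ge0// ler_piMr ?addr_ge0.
move=> a; rewrite -mulrA -mulrDr; congr (_ * _).
pose y := upd x i 0; pose dl j : R := (j == i)%:R.
have ya j : upd x i a j = y j + a * dl j.
  by rewrite /y /upd /dl; case: eqP => _; rewrite ?add0r ?mulr1 ?mulr0 ?addr0.
have sd (F : 'I_n -> R) : \sum_j F j * dl j = F i.
  rewrite (bigD1 i)//= /dl eqxx mulr1 big1 ?addr0// => j ji.
  by rewrite (negbTE ji) mulr0.
rewrite /quad -/y.
transitivity (\sum_j0 \sum_j w j0 j * y j0 * y j +
   ((\sum_j0 (\sum_j w j0 j * y j) * dl j0 + \sum_j0 \sum_j (w j0 j * y j0) * dl j) * a
   + (\sum_j0 \sum_j w j0 j * dl j0 * dl j) * a ^+ 2)).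
  rewrite mulrDl !mulr_suml -!big_split/=; apply: eq_bigr => j0 _.
  rewrite !mulr_suml -!big_split/=; apply: eq_bigr => j _.
  by rewrite !ya; ring.
congr (_ + _); rewrite sd.
under [X in (_ + X) * a]eq_bigr do rewrite sd.
under [X in _ + X * _]eq_bigr do rewrite sd.
rewrite sd wd mul0r addr0 -big_split/= !mulr_suml.
rewrite (bigD1 i)//= [RHS](bigD1 i)//= /y /upd eqxx !wd !mul0r !addr0 mul0r.
rewrite !mul0r !add0r.
apply: eq_bigr => j ji; rewrite (negbTE ji); ring.
Qed.

(** Conditionally on the points, the labels and the tie-breaking choices are
    independent: the exponential moment factorizes, first over the choices and
    then, by [bern_mgf], over the labels. *)
Lemma graph_mgf w q (c l : R) : (forall i j, 0 <= w i j) -> (forall i, w i i = 0) ->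
  (forall i, \sum_j w i j = 1) ->
  (forall i, \sum_j w i j + \sum_j w j i <= c) -> 1 <= c ->
  (forall i, 0 <= q i <= 1) -> `|l| * c <= 2^-1 ->
  \sum_(t : {ffun 'I_n -> bool} * {ffun 'I_n -> 'I_n})
    bern q t.1 * (\prod_i w i (t.2 i)) *
    expR (l * (\sum_i (t.1 i)%:R * (t.1 (t.2 i))%:R - quad w q))
  <= expR (4 * (l * c) ^+ 2 * n%:R).
Proof.
move=> w0 wd w1 wc c1 q01 lc.
have l12 : `|l| <= 2^-1.
  by apply: le_trans lc; rewrite ler_peMr.
rewrite -(pair_bigA _ (fun (s : {ffun 'I_n -> bool}) (f : {ffun 'I_n -> 'I_n}) =>
    bern q s * (\prod_i w i (f i)) *
    expR (l * (\sum_i (s i)%:R * (s (f i))%:R - quad w q))))/=.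
have inner (s : {ffun 'I_n -> bool}) :
    \sum_(f : {ffun 'I_n -> 'I_n}) (\prod_i w i (f i)) *
      expR (l * \sum_i (s i)%:R * (s (f i))%:R)
    <= expR (2 * l ^+ 2 * n%:R + l * quad w (fun i => (s i)%:R)).
  rewrite (eq_bigr (fun f : {ffun 'I_n -> 'I_n} => \prod_i (w i (f i) *
      expR (l * ((s i)%:R * (s (f i))%:R))))); last first.
    by move=> f _; rewrite big_split/= mulr_sumr expR_sum.
  rewrite -(bigA_distr_bigA (fun i j => w i j * expR (l * ((s i)%:R * (s j)%:R)))).
  rewrite expRD (_ : expR (_ * n%:R) = \prod_(i < n) expR (2 * l ^+ 2)); last first.
    by rewrite prodr_const card_ord -expRM_natr mulr_natr.
  rewrite /quad mulr_sumr expR_sum -big_split/=; apply: ler_prod => i _.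
  apply/andP; split.
    by apply: sumr_ge0 => j _; rewrite mulr_ge0 ?expR_ge0.
  rewrite -expRD; apply: le_trans (expR_ge1Dx _).
  apply: (@le_trans _ _ (\sum_j w i j *
      (1 + (2 * l ^+ 2 + l * ((s i)%:R * (s j)%:R))))); last first.
    rewrite le_eqVlt; apply/orP; left; apply/eqP.
    transitivity (\sum_j (w i j * (1 + 2 * l ^+ 2) + l * (w i j * (s i)%:R * (s j)%:R))).
      by apply: eq_bigr => j _; ring.
    by rewrite big_split/= -mulr_suml w1 mul1r -mulr_sumr addrA.
  apply: ler_sum => j _; rewrite ler_wpM2l//.
  have b1 : `|(s i)%:R * (s j)%:R : R| <= 1.
    by case: (s i); case: (s j); rewrite ?mulr1 ?mulr0 ?mul0r ?normr1 ?normr0.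
  have lb : `|l * ((s i)%:R * (s j)%:R)| <= `|l|.
    by rewrite normrM ler_piMr.
  apply: (le_trans (expR_le_quad (le_trans lb l12))).
  rewrite -addrA lerD2l addrC lerD2r ler_wpM2l//.
  by rewrite -real_normK ?num_real// -[l ^+ 2]real_normK ?num_real// lerXn2r ?nnegrE.
apply: (@le_trans _ _ (\sum_s bern q s *
    (expR (2 * l ^+ 2 * n%:R + l * quad w (fun i => (s i)%:R)) * expR (- (l * quad w q))))).
  apply: ler_sum => s _.
  rewrite (eq_bigr (fun f : {ffun 'I_n -> 'I_n} => bern q s * expR (- (l * quad w q)) *
    ((\prod_i w i (f i)) * expR (l * \sum_i (s i)%:R * (s (f i))%:R)))); last first.
    by move=> f _; rewrite mulrBr expRD; ring.
  rewrite -mulr_sumr -mulrA ler_wpM2l ?bern_ge0// mulrC ler_wpM2r ?expR_ge0//.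
have := bern_mgf q01 lc (quad_slope l w0 wd wc).
rewrite -(ler_pM2r (expR_gt0 (2 * l ^+ 2 * n%:R - l * quad w q))) => h.
apply: (@le_trans _ _ ((\sum_s bern q s * expR (l * quad w (fun i => (s i)%:R))) *
   expR (2 * l ^+ 2 * n%:R - l * quad w q))).
  rewrite mulr_suml; apply: ler_sum => s _.
  by rewrite -!mulrA -!expRD ler_wpM2l ?bern_ge0// ler_expR; lra.
apply: (le_trans h); rewrite -expRD ler_expR exprMn exprMn.
rewrite real_normK ?num_real//.
have c2 : 1 <= c ^+ 2 by rewrite expr_ge1// (le_trans ler01).
have : l ^+ 2 * n%:R <= l ^+ 2 * n%:R * c ^+ 2.
  by rewrite ler_peMr// mulr_ge0// sqr_ge0.
lra.
Qed.

End quadratic.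

(** * Joint law of the labels and the chosen neighbours *)

Lemma measurable_preimage d1 (T1 : measurableType d1) d2 (T2 : measurableType d2)
  (f : T1 -> T2) (B : set T2) :
  measurable_fun [set: T1] f -> measurable B -> measurable (f @^-1` B).
Proof. by move=> mf mB; rewrite -[_ @^-1` _]setTI; exact: mf. Qed.

Lemma indic01 (R : realType) T (A : set T) (x : T) : 0 <= (\1_A x : R) <= 1.
Proof. by rewrite indicE; case: (_ \in _); rewrite lexx ler01. Qed.

Lemma bern_indic (R : realType) n T (B : set T) (y : 'I_n -> T)
    (s : {ffun 'I_n -> bool}) :
  bern (fun i => \1_B (y i) : R) s = (s == [ffun i => y i \in B])%:R.
Proof.
rewrite /bern; case: eqP => [->|/eqP sB].
  rewrite big1// => i _; rewrite ffunE indicE.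
  by case: (_ \in _); rewrite ?subr0.
have [i si] : exists i, s i != (y i \in B).
  apply/existsP; apply: contraNT sB; rewrite negb_exists => /forallP h.
  by apply/eqP/ffunP => i; have := h i; rewrite negbK ffunE => /eqP.
rewrite (bigD1 i)//= indicE; move: si.
by case: (s i); case: (_ \in _) => //= _; rewrite ?subrr mul0r.
Qed.

Section label_law.
Context (R : realType) (k : nat)
  d0 (Omega0 : measurableType d0) (P0 : probability Omega0 R)
  d (Omega : measurableType d) (P : probability Omega R)
  (Y : Omega0 -> R) (V : Omega0 -> k.-tuple R)
  (Ys : nat -> Omega -> R) (Vs : nat -> Omega -> k.-tuple R).
Hypotheses (mY : measurable_fun [set: Omega0] Y)
  (mV : measurable_fun [set: Omega0] V)
  (mYs : forall i, measurable_fun [set: Omega] (Ys i))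
  (mVs : forall i, measurable_fun [set: Omega] (Vs i)).
Hypothesis iid : iid_copies P0 P (fun w => (Y w, V w)) (fun i w => (Ys i w, Vs i w)).
Variables (B : set R) (g : k.-tuple R -> R).
Hypotheses (mB : measurable B) (mg : measurable_fun [set: k.-tuple R] g)
  (g01 : forall v, 0 <= g v <= 1).
Hypothesis gE : forall C, measurable C ->
  Ex P0 (fun w => \1_B (Y w) * \1_C (V w)) = Ex P0 (fun w => g (V w) * \1_C (V w)).

Let mW0 : measurable_fun [set: Omega0] (fun w => (Y w, V w)).
Proof. exact: measurable_fun_pair. Qed.

Let mW i : measurable_fun [set: Omega] (fun w => (Ys i w, Vs i w)).
Proof. exact: measurable_fun_pair. Qed.

Let points n w : n.-tuple (k.-tuple R) := [tuple Vs j w | j < n].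

Let mpoints n : measurable_fun [set: Omega] (points n).
Proof.
apply/measurable_fun_tnthP => i; rewrite (_ : _ \o _ = Vs i)//.
by apply/funext => w /=; rewrite tnth_mktuple.
Qed.

Let bg i : bmeas (fun w => g (Vs i w)).
Proof. by apply: bmeas_comp => //; exact: bmeas01. Qed.

Let bB i : bmeas (fun w => \1_B (Ys i w) : R).
Proof. by apply: bmeas_comp => //; exact: bmeas_indic. Qed.

Let bbern n (q : nat -> Omega -> R) (s : {ffun 'I_n -> bool}) :
  (forall i, bmeas (q i)) -> bmeas (fun w => bern (fun i : 'I_n => q i w) s).
Proof.
move=> bq; apply: bmeas_prod => i; case: (s i) => //.
by apply: bmeasB => //; exact: bmeas_cst.
Qed.

(** Given the points, the labels are independent Bernoulli variables: it
    suffices to test this on boxes, where both sides factorize. *)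
Lemma label_law n (s : {ffun 'I_n -> bool}) (C : set (n.-tuple (k.-tuple R))) :
  measurable C ->
  Ex P (fun w => bern (fun i : 'I_n => \1_B (Ys i w)) s * \1_C (points n w)) =
  Ex P (fun w => bern (fun i : 'I_n => g (Vs i w)) s * \1_C (points n w)).
Proof.
move=> mC; apply: (@eq_weighted_pi R _ _ P _ _ P _ _ (points n) (points n)
  (fun w => bern (fun i : 'I_n => \1_B (Ys i w)) s)
  (fun w => bern (fun i : 'I_n => g (Vs i w)) s)
  (@mpoints n) (@mpoints n) (bbern _ bB) (bbern _ bg) _ _ (@boxes _ _ n)) => //.
- by move=> w; apply: bern_ge0 => i; exact: indic01.
- by move=> w; apply: bern_ge0.
- exact: measurable_tuple_boxes.
- exact: boxes_setI.
- exact: boxes_setT.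
move=> _ [D mD ->].
pose D' (i : nat) : set (k.-tuple R) := if insub i is Some j then D j else setT.
have D'E (i : 'I_n) : D' i = D i by rewrite /D' valK.
have mD' i : measurable (D' i) by rewrite /D'; case: insubP => //.
pose s' (i : nat) : bool := if insub i is Some j then s j else true.
have s'E (i : 'I_n) : s' i = s i by rewrite /s' valK.
have EF (h : nat -> R * k.-tuple R -> R) :
    (forall i, measurable_fun setT (h i)) -> (forall i x, 0 <= h i x <= 1) ->
    Ex P (fun w => bern (fun i : 'I_n => h i (Ys i w, Vs i w)) s *
      \1_[set v | forall i, D i (tnth v i)] (points n w)) =
    \prod_(i < n) Ex P0 (fun w => (if s i then h i (Y w, V w)
       else 1 - h i (Y w, V w)) * \1_(D i) (V w)).
  move=> mh h01.
  pose f i (x : R * k.-tuple R) := (if s' i then h i x else 1 - h i x) * \1_(D' i) x.2.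
  transitivity (Ex P (fun w => \prod_(i < n) f i (Ys i w, Vs i w))).
    congr Ex; apply/funext => w.
    rewrite big_split/=; congr (_ * _); first by apply: eq_bigr => i _; rewrite s'E.
    rewrite indicE; have [Dw|Dw] := boolP (_ \in _).
      rewrite big1// => i _; rewrite D'E indicE mem_set//.
      by have /= := set_mem Dw; move=> /(_ i); rewrite tnth_mktuple.
    apply/esym/eqP; rewrite prodf_seq_eq0; apply/hasP.
    apply: contrapT => nD; move/negP : Dw; apply; rewrite inE => i /=.
    rewrite tnth_mktuple; apply: contrapT => Di; apply: nD.
    by exists i; rewrite ?mem_index_enum//= D'E indicE memNset.
  rewrite (iid_prod mW0 mW iid).
  - by apply: eq_bigr => i _; rewrite /f s'E D'E.
  - move=> i; apply: measurable_funM.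
      by case: (s' i) => //; apply: measurable_funB.
    by apply: measurableT_comp; [exact: measurable_indic|exact: measurable_snd].
  - move=> i x; have /andP[h0 h1] := h01 i x; rewrite /f indicE.
    case: (_ \in _); rewrite ?mulr1 ?mulr0 ?lexx ?ler01//.
    by case: (s' i); rewrite ?h0// subr_ge0 h1 lerBlDr lerDl.
rewrite (EF (fun _ x => \1_B x.1)); first 1 last.
- by move=> i; apply: measurableT_comp; [exact: measurable_indic|exact: measurable_fst].
- by move=> i x; exact: indic01.
rewrite (EF (fun _ x => g x.2)); first 1 last.
- by move=> i; apply: measurableT_comp => //; exact: measurable_snd.
- by [].
apply: eq_bigr => i _ /=; case: (s i); first exact: gE.
have bD : bmeas (fun w => \1_(D i) (V w) : R).
  by apply: bmeas_comp => //; exact: bmeas_indic.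
under [in LHS]eq_fun do rewrite mulrBl mul1r.
under [in RHS]eq_fun do rewrite mulrBl mul1r.
rewrite !ExB//; first by rewrite gE.
- by apply: bmeasM => //; apply: bmeas_comp => //; exact: bmeas01.
- by apply: bmeasM => //; apply: bmeas_comp => //; exact: bmeas_indic.
Qed.

Variables (n : nat) (M : 'I_n -> Omega -> 'I_n).
Hypothesis n2 : (2 <= n)%N.
Hypothesis nnM : uniform_nearest P (fun w => [tuple (Ys j w, Vs j w) | j < n])
  (fun j w => Vs j w) M.

Let wt (v : n.-tuple (k.-tuple R)) := nn_weight (tnth v).
Let gt (v : n.-tuple (k.-tuple R)) := fun i : 'I_n => g (tnth v i).

Let dev (t : {ffun 'I_n -> bool} * {ffun 'I_n -> 'I_n}) v : R :=
  \sum_i (t.1 i)%:R * (t.1 (t.2 i))%:R - quad (wt v) (gt v).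

Let mgt i : measurable_fun setT (fun v => gt v i).
Proof. by apply: measurableT_comp => //; exact: measurable_tnth. Qed.

Let mdev t : measurable_fun setT (dev t).
Proof.
apply: measurable_funB => //; apply: measurable_sum => i.
apply: measurable_sum => j; apply: measurable_funM => //.
by apply: measurable_funM => //; exact: measurable_nn_weight.
Qed.

(** The tie-breaking weights are functions of the points, so that the law of the
    labels can be integrated against them. *)
Lemma tie_law (t : {ffun 'I_n -> bool} * {ffun 'I_n -> 'I_n})
    (C : set (n.-tuple (k.-tuple R))) : measurable C ->
  let E := [set w | [/\ t.1 = [ffun i : 'I_n => Ys i w \in B],
                        t.2 = [ffun i => M i w] & C (points n w)]] in
  measurable E /\
  Ex P \1_E = Ex P (fun w => bern (gt (points n w)) t.1 *
    (\prod_i wt (points n w) i (t.2 i) * \1_C (points n w))).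
Proof.
move=> mC E; case: nnM => mM lawM.
pose data w : n.-tuple (R * k.-tuple R) := [tuple (Ys j w, Vs j w) | j < n].
pose mid (D : n.-tuple (R * k.-tuple R)) : n.-tuple (k.-tuple R) :=
  [tuple (tnth D j).2 | j < n].
have midE w : mid (data w) = points n w.
  by apply: eq_from_tnth => i; rewrite !tnth_mktuple.
have mmid : measurable_fun setT mid.
  apply/measurable_fun_tnthP => i.
  rewrite (_ : _ \o _ = (fun D => (tnth D i).2)); last first.
    by apply/funext => D /=; rewrite tnth_mktuple.
  apply: (@measurableT_comp _ _ _ _ _ _ snd); first exact: measurable_snd.
  exact: measurable_tnth.
pose A : set (n.-tuple (R * k.-tuple R)) :=
  [set D | (forall i, t.1 i = ((tnth D i).1 \in B)) /\ C (mid D)].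
have mA : measurable A.
  rewrite (_ : A = \bigcap_(i in [set: 'I_n])
     (if t.1 i then [set D | B (tnth D i).1] else ~` [set D | B (tnth D i).1])
     `&` mid @^-1` C).
    apply: measurableI; last exact: measurable_preimage.
    apply: fin_bigcap_measurable => [|i _]; first exact: finite_finset.
    have mi : measurable [set D : n.-tuple (R * k.-tuple R) | B (tnth D i).1].
      apply: (@measurable_preimage _ _ _ _ (fun D : n.-tuple (R * k.-tuple R) => (tnth D i).1)) => //.
      apply: (@measurableT_comp _ _ _ _ _ _ fst); first exact: measurable_fst.
      exact: measurable_tnth.
    by case: (t.1 i) => //; exact: measurableC.
  apply/seteqP; split => D [h h']; split => // i.
    by move=> _; rewrite h; case: ifPn => [/set_mem//|/negP hn /= BD]; apply: hn; rewrite mem_set.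
  have := h i I; case: (t.1 i) => /= hB; first by rewrite mem_set.
  by rewrite memNset.
have EE : E = data @^-1` A `&` [set w | forall i, M i w = t.2 i].
  apply/seteqP; split => w.
    move=> [h1 h2 h3]; split; last by move=> i; rewrite h2 ffunE.
    by split; [move=> i; rewrite h1 ffunE tnth_mktuple|rewrite midE].
  move=> [[h1 h3] h2]; split; last by rewrite -midE.
    by apply/ffunP => i; rewrite ffunE h1 tnth_mktuple.
  by apply/ffunP => i; rewrite ffunE h2.
have mdata : measurable_fun setT data.
  apply/measurable_fun_tnthP => i; rewrite (_ : _ \o _ = (fun w => (Ys i w, Vs i w)))//.
  by apply/funext => w /=; rewrite tnth_mktuple.
have mE : measurable E.
  rewrite EE; apply: measurableI; first exact: measurable_preimage.
  rewrite (_ : [set _ | _] = \bigcap_(i in [set: 'I_n]) [set w | M i w = t.2 i]).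
    by apply: fin_bigcap_measurable => //; exact: finite_finset.
  by apply/seteqP; split => w h i; [move=> _|]; exact: h.
split => //.
pose f v := \prod_i wt v i (t.2 i) * \1_C v.
have bf : bmeas f.
  apply: bmeasM; last exact: bmeas_indic.
  apply: bmeas_prod => i; apply: bmeas01; first exact: measurable_nn_weight.
  by move=> v; rewrite nn_weight_ge0 nn_weight_le1.
transitivity (Ex P (fun w => bern (fun i : 'I_n => \1_B (Ys i w)) t.1 * f (points n w))).
  apply: EFin_inj; rewrite EFin_Ex_indic// EE lawM//.
  rewrite integral_restr /Ex /Rintegral fineK; last first.
    apply: integrable_fin_num => //; apply: bmeas_integrable.
    apply: bmeasM; first exact: (bbern _ bB).
    exact: (bmeas_comp (@mpoints n) bf).
  apply: eq_integral => w _; congr EFin.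
  rewrite bern_indic /f mulrCA; congr (_ * _).
    apply: eq_bigr => i _; rewrite /wt /nn_weight /=.
    rewrite (_ : nearest (tnth (points n w)) i = nearest (fun j : 'I_n => Vs j w) i)//.
    by congr nearest; apply/funext => j; rewrite tnth_mktuple.
  rewrite !indicE -natrM mulnb; congr (nat_of_bool _)%:R.
  apply/idP/andP => [/set_mem[h h']|[/eqP h /set_mem h']].
    split; last by rewrite mem_set// -midE.
    by apply/eqP/ffunP => i; rewrite h ffunE tnth_mktuple.
  by rewrite mem_set//; split; [move=> i; rewrite h ffunE tnth_mktuple|rewrite midE].
have -> : (fun w => bern (gt (points n w)) t.1 * f (points n w)) =
    (fun w => bern (fun i : 'I_n => g (Vs i w)) t.1 * f (points n w)).
  apply/funext => w; congr (bern _ _ * _); apply/funext => i.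
  by rewrite /gt tnth_mktuple.
apply: eq_weighted_Ex => //.
- exact: (@mpoints n).
- exact: (@mpoints n).
- exact: (bbern _ bB).
- exact: (bbern _ bg).
- by move=> w; apply: bern_ge0 => i; exact: indic01.
- by move=> w; exact: bern_ge0.
- by case: bf.
- move=> v; rewrite /f indicE.
  have p0 : 0 <= \prod_i wt v i (t.2 i).
    by apply: prodr_ge0 => i _; exact: nn_weight_ge0.
  have p1 : \prod_i wt v i (t.2 i) <= 1.
    by apply: prodr_ile1 => i _; rewrite nn_weight_ge0 nn_weight_le1.
  by case: (_ \in _); rewrite ?mulr1 ?mulr0 ?lexx ?ler01// p0 p1.
- by move=> D mD; exact: label_law.
Qed.

(** The exponential inequality for the nearest-neighbour pair statistic around
    its conditional mean given the points. *)
Lemma nn_pair_tail (e : R) : 0 < e -> e <= 1 ->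
  let c := (indeg R k).+1%:R in
  let E := [set w | n%:R * e <=
     `|\sum_(i < n) \1_B (Ys i w) * \1_B (Ys (M i w) w) -
       quad (nn_weight (fun j : 'I_n => Vs j w)) (fun i : 'I_n => g (Vs i w))|] in
  measurable E /\ (P E <= (2 * expR (- (e / (4 * c)) ^+ 2 * n%:R))%:E)%E.
Proof.
move=> e0 e1 c E.
pose T := ({ffun 'I_n -> bool} * {ffun 'I_n -> 'I_n})%type.
pose C (t : T) := [set v | n%:R * e <= `|dev t v|].
have mC t : measurable (C t).
  apply: measurable_asbool; apply: measurable_fun_ler => //.
  exact: measurableT_comp.
pose Et (t : T) := [set w | [/\ t.1 = [ffun i : 'I_n => Ys i w \in B],
                        t.2 = [ffun i => M i w] & C t (points n w)]].
have EtP t := tie_law t (mC t).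
pose tw w : T := ([ffun i : 'I_n => Ys i w \in B], [ffun i => M i w]).
have wtE w : wt (points n w) = nn_weight (fun j : 'I_n => Vs j w).
  by congr nn_weight; apply/funext => j; rewrite tnth_mktuple.
have gtE w : gt (points n w) = (fun i : 'I_n => g (Vs i w)).
  by apply/funext => i; rewrite /gt tnth_mktuple.
have devE w : dev (tw w) (points n w) =
    \sum_(i < n) \1_B (Ys i w) * \1_B (Ys (M i w) w) -
    quad (nn_weight (fun j : 'I_n => Vs j w)) (fun i : 'I_n => g (Vs i w)).
  by rewrite /dev wtE gtE; congr (_ - _); apply: eq_bigr => i _; rewrite !ffunE !indicE.
have EE : E = \bigcup_(t in [set: T]) Et t.
  apply/seteqP; split => w; first by move=> Ew; exists (tw w) => //; split => //=; rewrite /C/= devE.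
  by move=> [[s f] _ [/= -> ->]]; rewrite /C/= (devE w).
have mE : measurable E.
  rewrite EE; apply: fin_bigcup_measurable; first exact: finite_finset.
  by move=> t _; have [] := EtP t.
split => //; rewrite -EFin_Ex_indic// lee_fin.
have bEt t : bmeas (\1_(Et t) : Omega -> R).
  by apply: bmeas_indic; have [] := EtP t.
apply: (@le_trans _ _ (Ex P (fun w => \sum_t \1_(Et t) w))).
  apply: Ex_le; [exact: bmeas_indic|exact: bmeas_sum|move=> w].
  rewrite indicE; case: (boolP (_ \in _)) => [/set_mem Ew|_]; last first.
    by apply: sumr_ge0 => t _; have /andP[] := indic01 R (Et t) w.
  rewrite (bigD1 (tw w))//= indicE mem_set ?lerDl; last first.
    by split => //=; rewrite /C/= devE.
  by apply: sumr_ge0 => t _; have /andP[] := indic01 R (Et t) w.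
rewrite Ex_sum// (eq_bigr _ (fun t _ => (EtP t).2)).
have bt (t : T) : bmeas (fun v => bern (gt v) t.1 *
    (\prod_i wt v i (t.2 i) * \1_(C t) v)).
  apply: bmeasM; last first.
    apply: bmeasM; last exact: bmeas_indic.
    apply: bmeas_prod => i; apply: bmeas01; first exact: measurable_nn_weight.
    by move=> v; rewrite nn_weight_ge0 nn_weight_le1.
  have bgt i : bmeas (fun v => gt v i) by apply: bmeas01 => [|v]; [exact: mgt|exact: g01].
  by apply: bmeas_prod => i; case: (t.1 i) => //; apply: bmeasB => //; exact: bmeas_cst.
(* from here on the bound holds for each configuration of the points *)
rewrite -(Ex_sum P _ _ (fun t => bmeas_comp (@mpoints n) (bt t))).
rewrite -[leRHS](Ex_cst P); apply: Ex_le; last move=> w /=.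
- by apply: bmeas_sum => t; exact: (bmeas_comp (@mpoints n) (bt t)).
- exact: bmeas_cst.
move: (points n w) => v.
have c1 : 1 <= c by rewrite ler1n.
have wc i : \sum_j wt v i j + \sum_j wt v j i <= c.
  by rewrite /c -nat1r lerD ?in_weight_le// sum_nn_weight.
have p0 (t : T) : 0 <= bern (gt v) t.1 * \prod_i wt v i (t.2 i).
  rewrite mulr_ge0 ?bern_ge0//; first by move=> i; exact: g01.
  by apply: prodr_ge0 => i _; exact: nn_weight_ge0.
have := @mgf_tail R n T (fun t => bern (gt v) t.1 * \prod_i wt v i (t.2 i))
  (fun t => dev t v) c e p0 _ e0 _ _.
rewrite (eq_bigr (fun t : T => bern (gt v) t.1 *
    (\prod_i wt v i (t.2 i) * \1_(C t) v))); last first.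
  move=> t _; rewrite -mulrA; congr (_ * (_ * _)).
  rewrite indicE; congr (nat_of_bool _)%:R.
  by apply/idP/idP => [h|/set_mem]; [rewrite mem_set|].
have c0 : 0 < c by apply: lt_le_trans c1.
have ec : e <= 4 * c by lra.
apply => // l lc; apply: graph_mgf => //.
- by move=> i j; exact: nn_weight_ge0.
- by move=> i; exact: nn_weight_diag.
- by move=> i; exact: sum_nn_weight.
- by move=> i; exact: g01.
Qed.

End label_law.

(** * Strong law of large numbers *)

Section borel_cantelli_exp.
Context (R : realType) d (Omega : measurableType d) (P : probability Omega R).

(** The Borel-Cantelli lemma for a geometric series. *)
Lemma ae_eventually_not (E : nat -> set Omega) (r : R) : 0 < r ->
  (forall n, (2 <= n)%N -> measurable (E n) /\
     (P (E n) <= (2 * expR (- r * n%:R))%:E)%E) ->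
  {ae P, forall w, \forall n \near \oo, ~ E n w}.
Proof.
move=> r0 H; pose F n := if (2 <= n)%N then E n else set0.
have mF n : measurable (F n) by rewrite /F; case: ifPn => // /H[].
pose z := expR (- r).
have z0 : 0 < z by exact: expR_gt0.
have z1 : z < 1 by rewrite -[ltRHS]expR0 ltr_expR oppr_lt0.
have PF n : (P (F n) <= (geometric 2 z n)%:E)%E.
  rewrite /F; case: ifPn => [/H[_ h]|_].
    by apply: (le_trans h); rewrite /= lee_fin /z -expRM_natr.
  by rewrite measure0 lee_fin geometric_ge0// ltW.
have sumF : (\sum_(n <oo) P (F n) < +oo)%E.
  apply: (@le_lt_trans _ _ (2 * (1 - z)^-1)%:E); last exact: ltry.
  apply: lime_le; first by apply: is_cvg_nneseries => n _ _; exact: measure_ge0.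
  apply: nearW => n; apply: (@le_trans _ _ (\sum_(0 <= i < n) (geometric 2 z i)%:E)%E).
    by apply: lee_sum => i _; exact: PF.
  rewrite sumEFin lee_fin; apply: (@geometric_le_lim _ n 2 z) => //.
  by rewrite ger0_norm// ltW.
exists (lim_sup_set F); split.
- by apply: bigcap_measurable => // k _; apply: bigcup_measurable => j _.
- exact: lim_sup_set_cvg0.
move=> w /= nE k _; apply: contrapT => nF; apply: nE.
exists (maxn 2 k) => // n /=; rewrite geq_max => /andP[n2 kn] En.
by apply: nF; exists n => //=; rewrite /F n2.
Qed.

Lemma ae_cvg0_of_tails (u : nat -> Omega -> R) (c : R) : 0 < c ->
  (forall e n, 0 < e -> e <= 1 -> (2 <= n)%N ->
    let E := [set w | n%:R * e <= `|u n w|] in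
    measurable E /\ (P E <= (2 * expR (- (e / (4 * c)) ^+ 2 * n%:R))%:E)%E) ->
  {ae P, forall w, (n%:R^-1 * u n w) @[n --> \oo] --> 0}.
Proof.
move=> c0 H.
have : {ae P, forall w, forall m : nat,
    \forall n \near \oo, ~ (n%:R * m.+1%:R^-1 <= `|u n w|)}.
  apply: ae_foralln => m; apply: (@ae_eventually_not _ ((m.+1%:R^-1 / (4 * c)) ^+ 2)).
    by rewrite exprn_gt0// divr_gt0// mulr_gt0.
  by move=> n n2; apply: H => //; rewrite invf_le1// ler1n.
apply: filterS => w h; apply/cvgrPdist_lt => /= e e0.
have := h (Num.truncn e^-1); apply: filterS2 (nbhs_infty_gt 0) => n n0 /negP.
rewrite -ltNge sub0r normrN normrM => un.
have n0' : 0 < n%:R :> R by rewrite ltr0n.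
rewrite gtr0_norm ?invr_gt0// mulrC ltr_pdivrMr//.
apply: (lt_le_trans un); rewrite mulrC ler_wpM2r ?(ltW n0')//.
rewrite invf_ple ?posrE//; exact/ltW/truncnS_gt.
Qed.

End borel_cantelli_exp.

Section slln.
Context (R : realType) d0 (Omega0 : measurableType d0) (P0 : probability Omega0 R)
  d (Omega : measurableType d) (P : probability Omega R)
  dS (S : measurableType dS) (W0 : Omega0 -> S) (W : nat -> Omega -> S).
Hypotheses (mW0 : measurable_fun [set: Omega0] W0)
  (mW : forall i, measurable_fun [set: Omega] (W i)).
Hypothesis iidW : iid_copies P0 P W0 W.

(** The exponential inequality for the linear function [sum_i x_i]. *)
Lemma indic_tail (B : set S) (e : R) n : measurable B -> 0 < e -> e <= 1 ->
  let E := [set w | n%:R * e <=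
    `|\sum_(i < n) \1_B (W i w) - n%:R * Ex P0 (\1_B \o W0)|] in
  measurable E /\ (P E <= (2 * expR (- (e / (4 * 1)) ^+ 2 * n%:R))%:E)%E.
Proof.
move=> mB e0 e1; set p := Ex _ _; move=> E.
have b0 : bmeas (\1_B \o W0 : Omega0 -> R).
  by apply: bmeas_comp => //; exact: bmeas_indic.
have bi i : bmeas (fun w => \1_B (W i w) : R).
  by apply: (bmeas_comp (mW i)); exact: bmeas_indic.
have p01 : 0 <= p <= 1.
  apply/andP; split; first by apply: Ex_ge0 => w; have /andP[] := indic01 R B (W0 w).
  rewrite -[leRHS](Ex_cst P0); apply: Ex_le => //; first exact: bmeas_cst.
  by move=> w; have /andP[] := indic01 R B (W0 w).
pose D (s : {ffun 'I_n -> bool}) : R := \sum_i (s i)%:R - n%:R * p.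
have mE : measurable E.
  apply: measurable_asbool; apply: measurable_fun_ler => //.
  apply: measurableT_comp => //; apply: measurable_funB => //.
  by apply: measurable_sum => i; case: (bi i).
split => //; rewrite -EFin_Ex_indic// lee_fin.
have bb (s : {ffun 'I_n -> bool}) : bmeas (fun w => bern (fun i : 'I_n => \1_B (W i w) : R) s).
  by apply: bmeas_prod => i; case: (s i) => //; apply: bmeasB => //; exact: bmeas_cst.
have -> : \1_E = fun w => \sum_s (n%:R * e <= `|D s|)%R%:R *
    bern (fun i : 'I_n => \1_B (W i w) : R) s.
  apply/funext => w; pose s := [ffun i : 'I_n => W i w \in B].
  rewrite (bigD1 s)//= bern_indic eqxx mulr1 big1 ?addr0 => [|t ts].
    have -> : D s = \sum_(i < n) \1_B (W i w) - n%:R * p.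
      by congr (_ - _); apply: eq_bigr => i _; rewrite ffunE indicE.
    rewrite indicE; congr (nat_of_bool _)%:R.
    by apply/idP/idP => [/set_mem|h]; last rewrite mem_set.
  by rewrite bern_indic (negbTE ts) mulr0.
rewrite Ex_sum => [|s]; last exact: bmeasZ.
under eq_bigr do rewrite ExZ//.
have -> : \sum_s (n%:R * e <= `|D s|)%R%:R *
    Ex P (fun w => bern (fun i : 'I_n => \1_B (W i w) : R) s) =
   \sum_s bern (fun=> p) s * (n%:R * e <= `|D s|)%R%:R.
  apply: eq_bigr => s _; rewrite mulrC; congr (_ * _).
  pose s' (i : nat) : bool := if insub i is Some j then s j else true.
  have s'E (i : 'I_n) : s' i = s i by rewrite /s' valK.
  pose f i x : R := if s' i then \1_B x else 1 - \1_B x.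
  transitivity (Ex P (fun w => \prod_(i < n) f i (W i w))).
    by congr Ex; apply/funext => w; apply: eq_bigr => i _; rewrite /f s'E.
  rewrite (iid_prod mW0 mW iidW).
  - apply: eq_bigr => i _; rewrite /f s'E; case: (s i) => //.
    by rewrite [LHS](ExB P0 (bmeas_cst _ _) b0) Ex_cst.
  - move=> i; rewrite /f; case: (s' i); first exact: measurable_indic.
    by apply: measurable_funB => //; exact: measurable_indic.
  - move=> i x; rewrite /f; have /andP[h0 h1] := indic01 R B x.
    by case: (s' i); rewrite ?h0// subr_ge0 h1 lerBlDr lerDl.
apply: mgf_tail => //; first by move=> s; exact: bern_ge0.
  by apply: (le_trans e1); rewrite mulr1 ler1n.
move=> l; rewrite mulr1 => l12.
have slope : affine_slope `|l| (fun x : 'I_n -> R => l * \sum_i x i).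
  move=> x i _; exists l => // a.
  rewrite -mulrDr; congr (_ * _).
  rewrite (bigD1 i)//= [in RHS](bigD1 i)//= /upd eqxx add0r addrC; congr (_ + _).
  by apply: eq_bigr => j ji; rewrite (negbTE ji).
have := bern_mgf (fun=> p01) l12 slope.
rewrite sumr_const card_ord real_normK ?num_real// => h.
have -> : \sum_(t : {ffun 'I_n -> bool}) bern (fun=> p) t * expR (l * D t) =
    (\sum_(t : {ffun 'I_n -> bool}) bern (fun=> p) t * expR (l * \sum_i (t i)%:R)) * expR (- (l * (p *+ n))).
  rewrite mulr_suml; apply: eq_bigr => s _; rewrite -mulrA -expRD /D mulrBr.
  by rewrite mulr_natl.
apply: (le_trans (ler_wpM2r (expR_ge0 _) h)); rewrite -expRD ler_expR addrK mulr1.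
by rewrite ler_wpM2r// ler_wpM2r ?sqr_ge0// ler_nat.
Qed.

Lemma slln_indic (B : set S) : measurable B ->
  {ae P, forall w, (n%:R^-1 * \sum_(i < n) \1_B (W i w)) @[n --> \oo] -->
     Ex P0 (\1_B \o W0)}.
Proof.
move=> mB.
have := @ae_cvg0_of_tails R _ Omega P (fun n w =>
  \sum_(i < n) \1_B (W i w) - n%:R * Ex P0 (\1_B \o W0)) 1 ltr01
  (fun e n e0 e1 _ => indic_tail n mB e0 e1).
apply: filterS => w h; apply/cvgrPdist_lt => /= e e0.
move/cvgrPdist_lt : h => /(_ e e0).
apply: filterS2 (nbhs_infty_gt 0) => n n0.
by rewrite sub0r normrN mulrBr mulrA mulVf ?mul1r 1?distrC// pnatr_eq0 -lt0n.
Qed.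

(** By layers: [level_sum N] is uniformly close to the identity and involves
    finitely many events. *)
Lemma slln (f : S -> R) : measurable_fun [set: S] f -> (forall s, 0 <= f s <= 1) ->
  {ae P, forall w, (n%:R^-1 * \sum_(i < n) f (W i w)) @[n --> \oo] -->
     Ex P0 (f \o W0)}.
Proof.
move=> mf f01.
pose L N (i : nat) : set S := f @^-1` `[i.+1%:R / N.+1%:R, +oo[.
have mL N i : measurable (L N i) by exact: measurable_preimage.
have LE N s : level_sum N (f s) = N.+1%:R^-1 * \sum_(i < N.+1) \1_(L N i) s.
  congr (_ * _); apply: eq_bigr => i _; rewrite indicE; congr (nat_of_bool _)%:R.
  by apply/idP/idP => [h|/set_mem]; [rewrite mem_set// /L/= in_itv/= h|rewrite /L/= in_itv/= andbT].
have : {ae P, forall w, forall N i : nat,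
    (n%:R^-1 * \sum_(j < n) \1_(L N i) (W j w)) @[n --> \oo] -->
     Ex P0 (\1_(L N i) \o W0)}.
  by apply: ae_foralln => N; apply: ae_foralln => i; exact: slln_indic.
apply: filterS => w h; apply/cvgrPdist_lt => /= e e0.
pose N := Num.truncn (4 / e).
have Ne : N.+1%:R^-1 < e / 4.
  by rewrite -[ltRHS]invf_div ltf_pV2 ?posrE ?divr_gt0//; exact: truncnS_gt.
pose lN n : R := N.+1%:R^-1 * \sum_(i < N.+1) n%:R^-1 * \sum_(j < n) \1_(L N i) (W j w).
pose l : R := N.+1%:R^-1 * \sum_(i < N.+1) Ex P0 (\1_(L N i) \o W0).
have lNl : lN n @[n --> \oo] --> l.
  by apply: cvgM; first exact: cvg_cst; apply: cvg_big => [|i _]; [exact: add_continuous|exact: h].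
have b0 i : bmeas (\1_(L N i) \o W0 : Omega0 -> R).
  by apply: (bmeas_comp mW0); exact: bmeas_indic.
have bf : bmeas (f \o W0) by apply: (bmeas_comp mW0); exact: bmeas01.
have bl : bmeas (fun w => level_sum N (f (W0 w))).
  under eq_fun do rewrite LE.
  by apply: bmeasZ; apply: bmeas_sum => i; exact: b0.
have lE : `|Ex P0 (f \o W0) - l| <= N.+1%:R^-1.
  have -> : l = Ex P0 (fun w => level_sum N (f (W0 w))).
    under [in RHS]eq_fun do rewrite LE.
    have b0' (i : 'I_N.+1) : bmeas (fun x => \1_(L N i) (W0 x) : R) by exact: b0.
    by rewrite (ExZ P0 _ (bmeas_sum _ _ b0')) (Ex_sum P0 _ _ b0').
  rewrite -ExB//; apply: (le_trans (Ex_norm _ (bmeasB bf bl))).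
  rewrite -[leRHS](Ex_cst P0); apply: Ex_le; [exact/bmeas_norm/bmeasB|exact: bmeas_cst|].
  by move=> x; exact: (level_sum_approx N (f01 (W0 x))).
have lNE n : (0 < n)%N -> `|lN n - n%:R^-1 * \sum_(i < n) f (W i w)| <= N.+1%:R^-1.
  move=> n0.
  have -> : lN n = n%:R^-1 * \sum_(j < n) level_sum N (f (W j w)).
    rewrite /lN -mulr_sumr mulrCA exchange_big/= mulr_sumr; congr (_ * _).
    by apply: eq_bigr => j _; rewrite LE.
  rewrite -mulrBr -sumrB normrM ger0_norm ?invr_ge0//.
  rewrite ler_pdivrMl ?ltr0n// (le_trans (ler_norm_sum _ _ _))//.
  rewrite mulr_natl -[in leRHS](card_ord n) -sumr_const.
  by apply: ler_sum => i _; rewrite distrC; exact: level_sum_approx.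
move/cvgrPdist_lt : lNl => /(_ (e / 4)); rewrite divr_gt0// => /(_ isT).
apply: filterS2 (nbhs_infty_gt 0) => n n0 ln.
have := lNE n n0; set x := n%:R^-1 * _; move: lE ln Ne.
rewrite !ltr_norml !ler_norml.
move: (lN n) l (Ex _ _) x N.+1%:R^-1 => a b c y z.
by move=> /andP[? ?] /andP[? ?] ? /andP[? ?]; apply/andP; split; lra.
Qed.

End slln.

(** * Oscillation of a function along the nearest-neighbour graph *)

Lemma cvg0_near_le (R : realType) (u : nat -> R) :
  (forall e : R, 0 < e -> \forall n \near \oo, `|u n| <= e) -> u @ \oo --> (0 : R).
Proof.
move=> h; apply/cvgrPdist_le => /= e e0; apply: filterS (h e e0) => n.
by rewrite sub0r normrN.
Qed.

Lemma Ex_cvg0 (R : realType) d (T : measurableType d) (P : probability T R)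
    (f : nat -> T -> R) :
  (forall m, measurable_fun [set: T] (f m)) -> (forall m x, `|f m x| <= 1) ->
  (forall x, (f m x) @[m --> \oo] --> (0 : R)) ->
  (Ex P (f m)) @[m --> \oo] --> (0 : R).
Proof.
move=> mf f1 f0.
have bf m : bmeas (f m) by split => //; exists 1.
have : (\int[P]_x (f m x)%:E)%E @[m --> \oo] --> 0%:E.
  rewrite -[X in _ --> X](integral0 P setT).
  apply: (@dominated_cvg _ _ _ P setT measurableT (fun m x => (f m x)%:E) (cst 0%E) (cst 1%E)) => //.
  - by move=> m; apply/measurable_EFinP.
  - by move=> x _; apply: cvg_EFin; [exact: nearW|exact: f0].
  - exact: finite_measure_integrable_cst.
  - by move=> m x _; rewrite /= lee_fin.
by move/fine_cvg.
Qed.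

Section displacement.
Context (R : realType) (k : nat).
Implicit Types (x : nat -> k.-tuple R) (h : k.-tuple R -> R).

Definition disp x h n : R := n%:R^-1 * \sum_(i < n) \sum_(j < n)
  nn_weight (fun j : 'I_n => x j) i j * `|h (x i) - h (x j)|.

Lemma disp_ge0 x h n : 0 <= disp x h n.
Proof.
rewrite mulr_ge0// sumr_ge0// => i _; rewrite sumr_ge0// => j _.
by rewrite mulr_ge0// nn_weight_ge0.
Qed.

(** Replacing [h] by [h'] costs the average of [h - h'] at the points and at
    their neighbours; a point is the neighbour of boundedly many others. *)
Lemma disp_le x h h' n : (2 <= n)%N -> disp x h n <=
  disp x h' n + (indeg R k).+1%:R * (n%:R^-1 * \sum_(i < n) `|h (x i) - h' (x i)|).
Proof.
move=> n2; rewrite mulrCA -mulrDr ler_wpM2l//.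
pose d v := `|h v - h' v|; pose wt := nn_weight (fun j : 'I_n => x j).
apply: (@le_trans _ _ (\sum_(i < n) \sum_(j < n)
    (wt i j * `|h' (x i) - h' (x j)| + (wt i j * d (x i) + wt i j * d (x j))))).
  apply: ler_sum => i _; apply: ler_sum => j _.
  rewrite -!mulrDr ler_wpM2l ?nn_weight_ge0//.
  have -> : h (x i) - h (x j) = (h' (x i) - h' (x j)) +
     ((h (x i) - h' (x i)) - (h (x j) - h' (x j))) by ring.
  by rewrite (le_trans (ler_normD _ _))// lerD2l ler_normB.
under eq_bigr do rewrite big_split/=.
rewrite big_split/= lerD2l.
under eq_bigr do rewrite big_split/=.
rewrite big_split/= -nat1r mulrDl mul1r; apply: lerD.
  rewrite le_eqVlt; apply/orP; left; apply/eqP; apply: eq_bigr => i _.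
  by rewrite -mulr_suml sum_nn_weight// mul1r.
rewrite exchange_big/= mulr_sumr; apply: ler_sum => j _.
by rewrite -mulr_suml ler_wpM2r ?normr_ge0// in_weight_le.
Qed.

Lemma disp_le_add x h h1 h2 n : (2 <= n)%N ->
  (forall u v, `|h u - h v| <= `|h1 u - h1 v| + `|h2 u - h2 v|) ->
  disp x h n <= disp x h1 n + disp x h2 n.
Proof.
move=> n2 H; rewrite -mulrDr ler_wpM2l// -big_split/=; apply: ler_sum => i _.
rewrite -big_split/=; apply: ler_sum => j _.
by rewrite -mulrDr ler_wpM2l ?nn_weight_ge0.
Qed.

(** By continuity along the graph, the conditional mean of the pair statistic is
    close to a sum of independent terms. *)
Lemma quad_disp x h n : (2 <= n)%N -> (forall v, 0 <= h v <= 1) ->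
  `|n%:R^-1 * quad (nn_weight (fun j : 'I_n => x j)) (fun i : 'I_n => h (x i)) -
    n%:R^-1 * \sum_(i < n) h (x i) ^+ 2| <= disp x h n.
Proof.
move=> n2 h01; rewrite -mulrBr normrM ger0_norm ?invr_ge0// ler_wpM2l//.
pose wt := nn_weight (fun j : 'I_n => x j).
rewrite /quad -sumrB (le_trans (ler_norm_sum _ _ _))//; apply: ler_sum => i _.
have -> : h (x i) ^+ 2 = \sum_(j < n) wt i j * h (x i) * h (x i).
  by rewrite -mulr_suml -mulr_suml sum_nn_weight// mul1r.
rewrite -sumrB (le_trans (ler_norm_sum _ _ _))//; apply: ler_sum => j _.
have /andP[h0 h1] := h01 (x i).
rewrite -mulrBr normrM normrM (ger0_norm (nn_weight_ge0 _ _ _)) (ger0_norm h0).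
by rewrite -mulrA ler_wpM2l ?nn_weight_ge0// distrC ler_piMl.
Qed.

End displacement.

Section random_points.
Context (R : realType) (k : nat)
  d0 (Omega0 : measurableType d0) (P0 : probability Omega0 R)
  d (Omega : measurableType d) (P : probability Omega R)
  (V : Omega0 -> k.-tuple R) (Vs : nat -> Omega -> k.-tuple R).
Hypotheses (mV : measurable_fun [set: Omega0] V)
  (mVs : forall i, measurable_fun [set: Omega] (Vs i)).
Hypothesis iidV : iid_copies P0 P V Vs.

Let path w : nat -> k.-tuple R := fun i => Vs i w.

(** Functions that asymptotically do not separate a point from its nearest
    neighbours; the goal is that all measurable functions do so. *)
Definition nn_continuous (h : k.-tuple R -> R) :=
  {ae P, forall w, disp (path w) h @ \oo --> (0 : R)}.

(** Bounded points are close to their neighbours with boundedly many exceptions,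
    and unbounded points are rare by the law of large numbers. *)
Lemma nn_continuous_clip (m c : R) l : 0 <= m -> nn_continuous (clip_coord m c l).
Proof.
move=> m0.
pose far (C : nat) : set (k.-tuple R) :=
  [set v | ~~ [forall a, `|tnth v a| <= C%:R]%R].
have mfar C : measurable (far C).
  rewrite (_ : far C = ~` \bigcap_(a in [set: 'I_k]) [set v | `|tnth v a| <= C%:R]).
    apply: measurableC; apply: fin_bigcap_measurable => [|a _]; first exact: finite_finset.
    apply: measurable_asbool; apply: measurable_fun_ler => //.
    by apply: measurableT_comp => //; exact: measurable_tnth.
  apply/seteqP; split => v /=.
    by move=> /negP h h'; apply: h; apply/forallP => a; exact: h'.
  by move=> h; apply/negP => /forallP h'; apply: h => a _; exact: h'.
have far0 : Ex P0 (\1_(far C) \o V) @[C --> \oo] --> (0 : R).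
  apply: (@Ex_cvg0 _ _ _ P0 (fun C w => \1_(far C) (V w))).
  - by move=> C; apply: measurableT_comp => //; exact: measurable_indic.
  - by move=> C w; have /andP[? ?] := indic01 R (far C) (V w); rewrite ger0_norm.
  move=> w; apply: cvg_near_cst.
  exists (\sum_a (Num.truncn `|tnth (V w) a|).+1)%N => // C /= hC.
  rewrite indicE memNset//= => /negP; apply; apply/forallP => a.
  apply: (le_trans (ltW (truncnS_gt _))); rewrite ler_nat; apply: leq_trans hC.
  by rewrite (bigD1 a)//= leq_addr.
have : {ae P, forall w, forall C : nat,
    (n%:R^-1 * \sum_(i < n) \1_(far C) (Vs i w)) @[n --> \oo] -->
     Ex P0 (\1_(far C) \o V)}.
  by apply: ae_foralln => C; exact: (slln_indic mV mVs iidV).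
apply: filterS => w h; apply: cvg0_near_le => e e0.
have e3 : 0 < e / 3 by rewrite divr_gt0.
pose dl := e / 3 / (m + 1).
have m1 : 0 < m + 1 by rewrite ltr_wpDl.
have dl0 : 0 < dl by rewrite divr_gt0.
have mdl : m * dl <= e / 3.
  by rewrite /dl mulrCA ler_piMr ?(ltW e3)// ler_pdivrMr// mul1r lerDl.
have [C farC] : exists C : nat, Ex P0 (\1_(far C) \o V) < e / 6.
  have e6 : 0 < e / 6 by rewrite divr_gt0.
  move/cvgrPdist_lt : far0 => /(_ _ e6)[C _ /(_ C (leqnn C))].
  by rewrite /= sub0r normrN => /ltr_normlW hC; exists C.
have e6 : 0 < e / 6 by rewrite divr_gt0.
have hfar : \forall n \near \oo, n%:R^-1 * \sum_(i < n) \1_(far C) (Vs i w) <= e / 3.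
  move/cvgrPdist_lt : (h C) => /(_ _ e6); apply: filterS => n.
  by rewrite distrC => /ltr_normlW; lra.
pose pk := pack_bound k (C%:R : R) (dl ^+ 2).
have hpk : \forall n \near \oo, n%:R^-1 * pk%:R <= e / 3.
  exists (Num.truncn (pk%:R / (e / 3))).+1 => // n /= hn.
  have n0 : 0 < n%:R :> R by rewrite ltr0n (leq_trans _ hn).
  rewrite ler_pdivrMl// -ler_pdivrMr//.
  by apply: (le_trans (ltW (truncnS_gt _))); rewrite ler_nat.
near=> n; rewrite ger0_norm ?disp_ge0//.
have n2 : (2 <= n)%N by near: n; exists 2.
have n0 : 0 < n%:R :> R by rewrite ltr0n (leq_trans _ n2).
have := disp_clip_le (fun j : 'I_n => Vs j w) c (C%:R) l n2 m0 dl0.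
rewrite -/pk -(ler_pM2l (_ : 0 < n%:R^-1)) ?invr_gt0// => hd.
apply: (le_trans hd); rewrite 2!mulrDr mulKf ?gt_eqF//.
have h1 : n%:R^-1 * pk%:R <= e / 3 by near: n.
have : n%:R^-1 * \sum_(i < n) \1_(far C) (Vs i w) <= e / 3 by near: n.
rewrite [X in n%:R^-1 * X <= _](eq_bigr (fun i : 'I_n =>
  (~~ [forall a, `|tnth (Vs i w) a| <= C%:R]%R)%:R)) => [h2|i _]; last first.
  rewrite indicE; congr (nat_of_bool _)%:R.
  by apply/idP/idP => [/set_mem|hh]; last rewrite mem_set.
by rewrite [leRHS](_ : e = e / 3 + e / 3 + e / 3) ?lerD//; field.
Unshelve. all: by end_near. Qed.

(** [L^1] approximation: the perturbation bound of [disp_le] only involves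
    averages, to which the law of large numbers applies. *)
Lemma nn_continuous_lim (h : k.-tuple R -> R) (hs : nat -> k.-tuple R -> R) :
  measurable_fun [set: k.-tuple R] h -> (forall v, 0 <= h v <= 1) ->
  (forall m, measurable_fun [set: k.-tuple R] (hs m)) ->
  (forall m v, 0 <= hs m v <= 1) ->
  (forall v, hs m v @[m --> \oo] --> h v) ->
  (forall m, nn_continuous (hs m)) -> nn_continuous h.
Proof.
move=> mh h01 mhs hs01 hsh good.
pose df m v := `|h v - hs m v|.
have mdf m : measurable_fun setT (df m).
  by apply: measurableT_comp => //; exact: measurable_funB.
have df01 m v : 0 <= df m v <= 1.
  rewrite /df normr_ge0 ler_norml; have /andP[? ?] := h01 v.
  by have /andP[? ?] := hs01 m v; apply/andP; split; lra.
have df0 : Ex P0 (df m \o V) @[m --> \oo] --> (0 : R).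
  apply: (@Ex_cvg0 _ _ _ P0 (fun m w => df m (V w))).
  - by move=> m; apply: measurableT_comp.
  - by move=> m w; have /andP[? ?] := df01 m (V w); rewrite ger0_norm.
  move=> w; apply: cvg0_near_le => e e0.
  move/cvgrPdist_le : (hsh (V w)) => /(_ _ e0); apply: filterS => m.
  by rewrite /df normr_id.
have : {ae P, forall w, forall m : nat,
    (n%:R^-1 * \sum_(i < n) df m (Vs i w)) @[n --> \oo] --> Ex P0 (df m \o V) /\
    disp (path w) (hs m) @ \oo --> (0 : R)}.
  by apply: ae_foralln => m; apply: filterS2 (slln mV mVs iidV (mdf m) (df01 m)) (good m).
apply: filterS => w H; apply: cvg0_near_le => e e0.
pose c : R := (indeg R k).+1%:R.
have c0 : 0 < c by rewrite ltr0n.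
have [m dfm] : exists m, Ex P0 (df m \o V) < e / 3 / c.
  have e3 : 0 < e / 3 / c by rewrite !divr_gt0.
  move/cvgrPdist_lt : df0 => /(_ _ e3)[m _ /(_ m (leqnn m))].
  by rewrite /= sub0r normrN => /ltr_normlW hm; exists m.
have [h1 h2] := H m.
have ec : 0 < e / 3 / c by rewrite !divr_gt0.
have e3 : 0 < e / 3 by rewrite divr_gt0.
move/cvgrPdist_lt : h1 => /(_ _ ec) h1; move/cvgrPdist_lt : h2 => /(_ _ e3) h2.
near=> n; rewrite ger0_norm ?disp_ge0//.
have n2 : (2 <= n)%N by near: n; exists 2.
apply: (le_trans (disp_le (path w) h (hs m) n2)).
have d1 : disp (path w) (hs m) n < e / 3.
  have : `|0 - disp (path w) (hs m) n| < e / 3 by near: n.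
  by rewrite sub0r normrN => /ltr_normlW.
have d2 : n%:R^-1 * \sum_(i < n) df m (Vs i w) <= 2 * (e / 3 / c).
  have : `|Ex P0 (df m \o V) - n%:R^-1 * \sum_(i < n) df m (Vs i w)| < e / 3 / c.
    by near: n.
  rewrite distrC => /ltr_normlW; move: dfm; move: (Ex _ _) (e / 3 / c).
  by move: (n%:R^-1 * _) => a b z; lra.
have : c * (n%:R^-1 * \sum_(i < n) df m (Vs i w)) <= c * (2 * (e / 3 / c)).
  by rewrite ler_pM2l.
rewrite [c * (2 * _)](_ : _ = 2 * (e / 3)) => [d3|]; last by field; rewrite gt_eqF.
rewrite -/c; move: d1 d3; rewrite /df /path.
by move: (disp _ _ _) (c * _) => a b; lra.
Unshelve. all: by end_near. Qed.

Lemma nn_continuous_le (h h1 h2 : k.-tuple R -> R) :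
  (forall u v, `|h u - h v| <= `|h1 u - h1 v| + `|h2 u - h2 v|) ->
  nn_continuous h1 -> nn_continuous h2 -> nn_continuous h.
Proof.
move=> H; apply: filterS2 => w c1 c2.
have c12 : disp (path w) h1 n + disp (path w) h2 n @[n --> \oo] --> (0 : R).
  by rewrite -[X in _ --> X]addr0; exact: cvgD.
apply: (@squeeze_cvgr _ _ _ R (cst 0) _ _ _ 0 _ c12); last exact: cvg_cst.
exists 2 => // n n2; rewrite disp_ge0; exact: disp_le_add.
Qed.

Lemma nn_continuous_cst c : nn_continuous (cst c).
Proof.
apply: nearW => w; rewrite (_ : disp _ _ = cst 0); first exact: cvg_cst.
apply/funext => n; rewrite /disp big1 ?mulr0// => i _; rewrite big1// => j _.
by rewrite /= subrr normr0 mulr0.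
Qed.

(** The sets whose indicator has this property form a sigma-algebra that
    contains the half-spaces, by approximation with Lipschitz functions. *)
Lemma nn_continuous_indic (A : set (k.-tuple R)) : measurable A ->
  nn_continuous \1_A.
Proof.
pose G := [set A : set (k.-tuple R) | measurable A /\ nn_continuous \1_A].
suff : measurable `<=` G by move=> h /h[].
move: A => _.
have GC A : G A -> G (~` A).
  move=> [mA gA]; split; first exact: measurableC.
  apply: (nn_continuous_le _ gA (nn_continuous_cst 0)) => u v.
  rewrite subrr normr0 addr0 !indicE !in_setC.
  by case: (u \in A); case: (v \in A); rewrite ?subrr ?sub0r ?subr0 ?normrN.
have G0 : G set0.
  split => //; rewrite indic0; exact: nn_continuous_cst.
have GU A B : G A -> G B -> G (A `|` B).
  move=> [mA gA] [mB gB]; split; first exact: measurableU.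
  apply: (nn_continuous_le _ gA gB) => u v; rewrite !indicE !in_setU.
  case: (u \in A); case: (v \in A); case: (u \in B); case: (v \in B) => /=;
  by rewrite ?subrr ?sub0r ?subr0 ?normrN ?normr1 ?normr0 ?addr0 ?add0r ?ler01 ?lexx ?lerDl ?ler01.
have GbU (F : nat -> set (k.-tuple R)) : (forall i, G (F i)) -> G (\bigcup_i F i).
  move=> GF; have GU' n : G (\big[setU/set0]_(i < n) F i).
    elim: n => [|n ih]; first by rewrite big_ord0.
    by rewrite big_ord_recr/=; exact: GU.
  split; first by apply: bigcup_measurable => i _; case: (GF i).
  apply: (@nn_continuous_lim _ (fun m => \1_(\big[setU/set0]_(i < m) F i))).
  - by apply: measurable_indic; apply: bigcup_measurable => i _; case: (GF i).
  - by move=> v; exact: indic01.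
  - by move=> m; apply: measurable_indic; case: (GU' m).
  - by move=> m v; exact: indic01.
  - move=> v; rewrite indicE; have [vF|vF] := boolP (v \in _).
      move/set_mem : vF => [i _ Fi]; apply: cvg_near_cst.
      exists i.+1 => // m /= im; rewrite indicE mem_set//.
      by rewrite -bigcup_mkord; exists i.
    apply: cvg_near_cst; apply: nearW => m; rewrite indicE memNset//.
    rewrite -bigcup_mkord => -[i _ Fi]; move/negP : vF; apply.
    by rewrite mem_set//; exists i.
  - by move=> m; case: (GU' m).
have Gray l (c : R) : G [set v | tnth v l < c].
  split.
    apply: measurable_asbool; apply: measurable_fun_ltr => //.
    exact: measurable_tnth.
  apply: (@nn_continuous_lim _ (fun m => clip_coord m%:R c l)).
  - apply: measurable_indic; apply: measurable_asbool; apply: measurable_fun_ltr => //.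
    exact: measurable_tnth.
  - by move=> v; exact: indic01.
  - move=> m; rewrite /clip_coord; apply: measurable_minr => //.
    apply: measurable_maxr => //; apply: measurable_funM => //.
    by apply: measurable_funB => //; exact: measurable_tnth.
  - by move=> m v; rewrite /clip_coord ge_min le_min lexx ler01 le_max lexx.
  - move=> v; rewrite indicE; apply: cvg_near_cst.
    have [vc|vc] := ltP (tnth v l) c; last first.
      rewrite memNset; last by rewrite /= ltNge vc.
      apply: nearW => m; rewrite /clip_coord max_l ?min_r//.
      by rewrite mulr_ge0_le0// subr_le0.
    rewrite mem_set//.
    have cv : 0 < c - tnth v l by rewrite subr_gt0.
    exists (Num.truncn (c - tnth v l)^-1).+1 => // m /= hm.
    rewrite /clip_coord min_l// le_max; apply/orP; right.
    rewrite -ler_pdivrMr// mul1r (le_trans (ltW (truncnS_gt _)))//.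
    by rewrite ler_nat.
  - by move=> m; exact: nn_continuous_clip.
have coordG l (B : set R) : measurable B -> G [set v | B (tnth v l)].
  suff : <<s @RGenInftyO.G R >> `<=` [set B | G [set v | B (tnth v l)]].
    move=> h mB; apply: h; move: mB.
    rewrite /measurable/= -[<<s _ >>]/(measurable :
      set (set (g_sigma_algebraType (@RGenInftyO.G R)))).
    by rewrite -(RGenInftyO.measurableE R).
  apply: smallest_sub; last first.
    move=> _ [c ->] /=; rewrite (_ : [set v | _] = [set v | tnth v l < c])//.
  split => //= [B' GB'|F GF].
  - rewrite (_ : [set v | _] = ~` [set v | B' (tnth v l)]); first exact: GC GB'.
    by apply/seteqP; split => v /= => [[]|].
  - exact: GbU _ GF.
apply: smallest_sub.
  by split => // B GB; rewrite setTD; exact: GC.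
move=> C; rewrite -bigcup_seq/= => -[l _ [B mB <-]].
by rewrite setTI; exact: coordG.
Qed.

Lemma nn_continuous_measurable (g : k.-tuple R -> R) :
  measurable_fun [set: k.-tuple R] g -> (forall v, 0 <= g v <= 1) ->
  nn_continuous g.
Proof.
move=> mg g01.
pose L N (i : nat) : set (k.-tuple R) := g @^-1` `[i.+1%:R / N.+1%:R, +oo[.
have mL N i : measurable (L N i) by exact: measurable_preimage.
have LE N v : level_sum N (g v) = N.+1%:R^-1 * \sum_(i < N.+1) \1_(L N i) v.
  congr (_ * _); apply: eq_bigr => i _; rewrite indicE; congr (nat_of_bool _)%:R.
  by apply/idP/idP => [h|/set_mem]; [rewrite mem_set// /L/= in_itv/= h|rewrite /L/= in_itv/= andbT].
apply: (@nn_continuous_lim _ (fun N v => level_sum N (g v))) => //.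
- move=> N; under eq_fun do rewrite LE.
  by apply: measurable_funM => //; apply: measurable_sum => i; exact: measurable_indic.
- move=> N v; rewrite /level_sum mulr_ge0//=; last by rewrite sumr_ge0.
  rewrite ler_pdivrMl ?ltr0n// mulr1 -natr_sum ler_nat.
  by rewrite -[leqRHS]card_ord -sum1_card; apply: leq_sum => i _; case: (_ <= _)%R.
- move=> v; apply/cvgrPdist_le => /= e e0.
  exists (Num.truncn e^-1) => // N /= hN.
  apply: (le_trans (level_sum_approx N (g01 v))).
  rewrite invf_ple ?posrE ?ltr0n//.
  by rewrite (le_trans (ltW (truncnS_gt _)))// ler_nat ltnS.
- move=> N.
  have sumG n : nn_continuous (fun v => \sum_(i < n) \1_(L N i) v).
    elim: n => [|n ih].
      under eq_fun do rewrite big_ord0; exact: nn_continuous_cst.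
    apply: (nn_continuous_le _ ih (nn_continuous_indic (mL N n))) => u v.
    rewrite !big_ord_recr/= opprD addrACA; exact: ler_normD.
  apply: (nn_continuous_le _ (sumG N.+1) (nn_continuous_cst 0)) => u v.
  rewrite !LE -mulrBr normrM subrr normr0 addr0 ger0_norm ?invr_ge0//.
  by rewrite ler_piMl// invf_le1 ?ler1n.
Qed.

End random_points.

(** * Labels of nearest neighbours *)

Lemma ae_ex (R : realType) d (T : measurableType d) (P : probability T R)
  (Q : T -> Prop) : {ae P, forall x, Q x} -> exists x, Q x.
Proof.
move=> [A [mA PA QA]]; apply: contrapT => nQ.
have AT : A = setT.
  by apply/seteqP; split => // x _; apply: QA => Qx; apply: nQ; exists x.
have := probability_setT P; rewrite -AT [LHS]PA => /eqP.
by rewrite eqe eq_sym oner_eq0.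
Qed.

Lemma iid_copies_comp (R : realType) d0 (Omega0 : measurableType d0)
  (P0 : probability Omega0 R) d (Omega : measurableType d)
  (P : probability Omega R) dS (S : measurableType dS) dS' (S' : measurableType dS')
  (W0 : Omega0 -> S) (W : nat -> Omega -> S) (phi : S -> S') :
  measurable_fun [set: S] phi -> iid_copies P0 P W0 W ->
  iid_copies P0 P (phi \o W0) (fun i => phi \o W i).
Proof.
move=> mphi [same indep]; split => [i B mB|I B mB].
  by apply: (same i (phi @^-1` B)); exact: measurable_preimage.
by apply: (indep I (fun i => phi @^-1` B i)) => i; exact: measurable_preimage.
Qed.

(** The version [g] is a function of the value of [V], not of the sample point,
    so that it can be evaluated at the points of the sample. *)
Definition has_cond_prob (R : realType) k d0 (Omega0 : measurableType d0)
    (P0 : probability Omega0 R) (Y : Omega0 -> R) (V : Omega0 -> k.-tuple R)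
    (B : set R) (g : k.-tuple R -> R) :=
  [/\ measurable_fun [set: k.-tuple R] g, (forall v, 0 <= g v <= 1) &
   forall C, measurable C ->
   Ex P0 (fun w => \1_B (Y w) * \1_C (V w)) = Ex P0 (fun w => g (V w) * \1_C (V w))].

Section nn_pairs.
Context (R : realType) (k : nat)
  d0 (Omega0 : measurableType d0) (P0 : probability Omega0 R)
  d (Omega : measurableType d) (P : probability Omega R)
  (Y : Omega0 -> R) (V : Omega0 -> k.-tuple R)
  (Ys : nat -> Omega -> R) (Vs : nat -> Omega -> k.-tuple R)
  (M : forall n, 'I_n -> Omega -> 'I_n).
Arguments M : clear implicits.
Hypotheses (mY : measurable_fun [set: Omega0] Y)
  (mV : measurable_fun [set: Omega0] V)
  (mYs : forall i, measurable_fun [set: Omega] (Ys i))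
  (mVs : forall i, measurable_fun [set: Omega] (Vs i)).
Hypothesis iid : iid_copies P0 P (fun w => (Y w, V w)) (fun i w => (Ys i w, Vs i w)).
Hypothesis nnM : forall n, (2 <= n)%N ->
  uniform_nearest P (fun w => [tuple (Ys j w, Vs j w) | j < n])
    (fun j w => Vs j w) (M n).

Let iidV : iid_copies P0 P V Vs.
Proof. exact: (iid_copies_comp (@measurable_snd _ _ R (k.-tuple R)) iid). Qed.

Let iidY : iid_copies P0 P Y Ys.
Proof. exact: (iid_copies_comp (@measurable_fst _ _ R (k.-tuple R)) iid). Qed.

(** A point and its nearest neighbour behave like two conditionally independent
    labels at the same point. The pair statistic concentrates around its
    conditional mean by [nn_pair_tail]; this mean is nearly the average of [g^2]
    at the points by [quad_disp]; the law of large numbers concludes. *)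
Lemma nn_pair_cvg (B : set R) (g : k.-tuple R -> R) :
  measurable B -> has_cond_prob P0 Y V B g ->
  {ae P, forall w, (n%:R^-1 * \sum_(i < n)
      \1_B (Ys i w) * \1_B (Ys (M n i w) w)) @[n --> \oo] -->
    Ex P0 (fun w => g (V w) ^+ 2)}.
Proof.
move=> mB [mg g01 gE].
have c0 : 0 < (indeg R k).+1%:R :> R by rewrite ltr0n.
have tails := ae_cvg0_of_tails c0 (fun e n e0 e1 n2 =>
  nn_pair_tail mY mV mYs mVs iid mB mg g01 gE n2 (nnM n2) e0 e1).
have cont := nn_continuous_measurable mV mVs iidV mg g01.
have g2 : measurable_fun setT (fun v => g v ^+ 2) by exact: measurable_funX.
have g201 v : 0 <= g v ^+ 2 <= 1.
  by have /andP[? ?] := g01 v; rewrite sqr_ge0/= expr_le1.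
have lln := slln mV mVs iidV g2 g201.
apply: filterS3 tails cont lln => w t c l.
pose q n := quad (nn_weight (fun j : 'I_n => Vs j w)) (fun i : 'I_n => g (Vs i w)).
pose s n := n%:R^-1 * \sum_(i < n) g (Vs i w) ^+ 2.
have qs : n%:R^-1 * q n - s n @[n --> \oo] --> (0 : R).
  apply: cvg0_near_le => e e0.
  move/cvgrPdist_le : c => /(_ e e0); apply: filterS2 (nbhs_infty_gt 1) => n n2.
  rewrite sub0r normrN ger0_norm ?disp_ge0// => de.
  by apply: le_trans de; exact: (quad_disp (fun i => Vs i w) n2 g01).
rewrite -[X in _ --> X](add0r) -[X in X + _](add0r (0 : R)).
apply: cvg_trans (cvgD (cvgD t qs) l); apply: near_eq_cvg; apply: nearW => n /=.
by rewrite !fctE mulrBr /s /q addrA subrK subrK.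
Qed.

Hypothesis cond_prob : forall B, measurable B -> exists g, has_cond_prob P0 Y V B g.

(** The indicators of [J] at a point and at its neighbour add up to one, plus
    the pair statistic of [J], minus that of the complement of [J]. *)
Lemma nn_count_cvg (J : set R) : measurable J ->
  {ae P, forall w, (n%:R^-1 * \sum_(i < n)
     (\1_J (Ys i w) + \1_J (Ys (M n i w) w))) @[n --> \oo] -->
     2 * Ex P0 (\1_J \o Y)}.
Proof.
move=> mJ; have [g gP] := cond_prob mJ; have [mg g01 gE] := gP.
have bJ : bmeas (\1_J \o Y : Omega0 -> R).
  by apply: bmeas_comp => //; exact: bmeas_indic.
have bg : bmeas (g \o V) by apply: bmeas_comp => //; exact: bmeas01.
have hJC x : \1_(~` J) x = 1 - \1_J x :> R.
  by rewrite !indicE in_setC; case: (_ \in _); rewrite ?subrr ?subr0.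
have gP' : has_cond_prob P0 Y V (~` J) (fun v => 1 - g v).
  split; first exact: measurable_funB.
    by move=> v; have /andP[? ?] := g01 v; apply/andP; split; lra.
  move=> C mC.
  have bC : bmeas (\1_C \o V : Omega0 -> R).
    by apply: bmeas_comp => //; exact: bmeas_indic.
  under [in LHS]eq_fun do rewrite hJC mulrBl mul1r.
  under [in RHS]eq_fun do rewrite mulrBl mul1r.
  rewrite [LHS](ExB P0 bC (bmeasM bJ bC)) [RHS](ExB P0 bC (bmeasM bg bC)).
  by congr (_ - _); exact: gE.
have h1 := nn_pair_cvg mJ gP.
have h2 := nn_pair_cvg (measurableC mJ) gP'.
have Eg : Ex P0 (g \o V) = Ex P0 (\1_J \o Y).
  have := gE _ measurableT; under eq_fun do rewrite indicT mulr1.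
  by under [in RHS]eq_fun do rewrite indicT mulr1.
have E2 : Ex P0 (fun w => (1 - g (V w)) ^+ 2) =
    1 - 2 * Ex P0 (g \o V) + Ex P0 (fun w => g (V w) ^+ 2).
  have b2 : bmeas (fun w => g (V w) ^+ 2) by exact: (bmeasX 2 bg).
  rewrite -(ExZ P0 2 bg) -[X in X - _](Ex_cst P0 1).
  rewrite -(ExB P0 (bmeas_cst _ 1) (bmeasZ 2 bg)).
  rewrite -(ExD P0 (bmeasB (bmeas_cst _ 1) (bmeasZ 2 bg)) b2).
  by congr Ex; apply/funext => w /=; ring.
apply: filterS2 h1 h2 => w c1 c2.
have c3 : 1 + (n%:R^-1 * \sum_(i < n) \1_J (Ys i w) * \1_J (Ys (M n i w) w)) -
    n%:R^-1 * \sum_(i < n) \1_(~` J) (Ys i w) * \1_(~` J) (Ys (M n i w) w)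
    @[n --> \oo] --> 2 * Ex P0 (\1_J \o Y).
  have -> : 2 * Ex P0 (\1_J \o Y) = 1 + Ex P0 (fun w => g (V w) ^+ 2) -
      Ex P0 (fun w => (1 - g (V w)) ^+ 2) by rewrite E2 Eg; ring.
  by apply: cvgB => //; apply: cvgD => //; exact: cvg_cst.
apply: cvg_trans c3; apply: near_eq_cvg; apply: filterS (nbhs_infty_gt 0) => n n0.
rewrite -[X in X + _ - _](mulVf (_ : n%:R != 0 :> R)) ?pnatr_eq0 -?lt0n//.
rewrite -mulrDr -mulrBr; congr (_ * _).
rewrite [X in X + _ - _](_ : n%:R = \sum_(i < n) 1); last by rewrite sumr_const card_ord.
rewrite -big_split/= -sumrB.
by apply: eq_bigr => i _; rewrite !hJC; ring.
Qed.

End nn_pairs.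

(** * Uniform convergence over levels *)

Section grid.
Context (R : realType) d0 (Omega0 : measurableType d0) (P0 : probability Omega0 R)
  (Y : Omega0 -> R).
Hypothesis mY : measurable_fun [set: Omega0] Y.

Definition mass (A : set R) : R := Ex P0 (\1_A \o Y).

Lemma bmeas_mass (A : set R) : measurable A -> bmeas (\1_A \o Y : Omega0 -> R).
Proof. by move=> mA; apply: bmeas_comp => //; exact: bmeas_indic. Qed.

Lemma mass_ge0 A : 0 <= mass A.
Proof. by apply: Ex_ge0 => w; have /andP[] := indic01 R A (Y w). Qed.

Lemma le_mass (A B : set R) : measurable A -> measurable B -> A `<=` B ->
  mass A <= mass B.
Proof.
move=> mA mB AB; apply: Ex_le; [exact: bmeas_mass|exact: bmeas_mass|move=> w /=].
rewrite !indicE; case: (boolP (_ \in A)) => [/set_mem/AB h|_]; last by rewrite ler0n.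
by rewrite mem_set.
Qed.

Lemma mass_shrink (F : nat -> set R) (e : R) : 0 < e -> (forall n, measurable (F n)) ->
  (forall x, \forall n \near \oo, ~ F n x) ->
  \forall n \near \oo, mass (F n) <= e.
Proof.
move=> e0 mF F0.
have /cvgrPdist_le/(_ _ e0) : mass (F n) @[n --> \oo] --> (0 : R).
  apply: (@Ex_cvg0 _ _ _ P0 (fun n w => \1_(F n) (Y w))).
  - by move=> m; apply: measurableT_comp => //; exact: measurable_indic.
  - by move=> m w; have /andP[? ?] := indic01 R (F m) (Y w); rewrite ger0_norm.
  - move=> w; apply: cvg_near_cst; apply: filterS (F0 (Y w)) => m Fm.
    by rewrite indicE memNset.
by apply: filterS => n; rewrite sub0r normrN ger0_norm ?mass_ge0.
Qed.

(** The point itself is left out because it can be an atom. *)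
Lemma punctured_small (e x : R) : 0 < e -> exists dl : R,
  [/\ 0 < dl, mass `]x - dl, x[ <= e & mass `]x, x + dl[ <= e].
Proof.
move=> e0.
have H (F : nat -> set R) : (forall n, measurable (F n)) ->
    (forall n y, F n y -> 0 < `|y - x| < n.+1%:R^-1) ->
    \forall n \near \oo, mass (F n) <= e.
  move=> mF Fx; apply: mass_shrink => // y.
  have [xy|yx] := eqVneq y x.
    by apply: nearW => n /Fx; rewrite xy subrr normr0 ltxx.
  have d0' : 0 < `|y - x| by rewrite normr_gt0 subr_eq0.
  exists (Num.truncn `|y - x|^-1) => // n /= hn /Fx/andP[_].
  apply/negP; rewrite -leNgt invf_ple ?posrE ?ltr0n//.
  by rewrite (le_trans (ltW (truncnS_gt _)))// ler_nat ltnS.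
have h1 := H (fun n => `]x - n.+1%:R^-1, x[%classic).
have h2 := H (fun n => `]x, x + n.+1%:R^-1[%classic).
have [n [m1 m2]] : exists n : nat, mass `]x - n.+1%:R^-1, x[ <= e /\
    mass `]x, x + n.+1%:R^-1[ <= e.
  apply: (@filter_ex _ \oo); apply: filterS2 (h1 _ _) (h2 _ _) => //.
  - move=> n y; rewrite /= in_itv/= => /andP[a b].
    move: a b; move: n.+1%:R^-1 => z a b.
    by rewrite ltr0_norm ?subr_lt0//; apply/andP; split; lra.
  - move=> n y; rewrite /= in_itv/= => /andP[a b].
    move: a b; move: n.+1%:R^-1 => z a b.
    by rewrite gtr0_norm ?subr_gt0//; apply/andP; split; lra.
by exists n.+1%:R^-1; rewrite invr_gt0 ltr0n.
Qed.

(** Finitely many reference levels suffice: by compactness the line is covered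
    by points, punctured neighbourhoods of small mass and two small tails. *)
Lemma small_cover (e : R) : 0 < e ->
  exists (T : finType) (r : T -> R) (J : T -> set R),
    (forall i, measurable (J i) /\ mass (J i) <= e) /\
    forall t, exists i, forall y, Num.min t (r i) <= y < Num.max t (r i) -> J i y.
Proof.
move=> e0.
have [C [tl tr]] : exists C : nat, mass `]-oo, - C%:R[ <= e /\ mass `]C%:R, +oo[ <= e.
  apply: (@filter_ex _ \oo).
  apply: filterS2 (mass_shrink (F := fun n => `]-oo, - n%:R[%classic) e0 _ _)
    (mass_shrink (F := fun n => `]n%:R, +oo[%classic) e0 _ _) => //.
  - move=> x; exists (Num.truncn `|x|).+1 => // n /= hn; rewrite in_itv/=.
    apply/negP; rewrite -leNgt lerNl (le_trans (ler_norm _))// normrN.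
    by rewrite (le_trans (ltW (truncnS_gt _)))// ler_nat.
  - move=> x; exists (Num.truncn `|x|).+1 => // n /= hn; rewrite in_itv/= andbT.
    apply/negP; rewrite -leNgt (le_trans (ler_norm _))//.
    by rewrite (le_trans (ltW (truncnS_gt _)))// ler_nat.
have /choice[dl dlP] := fun x => punctured_small x e0.
have : compact `[- C%:R, C%:R : R] by exact: segment_compact.
rewrite compact_cover => /(_ R setT (fun x => ball x (dl x))).
case=> [x _|x _|D _ cov]; first exact: ball_open.
  by exists x => //; apply: ballxx; case: (dlP x).
exists ((D * option bool) + bool)%type.
exists (fun i => match i with
  | inl (x, None) => val x
  | inl (x, Some true) => val x + dl (val x) / 2
  | inl (x, Some false) => val x - dl (val x) / 2
  | inr true => C%:R + 1
  | inr false => - C%:R - 1 end).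
exists (fun i => match i with
  | inl (x, None) => set0
  | inl (x, Some true) => `]val x, val x + dl (val x)[%classic
  | inl (x, Some false) => `]val x - dl (val x), val x[%classic
  | inr true => `]C%:R, +oo[%classic
  | inr false => `]-oo, - C%:R[%classic end).
split.
  move=> [[x [[]|]]|[]]; split => //; try by case: (dlP (val x)).
  by rewrite /mass indic0 (_ : _ \o _ = fun=> 0)// Ex_cst ltW.
move=> t; have [tC|tC] := ltP C%:R t.
  exists (inr true) => y /andP[+ _]; rewrite /= in_itv/= andbT; apply: lt_le_trans.
  by rewrite lt_min tC ltrDl ltr01.
have [Ct|Ct] := ltP t (- C%:R).
  exists (inr false) => y /andP[_]; rewrite /= in_itv/= => /lt_trans; apply.
  by rewrite gt_max Ct gtrDl oppr_lt0 ltr01.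
have [|x xD] := cov t; first by rewrite /= in_itv/= Ct tC.
rewrite /ball/= ltr_norml => /andP[h1 h2].
have [dx _ _] := dlP x.
have [tx|tx|tx] := ltgtP t x.
- exists (inl ([` xD]%fset, Some false)) => y /=; rewrite in_itv/= => /andP[h3 h4].
  apply/andP; split.
    by apply: lt_le_trans h3; rewrite lt_min; apply/andP; split; lra.
  by apply: (lt_le_trans h4); rewrite ge_max; apply/andP; split; lra.
- exists (inl ([` xD]%fset, Some true)) => y /=; rewrite in_itv/= => /andP[h3 h4].
  apply/andP; split.
    by apply: lt_le_trans h3; rewrite lt_min; apply/andP; split; lra.
  by apply: (lt_le_trans h4); rewrite ge_max; apply/andP; split; lra.
- exists (inl ([` xD]%fset, None)) => y /=; rewrite tx minxx maxxx.
  by case: ltgtP.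
Qed.

End grid.

(** A Glivenko-Cantelli argument: functions of a level whose oscillation is
    controlled by empirical masses converge uniformly as soon as they converge
    at the reference levels of [small_cover]. *)
Lemma grid_uniform (R : realType) (T : finType) (r : T -> R) (J : T -> set R)
    (Gn : nat -> R -> R) (G : R -> R) (cn : nat -> T -> R) (e : R) : 0 < e ->
  (forall t, exists i, forall y, Num.min t (r i) <= y < Num.max t (r i) -> J i y) ->
  (forall n s t i, s <= t -> (forall y, s <= y < t -> J i y) ->
     `|Gn n s - Gn n t| <= cn n i) ->
  (forall s t i, s <= t -> (forall y, s <= y < t -> J i y) -> `|G s - G t| <= e) ->
  (forall i, \forall n \near \oo, cn n i <= 2 * e) ->
  (forall i, Gn n (r i) @[n --> \oo] --> G (r i)) ->
  \forall n \near \oo, forall t, `|Gn n t - G t| <= 4 * e.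
Proof.
move=> e0 cover lipn lip cne Gnr.
have H : \forall n \near \oo, forall i, cn n i <= 2 * e /\ `|G (r i) - Gn n (r i)| <= e.
  apply: filter_forall => i; apply: filterS2 (cne i) _.
    by move=> n; exact: conj.
  by move/cvgrPdist_le : (Gnr i); exact.
apply: filterS H => n Hn t; have [i ti] := cover t; have [h1 h2] := Hn i.
have sym (F : R -> R) (b : R) : (forall s u, s <= u ->
    (forall y, s <= y < u -> J i y) -> `|F s - F u| <= b) -> `|F t - F (r i)| <= b.
  move=> HF; case: (leP t (r i)) (ti) => tr ty.
    exact: HF.
  by rewrite distrC; apply: HF; first exact: ltW.
have h3 := sym (Gn n) _ (fun s u => lipn n s u i).
have h4 := sym G _ (fun s u => lip s u i).
have -> : Gn n t - G t = (Gn n t - Gn n (r i)) - (G (r i) - Gn n (r i)) - (G t - G (r i)).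
  by ring.
apply: (le_trans (ler_normB _ _)); rewrite (_ : 4 * e = 2 * e + e + e); last by ring.
rewrite lerD//; apply: (le_trans (ler_normB _ _)); rewrite lerD//.
exact: le_trans h3 h1.
Qed.

(** [Gn] is a statistic that decreases with the level and [cn] bounds its
    oscillation over a set of levels in terms of the sample points there. *)
Section levels.
Context (R : realType) d0 (Omega0 : measurableType d0) (P0 : probability Omega0 R)
  d (Omega : measurableType d) (P : probability Omega R)
  (Y : Omega0 -> R) (Ys : nat -> Omega -> R).
Hypotheses (mY : measurable_fun [set: Omega0] Y)
  (mYs : forall i, measurable_fun [set: Omega] (Ys i)).
Hypothesis iidY : iid_copies P0 P Y Ys.
Context (Gn : nat -> Omega -> R -> R) (G : R -> R)
  (cn : nat -> Omega -> set R -> R) (kappa : R).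
Hypotheses (kappa0 : 0 <= kappa)
  (Gn01 : forall n w t, 0 <= Gn n w t <= 1)
  (Gn_mono : forall n w s t, s <= t -> Gn n w t <= Gn n w s)
  (Gn_lip : forall n w s t J, s <= t -> (forall y, s <= y < t -> J y) ->
     `|Gn n w s - Gn n w t| <= cn n w J)
  (Gn_cvg : forall t, {ae P, forall w, Gn n w t @[n --> \oo] --> G t})
  (cn_cvg : forall J, measurable J ->
     {ae P, forall w, cn n w J @[n --> \oo] --> kappa * mass P0 Y J}).

Lemma level01 t : 0 <= G t <= 1.
Proof.
have [w h] := ae_ex (Gn_cvg t); apply/andP; split.
  rewrite -(cvg_lim _ h)//; apply: limr_ge; first by apply/cvg_ex; exists (G t).
  by apply: nearW => n; have /andP[] := Gn01 n w t.
rewrite -(cvg_lim _ h)//; apply: limr_le; first by apply/cvg_ex; exists (G t).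
by apply: nearW => n; have /andP[] := Gn01 n w t.
Qed.

Lemma level_mono s t : s <= t -> G t <= G s.
Proof.
move=> st; have /ae_ex[w [h1 h2]] : {ae P, forall w, Gn n w s @[n --> \oo] --> G s /\
    Gn n w t @[n --> \oo] --> G t}.
  by apply: filterS2 (Gn_cvg s) (Gn_cvg t) => w; exact: conj.
by apply: (ler_cvg_to h2 h1); apply: nearW => n; exact: Gn_mono.
Qed.

Lemma level_lip s t : s <= t -> `|G s - G t| <= kappa * mass P0 Y `[s, t[.
Proof.
move=> st; have mst : measurable (`[s, t[%classic : set R) by [].
have /ae_ex[w [h1 h2 h3]] : {ae P, forall w, [/\ Gn n w s @[n --> \oo] --> G s,
    Gn n w t @[n --> \oo] --> G t &
    cn n w `[s, t[%classic @[n --> \oo] --> kappa * mass P0 Y `[s, t[]}.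
  by apply: filterS3 (Gn_cvg s) (Gn_cvg t) (cn_cvg mst) => w.
have h : `|Gn n w s - Gn n w t| @[n --> \oo] --> `|G s - G t|.
  by apply: cvg_norm; exact: cvgB.
by apply: (ler_cvg_to h h3); apply: nearW => n; apply: Gn_lip => // y.
Qed.

Lemma measurable_level : measurable_fun [set: R] G.
Proof.
apply: nonincreasing_measurable => // s t st; exact: level_mono.
Qed.

Lemma level_uniform : {ae P, forall w, forall e : R, 0 < e ->
  \forall n \near \oo, forall t, `|Gn n w t - G t| <= e}.
Proof.
suff : {ae P, forall w, forall m : nat,
    \forall n \near \oo, forall t, `|Gn n w t - G t| <= 4 * m.+1%:R^-1}.
  apply: filterS => w h e e0; apply: filterS (h (Num.truncn (4 / e))) => n hn t.
  apply: (le_trans (hn t)).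
  rewrite ler_pdivrMr ?ltr0n// mulrC -ler_pdivrMr//; exact/ltW/truncnS_gt.
apply: ae_foralln => m; pose e : R := m.+1%:R^-1.
have e0 : 0 < e by rewrite invr_gt0 ltr0n.
pose e' := e / (kappa + 1).
have k1 : 0 < kappa + 1 by rewrite ltr_wpDl.
have e'0 : 0 < e' by rewrite divr_gt0.
have ke' : kappa * e' <= e.
  by rewrite /e' mulrCA ler_piMr ?(ltW e0)// ler_pdivrMr// mul1r lerDl.
have [T [r [J [JP cover]]]] := small_cover P0 mY e'0.
have kJ i : kappa * mass P0 Y (J i) <= e.
  by apply: le_trans ke'; rewrite ler_wpM2l//; case: (JP i).
have all_i : {ae P, forall w, forall i : T,
    Gn n w (r i) @[n --> \oo] --> G (r i) /\
    cn n w (J i) @[n --> \oo] --> kappa * mass P0 Y (J i)}.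
  apply: filter_forall => i.
  by apply: filterS2 (Gn_cvg (r i)) (cn_cvg (JP i).1) => w; exact: conj.
apply: filterS all_i => w Hw.
apply: (@grid_uniform _ T r J _ _ (fun n i => cn n w (J i)) _ e0 cover).
- by move=> n s t i; exact: Gn_lip.
- move=> s t i st sJ; apply: (le_trans (level_lip st)); apply: le_trans (kJ i).
  by rewrite ler_wpM2l//; apply: le_mass => //; case: (JP i).
- move=> i; move/cvgrPdist_le : (Hw i).2 => /(_ _ e0); apply: filterS => n.
  move=> h; have := kJ i; move: h; rewrite ler_norml.
  by move: (_ * _) (cn _ _ _) => a b /andP[? ?] ?; lra.
- by move=> i; case: (Hw i).
Qed.

(** The levels are themselves sample values, hence the need for uniformity. *)
Lemma level_avg_cvg : {ae P, forall w,
  n%:R^-1 * (\sum_(j < n) Gn n w (Ys j w)) @[n --> \oo] --> Ex P0 (G \o Y)}.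
Proof.
have := slln mY mYs iidY measurable_level level01.
apply: filterS2 level_uniform => w U L.
have D : n%:R^-1 * (\sum_(j < n) Gn n w (Ys j w)) - n%:R^-1 * (\sum_(j < n) G (Ys j w))
    @[n --> \oo] --> (0 : R).
  apply: cvg0_near_le => e e0; apply: filterS2 (nbhs_infty_gt 0) (U e e0) => n n0 h.
  rewrite -mulrBr -sumrB normrM ger0_norm ?invr_ge0//.
  rewrite ler_pdivrMl ?ltr0n// (le_trans (ler_norm_sum _ _ _))//.
  rewrite mulr_natl -[in leRHS](card_ord n) -sumr_const.
  by apply: ler_sum => i _; exact: h.
rewrite -[X in _ --> X](add0r).
apply: cvg_trans (cvgD D L); apply: near_eq_cvg; apply: nearW => n /=.
by rewrite !fctE subrK.
Qed.

End levels.

Section empirical_levels.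
Context (R : realType) d0 (Omega0 : measurableType d0) (P0 : probability Omega0 R)
  d (Omega : measurableType d) (P : probability Omega R)
  (Y : Omega0 -> R) (Ys : nat -> Omega -> R).
Hypotheses (mY : measurable_fun [set: Omega0] Y)
  (mYs : forall i, measurable_fun [set: Omega] (Ys i)).
Hypothesis iidY : iid_copies P0 P Y Ys.

Definition surv (t : R) : R := mass P0 Y `[t, +oo[.

Definition emp_surv n w (t : R) : R := n%:R^-1 * \sum_(i < n) (t <= Ys i w)%R%:R.

Let ge_indic (t y : R) : (t <= y)%R%:R = \1_(`[t, +oo[%classic) y :> R.
Proof.
rewrite indicE; congr (nat_of_bool _)%:R.
by apply/idP/idP => [h|/set_mem]; [rewrite mem_set//= in_itv/= h|rewrite /= in_itv/= andbT].
Qed.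

Lemma avg01 n (f : 'I_n -> R) : (forall i, 0 <= f i <= 1) ->
  0 <= n%:R^-1 * \sum_i f i <= 1.
Proof.
move=> f01; rewrite mulr_ge0 ?invr_ge0//=; last first.
  by apply: sumr_ge0 => i _; have /andP[] := f01 i.
case: n f f01 => [|n] f f01; first by rewrite invr0 mul0r ler01.
rewrite ler_pdivrMl ?ltr0n// mulr1 [leRHS](_ : _ = \sum_(i < n.+1) 1).
  by apply: ler_sum => i _; have /andP[] := f01 i.
by rewrite sumr_const card_ord.
Qed.

Lemma avg_le n (f g : 'I_n -> R) : (forall i, f i <= g i) ->
  n%:R^-1 * \sum_i f i <= n%:R^-1 * \sum_i g i.
Proof. by move=> fg; rewrite ler_wpM2l ?invr_ge0// ler_sum. Qed.

Lemma avg_norm_le n (f g h : 'I_n -> R) : (forall i, `|f i - g i| <= h i) ->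
  `|n%:R^-1 * \sum_i f i - n%:R^-1 * \sum_i g i| <= n%:R^-1 * \sum_i h i.
Proof.
move=> fgh; rewrite -mulrBr -sumrB normrM ger0_norm ?invr_ge0// ler_wpM2l ?invr_ge0//.
by rewrite (le_trans (ler_norm_sum _ _ _))// ler_sum.
Qed.

Lemma ge_bool01 (t y : R) : 0 <= ((t <= y)%R%:R : R) <= 1.
Proof. by case: (t <= y); rewrite lexx ler01. Qed.

Lemma ge_bool_mono (s t y : R) : s <= t -> ((t <= y)%R%:R : R) <= (s <= y)%R%:R.
Proof.
move=> st; case: (leP t y) => ty; last by rewrite ler0n.
by rewrite (le_trans st ty).
Qed.

Lemma ge_bool_lip (s t y : R) (J : set R) : s <= t -> (forall y, s <= y < t -> J y) ->
  `|(s <= y)%R%:R - (t <= y)%R%:R| <= (\1_J y : R).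
Proof.
move=> st sJ; case: (leP s y) => sy; case: (leP t y) => ty.
- by rewrite subrr normr0; have /andP[] := indic01 R J y.
- by rewrite subr0 normr1 indicE mem_set//; apply: sJ; rewrite sy ty.
- by have := le_trans st ty; rewrite leNgt sy.
- by rewrite subrr normr0; have /andP[] := indic01 R J y.
Qed.

Let mray (t : R) : measurable (`[t, +oo[%classic : set R). Proof. by []. Qed.

Lemma emp_surv_cvg t : {ae P, forall w, emp_surv n w t @[n --> \oo] --> surv t}.
Proof.
have := slln_indic mY mYs iidY (mray t); apply: filterS => w.
apply: cvg_trans; apply: near_eq_cvg; apply: nearW => n.
by rewrite /emp_surv; congr (_ * _); apply: eq_bigr => i _; rewrite ge_indic.
Qed.

Lemma emp_surv01 n w t : 0 <= emp_surv n w t <= 1.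
Proof. by apply: avg01 => i; exact: ge_bool01. Qed.

Lemma emp_surv_mono n w s t : s <= t -> emp_surv n w t <= emp_surv n w s.
Proof. by move=> st; apply: avg_le => i; exact: ge_bool_mono. Qed.

Lemma emp_surv_lip n w s t J : s <= t -> (forall y, s <= y < t -> J y) ->
  `|emp_surv n w s - emp_surv n w t| <= n%:R^-1 * \sum_(i < n) \1_J (Ys i w).
Proof. by move=> st sJ; apply: avg_norm_le => i; exact: ge_bool_lip. Qed.

Lemma emp_surv_avg_cvg : {ae P, forall w,
  n%:R^-1 * (\sum_(j < n) emp_surv n w (Ys j w)) @[n --> \oo] --> Ex P0 (surv \o Y)}.
Proof.
apply: (@level_avg_cvg _ _ _ P0 _ _ P Y Ys mY mYs iidY emp_surv surv
  (fun n w J => n%:R^-1 * \sum_(i < n) \1_J (Ys i w)) 1) => //.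
- exact: emp_surv01.
- exact: emp_surv_mono.
- exact: emp_surv_lip.
- exact: emp_surv_cvg.
- by move=> J mJ; rewrite mul1r; exact: slln_indic.
Qed.

Lemma emp_surv_sqr_avg_cvg : {ae P, forall w,
  n%:R^-1 * (\sum_(j < n) emp_surv n w (Ys j w) ^+ 2) @[n --> \oo] -->
    Ex P0 ((fun t => surv t ^+ 2) \o Y)}.
Proof.
apply: (@level_avg_cvg _ _ _ P0 _ _ P Y Ys mY mYs iidY
  (fun n w t => emp_surv n w t ^+ 2) (fun t => surv t ^+ 2)
  (fun n w J => 2 * (n%:R^-1 * \sum_(i < n) \1_J (Ys i w))) 2) => //.
- by move=> n w t; have /andP[? ?] := emp_surv01 n w t; rewrite sqr_ge0 expr_le1.
- move=> n w s t st; have /andP[? ?] := emp_surv01 n w t.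
  by rewrite lerXn2r ?nnegrE ?emp_surv_mono//; have /andP[] := emp_surv01 n w s.
- move=> n w s t J st sJ; rewrite subr_sqr normrM mulrC ler_pM//.
    have /andP[? ?] := emp_surv01 n w t; have /andP[? ?] := emp_surv01 n w s.
    by rewrite ger0_norm ?addr_ge0//; lra.
  exact: emp_surv_lip.
- move=> t; apply: filterS (emp_surv_cvg t) => w h; rewrite expr2.
  by under eq_fun do rewrite expr2; exact: cvgM.
- move=> J mJ; apply: filterS (slln_indic mY mYs iidY mJ) => w h.
  by apply: cvgM => //; exact: cvg_cst.
Qed.

Context (k : nat) (V : Omega0 -> k.-tuple R) (Vs : nat -> Omega -> k.-tuple R)
  (M : forall n, 'I_n -> Omega -> 'I_n).
Arguments M : clear implicits.
Hypotheses (mV : measurable_fun [set: Omega0] V)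
  (mVs : forall i, measurable_fun [set: Omega] (Vs i)).
Hypothesis iid : iid_copies P0 P (fun w => (Y w, V w)) (fun i w => (Ys i w, Vs i w)).
Hypothesis nnM : forall n, (2 <= n)%N ->
  uniform_nearest P (fun w => [tuple (Ys j w, Vs j w) | j < n])
    (fun j w => Vs j w) (M n).
Hypothesis cond_prob : forall B, measurable B -> exists g, has_cond_prob P0 Y V B g.
Variable g : R -> k.-tuple R -> R.
Hypothesis gP : forall t, has_cond_prob P0 Y V `[t, +oo[ (g t).

Definition cond_sqr t : R := Ex P0 (fun w => g t (V w) ^+ 2).

(** The frequency of the points that lie above level [t] together with their
    chosen neighbour; summed over the sample levels it gives the minima of ranks
    of the estimator. *)
Definition emp_pair n w (t : R) : R :=
  n%:R^-1 * \sum_(i < n) (t <= Ys i w)%R%:R * (t <= Ys (M n i w) w)%R%:R.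

Let emp_pair_cvg t : {ae P, forall w, emp_pair n w t @[n --> \oo] --> cond_sqr t}.
Proof.
have := nn_pair_cvg mY mV mYs mVs iid nnM (mray t) (gP t).
apply: filterS => w; apply: cvg_trans; apply: near_eq_cvg; apply: nearW => n.
by rewrite /emp_pair; congr (_ * _); apply: eq_bigr => i _; rewrite !ge_indic.
Qed.

Let emp_pair01 n w t : 0 <= emp_pair n w t <= 1.
Proof.
apply: avg01 => i; have /andP[? ?] := ge_bool01 t (Ys i w).
by have /andP[? ?] := ge_bool01 t (Ys (M n i w) w); rewrite mulr_ge0//= mulr_ile1.
Qed.

Let emp_pair_mono n w s t : s <= t -> emp_pair n w t <= emp_pair n w s.
Proof.
by move=> st; apply: avg_le => i; rewrite ler_pM// ge_bool_mono.
Qed.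

Let emp_pair_lip n w s t J : s <= t -> (forall y, s <= y < t -> J y) ->
  `|emp_pair n w s - emp_pair n w t| <=
  n%:R^-1 * \sum_(i < n) (\1_J (Ys i w) + \1_J (Ys (M n i w) w)).
Proof.
move=> st sJ; apply: avg_norm_le => i.
have h1 := @ge_bool_lip s t (Ys i w) J st sJ.
have h2 := @ge_bool_lip s t (Ys (M n i w) w) J st sJ.
have /andP[a0 a1] := ge_bool01 s (Ys (M n i w) w).
have /andP[b0 b1] := ge_bool01 t (Ys i w).
move: h1 h2 a0 a1 b0 b1.
move: ((s <= Ys i w)%R%:R) ((t <= Ys i w)%R%:R) => a b.
move: ((s <= Ys _ w)%R%:R) ((t <= Ys _ w)%R%:R) => a' b' h1 h2 a0 a1 b0 b1.
have -> : a * a' - b * b' = (a - b) * a' + b * (a' - b') by ring.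
rewrite (le_trans (ler_normD _ _))// lerD// normrM.
  by apply: le_trans h1; rewrite ler_piMr// ger0_norm.
by apply: le_trans h2; rewrite ler_piMl// ger0_norm.
Qed.

Lemma emp_pair_avg_cvg : {ae P, forall w,
  n%:R^-1 * (\sum_(j < n) emp_pair n w (Ys j w)) @[n --> \oo] --> Ex P0 (cond_sqr \o Y)}.
Proof.
apply: (@level_avg_cvg _ _ _ P0 _ _ P Y Ys mY mYs iidY emp_pair cond_sqr
  (fun n w J => n%:R^-1 * \sum_(i < n) (\1_J (Ys i w) + \1_J (Ys (M n i w) w))) 2) => //.
by move=> J mJ; exact: (nn_count_cvg mY mV mYs mVs iid nnM cond_prob mJ).
Qed.

Lemma measurable_cond_sqr : measurable_fun [set: R] cond_sqr.
Proof. exact: (measurable_level emp_pair_mono emp_pair_cvg). Qed.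

End empirical_levels.

(** * Versions of conditional expectations *)

Section ae_order.
Context (R : realType) d (T : measurableType d) (mu : {measure set T -> \bar R}).

Lemma ae_le (f g : T -> R) :
  mu.-integrable [set: T] (EFin \o f) -> mu.-integrable [set: T] (EFin \o g) ->
  (\int[mu]_(x in [set x | (g x < f x)%R]) (f x)%:E <=
   \int[mu]_(x in [set x | (g x < f x)%R]) (g x)%:E)%E ->
  {ae mu, forall x, f x <= g x}.
Proof.
move=> intf intg; set C := [set x | _] => h.
have mf : measurable_fun setT f by apply/measurable_EFinP; exact: measurable_int intf.
have mg : measurable_fun setT g by apply/measurable_EFinP; exact: measurable_int intg.
have mC : measurable C by apply: measurable_asbool; exact: measurable_fun_ltr.
have fC : mu.-integrable C (EFin \o f) by exact: integrableS intf.
have gC : mu.-integrable C (EFin \o g) by exact: integrableS intg.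
have mEf : measurable_fun C (fun x => (f x - g x)%:E).
  by apply: measurable_funTS; apply/measurable_EFinP; exact: measurable_funB.
have : (\int[mu]_(x in C) `|(f x - g x)%:E| = 0)%E.
  rewrite (eq_integral (fun x => (f x)%:E - (g x)%:E)%E) => [|x /set_mem Cx].
    have h0 : (0 <= \int[mu]_(x in C) ((f x)%:E - (g x)%:E))%E.
      by apply: integral_ge0 => x Cx; rewrite -EFinB lee_fin subr_ge0 ltW.
    apply/eqP; rewrite eq_le h0 andbT integralB// sube_le0//.
  by rewrite /= ger0_norm// subr_ge0 ltW.
move/(ae_eq_integral_abs _ mC mEf).1; apply: filterS => x fx.
rewrite leNgt; apply/negP => Cx; have [/eqP] := fx Cx.
by rewrite subr_eq0 => /eqP fgx; rewrite /C/= fgx ltxx in Cx.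
Qed.

End ae_order.

Section conditional_probability.
Context (R : realType) d (Omega : measurableType d) (P : probability Omega R)
  dS (S : measurableType dS).

(** The Radon-Nikodym derivative, with respect to the law of [X], of the image
    under [X] of the measure with density [W]; it takes values in the unit
    interval almost everywhere, hence everywhere after truncation. *)
Lemma exists_factor (X : {mfun Omega >-> S}) (W : Omega -> R) :
  measurable_fun [set: Omega] W -> (forall w, 0 <= W w <= 1) ->
  exists g : S -> R, [/\ measurable_fun [set: S] g, (forall s, 0 <= g s <= 1) &
    forall C, measurable C ->
      Ex P (fun w => W w * \1_C (X w)) = Ex P (fun w => g (X w) * \1_C (X w))].
Proof.
move=> mW W01.
have bW : bmeas W by exact: bmeas01.
have iW := bmeas_integrable P bW.
have mX : measurable_fun [set: Omega] X by [].
have mXC C : measurable C -> measurable (X @^-1` C) by exact: measurable_preimage.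
pose nu : {charge set S -> \bar R} :=
  @measure_function_pushforward__canonical__charge_Charge
    _ _ _ _ X _ (induced_charge iW) mX.
pose mu : probability S R := distribution P X.
have numu : nu `<< mu.
  apply: (dominates_pushforward mX).
  apply/null_content_dominatesP => A mA PA0.
  by apply: null_set_integral => //; apply: measurable_funTS; exact: measurable_int iW.
have ig := Radon_Nikodym_integrable numu.
pose g0 s := fine (Radon_Nikodym nu mu s).
have g0E s : (g0 s)%:E = Radon_Nikodym nu mu s.
  by rewrite fineK//; exact: Radon_Nikodym_fin_num.
have ig0 : mu.-integrable setT (EFin \o g0).
  by rewrite (_ : _ \o _ = Radon_Nikodym nu mu)//; apply/funext => s /=.
have mg0 : measurable_fun setT g0.
  by apply/measurable_EFinP; exact: measurable_int ig0.
have nuE C : measurable C ->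
    (\int[P]_(w in X @^-1` C) (W w)%:E = \int[mu]_(s in C) (g0 s)%:E)%E.
  move=> mC; transitivity (nu C) => //.
  rewrite (Radon_Nikodym_integral numu mC).
  by apply: eq_integral => s _; rewrite g0E.
have le1 : {ae mu, forall s, g0 s <= 1}.
  apply: ae_le => //; first exact: finite_measure_integrable_cst.
  set C := [set x | _].
  have mC : measurable C by apply: measurable_asbool; exact: measurable_fun_ltr.
  rewrite -nuE// integral_cst// mul1e /mu /distribution /pushforward.
  apply: (@le_trans _ _ (\int[P]_(w in X @^-1` C) 1%:E)%E); last first.
    by rewrite integral_cst ?mul1e//; exact: mXC.
  apply: ge0_le_integral => //; first exact: mXC.
  - by move=> w _; rewrite lee_fin; have /andP[] := W01 w.
  - by apply: measurable_funTS; exact/measurable_EFinP.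
  - by move=> w _; rewrite lee_fin; have /andP[] := W01 w.
have ge0 : {ae mu, forall s, 0 <= g0 s}.
  apply: ae_le => //; first exact: finite_measure_integrable_cst.
  set C := [set x | _].
  have mC : measurable C by apply: measurable_asbool; exact: measurable_fun_ltr.
  rewrite -nuE// integral_cst// mul0e; apply: integral_ge0 => w _.
  by rewrite lee_fin; have /andP[] := W01 w.
pose g s := Num.max 0 (Num.min 1 (g0 s)).
have mg : measurable_fun setT g by apply: measurable_maxr => //; exact: measurable_minr.
have g01 s : 0 <= g s <= 1.
  by rewrite /g le_max lexx/= ge_max ler01 ge_min lexx.
exists g; split => // C mC.
have bC : bmeas (fun w => W w * \1_C (X w)).
  by apply: bmeasM => //; apply: bmeas_comp => //; exact: bmeas_indic.
have bgC : bmeas (fun w => g (X w) * \1_C (X w)).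
  apply: bmeasM; first by apply: bmeas_comp => //; exact: bmeas01.
  by apply: bmeas_comp => //; exact: bmeas_indic.
apply: EFin_inj; rewrite !EFin_Ex//.
have := nuE _ mC; rewrite integral_restr => ->.
transitivity (\int[mu]_(s in C) (g s)%:E)%E.
  apply: ae_eq_integral => //.
  - by apply: measurable_funTS; exact/measurable_EFinP.
  - by apply: measurable_funTS; exact/measurable_EFinP.
  apply: filterS2 le1 ge0 => s h1 h2 _; congr EFin; rewrite /g.
  by rewrite min_r ?max_r.
rewrite ge0_integral_pushforward//.
- by rewrite (integral_restr P (fun w => g (X w)) (X @^-1` C)).
- by apply: measurable_funTS; exact/measurable_EFinP.
- by move=> s _; rewrite lee_fin; have /andP[] := g01 s.
Qed.

Lemma cond_exp_integral (X : {mfun Omega >-> S}) (W : Omega -> R) :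
  P.-integrable [set: Omega] (EFin \o W) ->
  (\int[P]_w (cond_exp P X W w)%:E = \int[P]_w (W w)%:E)%E.
Proof.
move=> iW; have [_ _ h] := cond_expP X iW; apply: h.
by exists setT => //; rewrite setTI.
Qed.

Lemma measurable_cond_exp (X : {mfun Omega >-> S}) (W : Omega -> R) :
  P.-integrable [set: Omega] (EFin \o W) ->
  measurable_fun [set: Omega] (cond_exp P X W).
Proof.
move=> iW; have [_ i _] := cond_expP X iW.
by apply/measurable_EFinP; exact: measurable_int i.
Qed.

(** [cond_exp] is an arbitrary version; two versions agree almost surely, since
    the sets where one exceeds the other are events of [X]. *)
Lemma cond_exp_ae (X : {mfun Omega >-> S}) (W : Omega -> R) (g : S -> R) :
  P.-integrable [set: Omega] (EFin \o W) ->
  measurable_fun [set: S] g -> (forall s, 0 <= g s <= 1) ->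
  (forall C, measurable C -> (\int[P]_(w in X @^-1` C) (W w)%:E =
     \int[P]_(w in X @^-1` C) (g (X w))%:E)%E) ->
  {ae P, forall w, cond_exp P X W w = g (X w)}.
Proof.
move=> iW mg g01 WE; have [mV iV VE] := cond_expP X iW.
set V := cond_exp P X W in mV iV VE *.
pose U w := g (X w).
have mX : measurable_fun setT X by [].
have bU : bmeas U by apply: bmeas_comp => //; exact: bmeas01.
have iU := bmeas_integrable P bU.
(* [U] is measurable for the sigma-algebra of [X] as well *)
have mUX : measurable_fun [set: g_sigma_algebra_preimageType X]
    (U : g_sigma_algebra_preimageType X -> R).
  move=> _ B mB; rewrite setTI; exists (g @^-1` B); last by rewrite setTI.
  exact: measurable_preimage.
have key (f1 f2 : Omega -> R) :
    measurable_fun [set: g_sigma_algebra_preimageType X]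
      (f1 : g_sigma_algebra_preimageType X -> R) ->
    measurable_fun [set: g_sigma_algebra_preimageType X]
      (f2 : g_sigma_algebra_preimageType X -> R) ->
    P.-integrable setT (EFin \o f1) -> P.-integrable setT (EFin \o f2) ->
    (forall C, measurable C -> (\int[P]_(w in X @^-1` C) (f1 w)%:E =
      \int[P]_(w in X @^-1` C) (f2 w)%:E)%E) ->
    {ae P, forall w, f1 w <= f2 w}.
  move=> m1 m2 i1 i2 E12; apply: ae_le => //.
  have : measurable ([set w | f2 w < f1 w] : set (g_sigma_algebra_preimageType X)).
    by apply: measurable_asbool; exact: measurable_fun_ltr.
  by move=> [C mC]; rewrite setTI => <-; rewrite E12.
have VU C : measurable C -> (\int[P]_(w in X @^-1` C) (V w)%:E =
    \int[P]_(w in X @^-1` C) (U w)%:E)%E.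
  move=> mC; rewrite VE; first exact: WE.
  by exists C => //; rewrite setTI.
have h1 := key V U mV mUX iV iU VU.
have h2 := key U V mUX mV iU iV (fun C mC => esym (VU C mC)).
by apply: filterS2 h1 h2 => w u v; apply: le_anti; rewrite u v.
Qed.

End conditional_probability.

Section almost_everywhere_equal.
Context (R : realType) d (T : measurableType d) (P : probability T R).

Lemma ae_integrable (A a : T -> R) : measurable_fun [set: T] A -> bmeas a ->
  {ae P, forall w, A w = a w} -> P.-integrable [set: T] (EFin \o A).
Proof.
move=> mA ba Aa; have /integrableP[_ ia] := bmeas_integrable P ba.
apply/integrableP; split; first exact/measurable_EFinP.
rewrite (ae_eq_integral (fun w => `|(EFin \o a) w|%E)) //.
- by apply: measurableT_comp => //; exact/measurable_EFinP.
- by apply: measurableT_comp => //; apply/measurable_EFinP; case: ba.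
- by apply: filterS Aa => w /= -> _.
Qed.

Lemma ae_integral (A a : T -> R) (C : set T) : measurable_fun [set: T] A -> bmeas a ->
  measurable C -> {ae P, forall w, A w = a w} ->
  (\int[P]_(w in C) (A w)%:E)%E = (Ex P (fun w => a w * \1_C w))%:E.
Proof.
move=> mA ba mC Aa; rewrite EFin_Ex; last by apply: bmeasM => //; exact: bmeas_indic.
rewrite -integral_restr; apply: ae_eq_integral => //.
- by apply: measurable_funTS; exact/measurable_EFinP.
- by apply: measurable_funTS; apply/measurable_EFinP; case: ba.
- by apply: filterS Aa => w /= -> _.
Qed.

End almost_everywhere_equal.

(** Pythagoras' identity: [b \o X] is the orthogonal projection of [a]. *)
Lemma Ex_sqr_defect (R : realType) d (Omega : measurableType d)
  (P : probability Omega R) dS (S : measurableType dS) (X : Omega -> S)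
  (a : Omega -> R) (b : S -> R) :
  measurable_fun [set: Omega] X -> bmeas a -> (forall w, 0 <= a w) ->
  measurable_fun [set: S] b -> (forall s, 0 <= b s <= 1) ->
  (forall C, measurable C ->
    Ex P (fun w => a w * \1_C (X w)) = Ex P (fun w => b (X w) * \1_C (X w))) ->
  Ex P (fun w => (a w - b (X w)) ^+ 2) =
  Ex P (fun w => a w ^+ 2) - Ex P (fun w => b (X w) ^+ 2).
Proof.
move=> mX ba a0 mb b01 aE.
have bb : bmeas (b \o X) by apply: bmeas_comp => //; exact: bmeas01.
have mixed : Ex P (fun w => a w * b (X w)) = Ex P (fun w => b (X w) ^+ 2).
  have b0 w : 0 <= b (X w) by have /andP[] := b01 (X w).
  rewrite (eq_weighted_Ex mX mX ba bb a0 b0 mb b01 aE).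
  by congr Ex; apply/funext => w; rewrite expr2.
have b1 := bmeasX 2 ba; have b2 := bmeasX 2 bb; have b3 := bmeasM ba bb.
have -> : (fun w => (a w - b (X w)) ^+ 2) =
    (fun w => a w ^+ 2 - 2 * (a w * b (X w)) + b (X w) ^+ 2).
  by apply/funext => w; ring.
rewrite (ExD P (bmeasB b1 (bmeasZ 2 b3)) b2) (ExB P b1 (bmeasZ 2 b3)) (ExZ P 2 b3).
by rewrite mixed; ring.
Qed.

Section conditional_variance.
Context (R : realType) d (Omega : measurableType d) (P : probability Omega R)
  dS (S : measurableType dS) (X : {mfun Omega >-> S}).

Lemma cond_exp_ae_Ex (A a : Omega -> R) (b : S -> R) :
  measurable_fun [set: Omega] A -> bmeas a -> {ae P, forall w, A w = a w} ->
  measurable_fun [set: S] b -> (forall s, 0 <= b s <= 1) ->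
  (forall C, measurable C ->
    Ex P (fun w => a w * \1_C (X w)) = Ex P (fun w => b (X w) * \1_C (X w))) ->
  {ae P, forall w, cond_exp P X A w = b (X w)}.
Proof.
move=> mA ba Aa mb b01 aE.
have bb : bmeas (b \o X) by apply: bmeas_comp => //; exact: bmeas01.
apply: cond_exp_ae => //; first exact: ae_integrable Aa.
move=> C mC; have mXC : measurable (X @^-1` C) by exact: measurable_preimage.
rewrite (ae_integral mA ba mXC Aa).
have mbX : measurable_fun setT (b \o X) by case: bb.
rewrite (ae_integral mbX bb mXC); first by congr EFin; exact: aE.
exact: aeW.
Qed.

(** The mean of a conditional expectation is the mean; what remains is the
    squared distance of [A] to its conditional expectation. *)
Lemma cond_var_integral (A a : Omega -> R) (b : S -> R) :
  measurable_fun [set: Omega] A -> bmeas a -> (forall w, 0 <= a w) ->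
  {ae P, forall w, A w = a w} ->
  measurable_fun [set: S] b -> (forall s, 0 <= b s <= 1) ->
  (forall C, measurable C ->
    Ex P (fun w => a w * \1_C (X w)) = Ex P (fun w => b (X w) * \1_C (X w))) ->
  ('E_P[cond_var P X A] =
   (Ex P (fun w => a w ^+ 2) - Ex P (fun w => b (X w) ^+ 2))%:E)%E.
Proof.
move=> mA ba a0 Aa mb b01 aE.
have bb : bmeas (b \o X) by apply: bmeas_comp => //; exact: bmeas01.
have Bb := cond_exp_ae_Ex mA ba Aa mb b01 aE.
have mB := measurable_cond_exp X (ae_integrable mA ba Aa).
pose D w := (A w - cond_exp P X A w) ^+ 2.
have bd : bmeas (fun w => (a w - b (X w)) ^+ 2).
  by apply: bmeasX; exact: bmeasB ba bb.
have mD : measurable_fun setT D by apply: measurable_funX; exact: measurable_funB.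
have Dd : {ae P, forall w, D w = (a w - b (X w)) ^+ 2}.
  by apply: filterS2 Aa Bb => w; rewrite /D => -> ->.
rewrite unlock cond_exp_integral; last exact: ae_integrable Dd.
rewrite (ae_integral mD bd measurableT Dd); congr EFin.
under eq_fun do rewrite indicT mulr1.
exact: Ex_sqr_defect.
Qed.

End conditional_variance.

(** * The dependence measure in terms of versions *)

Section concatenation.
Context (R : realType) (p q : nat).

Definition cat_tuple_pair (u : p.-tuple R * q.-tuple R) : (p + q).-tuple R :=
  [tuple of u.1 ++ u.2].

Definition split_tuple (v : (p + q).-tuple R) : p.-tuple R * q.-tuple R :=
  ([tuple tnth v (lshift q i) | i < p], [tuple tnth v (rshift p i) | i < q]).

Lemma cat_tuple_pairK : cancel cat_tuple_pair split_tuple.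
Proof.
case=> x z; rewrite /split_tuple /cat_tuple_pair/=.
by congr pair; apply: eq_from_tnth => i; rewrite tnth_mktuple ?tnth_lshift ?tnth_rshift.
Qed.

Lemma measurable_cat_tuple_pair : measurable_fun [set: _] cat_tuple_pair.
Proof.
apply/measurable_fun_tnthP => i.
have [j|j] := fintype.splitP i => ij.
- rewrite (_ : _ \o _ = (fun x => tnth x j) \o fst).
    by apply: measurableT_comp => //; exact: measurable_tnth.
  apply/funext => -[x z] /=; rewrite (_ : i = lshift q j); last exact: val_inj.
  by rewrite [LHS]tnth_lshift.
- rewrite (_ : _ \o _ = (fun x => tnth x j) \o snd).
    by apply: measurableT_comp => //; exact: measurable_tnth.
  apply/funext => -[x z] /=; rewrite (_ : i = rshift p j); last exact: val_inj.
  by rewrite [LHS]tnth_rshift.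
Qed.

Lemma measurable_split_tuple : measurable_fun [set: _] split_tuple.
Proof.
apply/measurable_fun_pairP; split; apply/measurable_fun_tnthP => i.
- rewrite (_ : _ \o _ = (fun v : (p + q).-tuple R => tnth v (lshift q i))).
    exact: measurable_tnth.
  by apply/funext => v /=; rewrite tnth_mktuple.
- rewrite (_ : _ \o _ = (fun v : (p + q).-tuple R => tnth v (rshift p i))).
    exact: measurable_tnth.
  by apply/funext => v /=; rewrite tnth_mktuple.
Qed.

End concatenation.

Section identification.
Context (R : realType) (p q : nat) d0 (Omega0 : measurableType d0)
  (P0 : probability Omega0 R)
  (Y : {RV P0 >-> R}) (X : {RV P0 >-> p.-tuple R}) (Z : {RV P0 >-> q.-tuple R}).

Let V w := [tuple of X w ++ Z w].
Let XZ w := (X w, Z w).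

Variables (g : R -> (p + q).-tuple R -> R) (b : R -> p.-tuple R -> R).
Hypotheses (gP : forall t, has_cond_prob P0 Y V `[t, +oo[ (g t))
  (bP : forall t, has_cond_prob P0 Y X `[t, +oo[ (b t)).

Let mY : measurable_fun [set: Omega0] Y. Proof. by []. Qed.
Let mX : measurable_fun [set: Omega0] X. Proof. by []. Qed.
Let mZ : measurable_fun [set: Omega0] Z. Proof. by []. Qed.

Let mXZ : measurable_fun [set: Omega0] XZ.
Proof. exact: measurable_fun_pair. Qed.

Lemma measurable_catXZ : measurable_fun [set: Omega0] V.
Proof.
rewrite (_ : V = @cat_tuple_pair R p q \o XZ)//.
by apply: measurableT_comp => //; exact: measurable_cat_tuple_pair.
Qed.

Let ray_indic t : \1_[set w | t <= Y w] = (fun w => \1_(`[t, +oo[%classic) (Y w)) :> (_ -> R).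
Proof.
apply/funext => w; rewrite !indicE; congr (nat_of_bool _)%:R.
by apply/idP/idP => /set_mem/= h; rewrite mem_set//=; move: h; rewrite in_itv/= andbT.
Qed.

Let b1 t : bmeas (fun w => \1_(`[t, +oo[%classic) (Y w) : R).
Proof. exact: (bmeas_comp mY (bmeas_indic R _)). Qed.

Lemma cond_var_indic t :
  ('E_P0[cond_var P0 X \1_[set w | (t <= Y w)%R]] =
   (surv P0 Y t - cond_sqr P0 X b t)%:E)%E.
Proof.
have [mb b01 bE] := bP t.
rewrite ray_indic (cond_var_integral _ (b1 t) _ _ mb b01 bE).
- congr (_ - _)%:E; rewrite /surv /mass; congr Ex; apply/funext => w /=.
  by rewrite indicE; case: (_ \in _); rewrite ?expr1n ?expr0n.
- by case: (b1 t).
- by move=> w; have /andP[] := indic01 R `[t, +oo[ (Y w).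
- exact: aeW.
Qed.

(** Conditioning on the pair [(X, Z)] is conditioning on the concatenated
    vector; the conditional probability given both has the same conditional
    expectation given [X] as the indicator itself. *)
Lemma cond_var_cond_prob t :
  ('E_P0[cond_var P0 X (cond_prob_ge P0 Y XZ t)] =
   (cond_sqr P0 V g t - cond_sqr P0 X b t)%:E)%E.
Proof.
have [mb b01 bE] := bP t; have [mg g01 gE] := gP t.
pose U : {mfun Omega0 >-> (p.-tuple R * q.-tuple R)%type} :=
  HB.pack XZ (isMeasurableFun.Build _ _ _ _ XZ mXZ).
pose h (u : p.-tuple R * q.-tuple R) := g t (cat_tuple_pair u).
have mh : measurable_fun setT h.
  by apply: measurableT_comp => //; exact: measurable_cat_tuple_pair.
have hE C : measurable C ->
    Ex P0 (fun w => \1_(`[t, +oo[%classic) (Y w) * \1_C (U w)) =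
    Ex P0 (fun w => h (U w) * \1_C (U w)).
  move=> mC; have := gE _ (measurable_preimage (@measurable_split_tuple R p q) mC).
  have E w : \1_(@split_tuple R p q @^-1` C) (V w) = \1_C (U w) :> R.
    rewrite !indicE; congr (nat_of_bool _)%:R.
    have UE : split_tuple (V w) = U w by exact: (cat_tuple_pairK (X w, Z w)).
    by apply/idP/idP => /set_mem/= h0; rewrite mem_set//=; move: h0; rewrite UE.
  under [in LHS]eq_fun do rewrite E.
  by under [in RHS]eq_fun do rewrite E.
have Ab : {ae P0, forall w, cond_exp P0 U (fun w => \1_(`[t, +oo[%classic) (Y w)) w = h (U w)}.
  apply: (cond_exp_ae_Ex _ (b1 t)) => //.
  - by case: (b1 t).
  - exact: aeW.
  - by move=> s; exact: g01.
rewrite /cond_prob_ge ray_indic.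
have bh : bmeas (fun w => h (U w)).
  have mU : measurable_fun setT U by [].
  exact: (bmeas_comp mU (bmeas01 mh (fun s => g01 (cat_tuple_pair s)))).
rewrite (cond_var_integral _ bh _ Ab mb b01).
- by [].
- by apply: (measurable_cond_exp U); exact: bmeas_integrable.
- by move=> w; have /andP[] := g01 (cat_tuple_pair (U w)).
- move=> C mC; rewrite -bE//.
  have := hE (fst @^-1` C) (measurable_preimage measurable_fst mC).
  by move=> ->.
Qed.

Hypotheses (msurv : measurable_fun [set: R] (surv P0 Y))
  (mg : measurable_fun [set: R] (cond_sqr P0 V g))
  (mb : measurable_fun [set: R] (cond_sqr P0 X b)).

Lemma surv01 t : 0 <= surv P0 Y t <= 1.
Proof.
rewrite /surv mass_ge0/= -[leRHS](Ex_cst P0 1); apply: Ex_le.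
- exact: b1.
- exact: bmeas_cst.
by move=> w /=; have /andP[] := indic01 R `[t, +oo[ (Y w).
Qed.

Lemma Ex_sqr01 k (U : Omega0 -> k.-tuple R) (h : k.-tuple R -> R) :
  measurable_fun [set: Omega0] U ->
  measurable_fun [set: k.-tuple R] h -> (forall v, 0 <= h v <= 1) ->
  0 <= Ex P0 (fun w => h (U w) ^+ 2) <= 1.
Proof.
move=> mU mh h01; rewrite Ex_ge0/= => [|w]; last exact: sqr_ge0.
rewrite -[leRHS](Ex_cst P0 1); apply: Ex_le.
- by apply: bmeasX; exact: (bmeas_comp mU (bmeas01 mh h01)).
- exact: bmeas_cst.
by move=> w; have /andP[? ?] := h01 (U w); rewrite expr_le1.
Qed.

Lemma cond_depE :
  cond_dep Y Z X =
  (Ex P0 (cond_sqr P0 V g \o Y) - Ex P0 (cond_sqr P0 X b \o Y)) /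
  (Ex P0 (surv P0 Y \o Y) - Ex P0 (cond_sqr P0 X b \o Y)).
Proof.
have bs : bmeas (surv P0 Y) by apply: bmeas01 => //; exact: surv01.
have bg : bmeas (cond_sqr P0 V g).
  apply: bmeas01 => // t; have [? ? _] := gP t.
  by apply: Ex_sqr01 => //; exact: measurable_catXZ.
have bb : bmeas (cond_sqr P0 X b).
  by apply: bmeas01 => // t; have [? ? _] := bP t; exact: Ex_sqr01.
have E (f1 f2 : R -> R) : bmeas f1 -> bmeas f2 ->
    fine (\int[distribution P0 Y]_t (f1 t - f2 t)%:E)%E =
    Ex P0 (f1 \o Y) - Ex P0 (f2 \o Y).
  move=> bf1 bf2; have b12 := bmeas_comp mY (bmeasB bf1 bf2).
  rewrite integral_distribution.
  - by rewrite -(ExB P0 (bmeas_comp mY bf1) (bmeas_comp mY bf2)).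
  - by apply/measurable_EFinP; case: (bmeasB bf1 bf2).
  - exact: (bmeas_integrable P0 b12).
rewrite /cond_dep; congr (_ / _).
  by rewrite -E//; congr fine; apply: eq_integral => t _; exact: cond_var_cond_prob.
by rewrite -E//; congr fine; apply: eq_integral => t _; exact: cond_var_indic.
Qed.

End identification.

(** * Positivity of the denominator *)

Lemma ae_eq0_of_Ex (R : realType) d (T : measurableType d) (P : probability T R)
  (f : T -> R) : bmeas f -> (forall x, 0 <= f x) -> Ex P f = 0 ->
  {ae P, forall x, f x = 0}.
Proof.
move=> bf f0 Ef; have mEf : measurable_fun setT (EFin \o f).
  by apply/measurable_EFinP; case: bf.
have : (\int[P]_x `|(EFin \o f) x| = 0)%E.
  under eq_integral do rewrite /= ger0_norm//.
  by rewrite -EFin_Ex// Ef.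
move/(ae_eq_integral_abs _ measurableT mEf).1; apply: filterS => x /(_ I).
by move=> /= [].
Qed.

(** If the infimum is not attained, a sequence tending to it is strictly below
    every element in the end. *)
Lemma coinitial_seq (R : realType) (H : set R) : H !=set0 -> has_lbound H ->
  exists t : nat -> R, (forall n, H (t n)) /\ forall x, H x -> exists n, t n <= x.
Proof.
move=> H0 Hlb; have Hinf : has_inf H by [].
have [Hi|Hi] := pselect (H (inf H)).
  by exists (fun=> inf H); split => // x Hx; exists 0%N; exact: ge_inf.
have /choice[t tP] : forall n : nat, exists t, H t /\ t < inf H + n.+1%:R^-1.
  by move=> n; have [|t Ht tn] := @inf_adherent _ H n.+1%:R^-1 _ Hinf;
    [rewrite invr_gt0|exists t].
exists t; split=> [n|x Hx]; first by have [] := tP n.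
have xi : 0 < x - inf H.
  rewrite subr_gt0 lt_neqAle ge_inf// andbT.
  by apply/eqP => E; apply: Hi; rewrite E.
exists (Num.truncn (x - inf H)^-1); rewrite ltW//.
apply: (lt_le_trans (tP _).2); rewrite -lerBrDl.
by rewrite invf_ple ?posrE ?ltr0n// ltW// truncnS_gt.
Qed.

Section determination.
Context (R : realType) d0 (Omega0 : measurableType d0) (P0 : probability Omega0 R)
  dS (S : measurableType dS) (Y : Omega0 -> R) (X : Omega0 -> S).

Definition determined s := exists2 A, measurable A &
  {ae P0, forall w, (s <= Y w) <-> A (X w)}.

(** A set of levels that contains [Y] almost surely has a countable subset that
    comes arbitrarily close to its infimum, so that all other levels are
    countable unions. *)
Lemma determined_all (G : set R) : (forall s, G s -> determined s) ->
  {ae P0, forall w, G (Y w)} -> forall s, determined s.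
Proof.
move=> Gd YG s; pose H := [set t | G t /\ s <= t].
have [H0|/set0P/negP] := pselect (H !=set0); last first.
  rewrite negbK => /eqP H0; exists set0 => //.
  apply: filterS YG => w Gw; split => // sw.
  by have : H (Y w) by []; rewrite H0.
have [t [Ht tH]] : exists t : nat -> R,
    (forall n, H (t n)) /\ forall x, H x -> exists n, t n <= x.
  by apply: coinitial_seq => //; exists s => x [].
have /choice[A AP] : forall n, exists A, measurable A /\
    {ae P0, forall w, (t n <= Y w) <-> A (X w)}.
  by move=> n; have [A] := Gd _ (Ht n).1; exists A.
exists (\bigcup_n A n); first by apply: bigcup_measurable => n _; have [] := AP n.
have /ae_foralln := fun n => (AP n).2.
apply: filterS2 YG => w Gw Aw; split=> [sw|[n _ /Aw]].
  by have [n tn] := tH (Y w) (conj Gw sw); exists n => //; apply/Aw.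
by apply: le_trans; have [] := Ht n.
Qed.

(** If every upper level set of [Y] is almost surely an event of [X], then [Y]
    is the supremum of the rational levels below it. *)
Lemma determined_function : (forall s, determined s) ->
  exists2 g : S -> R, measurable_fun [set: S] g & {ae P0, forall w, Y w = g (X w)}.
Proof.
move=> dY; pose r (n : nat) : R := ratr (odflt 0 (@choice.unpickle rat n)).
have /choice[A AP] : forall n, exists A, measurable A /\
    {ae P0, forall w, (r n <= Y w) <-> A (X w)}.
  by move=> n; have [A] := dY (r n); exists A.
pose f n v : \bar R := if v \in A n then (r n)%:E else -oo%E.
have mf n : measurable_fun [set: S] (f n).
  apply: measurable_fun_ifT => //; apply: measurable_fun_bool true _.
  rewrite setTI (_ : _ @^-1` _ = A n); first by have [] := AP n.
  by apply/seteqP; split => v /=; [move/set_mem|move/mem_set].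
exists (fun v => fine (esups (f ^~ v) 0%N)).
  by apply: (measurableT_comp (@fine_measurable R setT measurableT)) => //; exact: measurable_fun_esups.
have /ae_foralln := fun n => (AP n).2; apply: filterS => w Aw.
suff -> : esups (f ^~ (X w)) 0%N = (Y w)%:E by [].
apply/eqP; rewrite eq_le; apply/andP; split.
  apply: ge_ereal_sup => _ [n _ <-]; rewrite /f; case: ifPn => [/set_mem/Aw h|_].
    by rewrite lee_fin.
  exact: leNye.
rewrite leNgt; apply/negP => h.
have [r0 r0Y] : exists x : R, (esups (f ^~ (X w)) 0%N <= x%:E)%E /\ x < Y w.
  case: (esups _ _) h => [x|//|_]; first by exists x.
  by exists (Y w - 1); rewrite leNye ltrBlDr ltrDl ltr01.
have [q] := rat_in_itvoo r0Y.2; rewrite in_itv/= => /andP[xq qY].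
have rq : r (choice.pickle q) = ratr q by rewrite /r choice.pickleK.
have : (f (choice.pickle q) (X w) <= r0%:E)%E.
  by apply: (le_trans _ r0Y.1); apply: ereal_sup_ubound; exists (choice.pickle q).
rewrite /f mem_set; last by apply/Aw; rewrite rq ltW.
by rewrite rq lee_fin leNgt xq.
Qed.

Variable b : R -> S -> R.
Hypotheses (mY : measurable_fun [set: Omega0] Y) (mX : measurable_fun [set: Omega0] X).
Hypotheses (mb : forall t, measurable_fun [set: S] (b t))
  (b01 : forall t v, 0 <= b t v <= 1)
  (bE : forall t C, measurable C ->
    Ex P0 (fun w => \1_(`[t, +oo[%classic) (Y w) * \1_C (X w)) =
    Ex P0 (fun w => b t (X w) * \1_C (X w))).

Let e t w : R := \1_(`[t, +oo[%classic) (Y w).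

Let be t : bmeas (e t).
Proof. exact: (bmeas_comp mY (bmeas_indic R _)). Qed.

Let bb t : bmeas (b t \o X).
Proof. exact: (bmeas_comp mX (bmeas01 (mb t) (b01 t))). Qed.

Let defectE t : Ex P0 (fun w => (e t w - b t (X w)) ^+ 2) =
  surv P0 Y t - Ex P0 (fun w => b t (X w) ^+ 2).
Proof.
rewrite (Ex_sqr_defect mX (be t) _ (mb t) (b01 t) (bE t)) => [|w]; last first.
  by have /andP[] := indic01 R `[t, +oo[ (Y w).
congr (_ - _); rewrite /surv /mass; congr Ex; apply/funext => w /=.
by rewrite /e indicE; case: (_ \in _); rewrite ?expr1n ?expr0n.
Qed.

(** The integrand is the mean squared distance of a level indicator to its
    conditional probability; it vanishes only if the indicator is almost surely
    a function of [X]. If this happens at almost every level, then [Y] itself is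
    a function of [X]. *)
Lemma surv_cond_sqr_gt0 :
  measurable_fun [set: R] (surv P0 Y) ->
  measurable_fun [set: R] (fun t => Ex P0 (fun w => b t (X w) ^+ 2)) ->
  (forall g : S -> R, measurable_fun [set: S] g -> ~ {ae P0, forall w, Y w = g (X w)}) ->
  0 < Ex P0 (surv P0 Y \o Y) - Ex P0 ((fun t => Ex P0 (fun w => b t (X w) ^+ 2)) \o Y).
Proof.
move=> ms mc nog; pose F t := Ex P0 (fun w => (e t w - b t (X w)) ^+ 2).
have FE : F = fun t => surv P0 Y t - Ex P0 (fun w => b t (X w) ^+ 2).
  by apply/funext => t; exact: defectE.
have bd t : bmeas (fun w => (e t w - b t (X w)) ^+ 2).
  by apply: bmeasX; exact: bmeasB (be t) (bb t).
have bs : bmeas (surv P0 Y).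
  apply: bmeas01 => // t; rewrite /surv mass_ge0/= -[leRHS](Ex_cst P0 1).
  apply: Ex_le; [exact: be|exact: bmeas_cst|move=> w].
  by have /andP[] := indic01 R `[t, +oo[ (Y w).
have bc : bmeas (fun t => Ex P0 (fun w => b t (X w) ^+ 2)).
  apply: bmeas01 => // t; rewrite Ex_ge0/= => [|w]; last exact: sqr_ge0.
  rewrite -[leRHS](Ex_cst P0 1); apply: Ex_le; [exact: bmeasX (bb t)|exact: bmeas_cst|].
  by move=> w; have /andP[? ?] := b01 t (X w); rewrite expr_le1.
have bF : bmeas (F \o Y) by rewrite FE; exact: (bmeas_comp mY (bmeasB bs bc)).
rewrite -(ExB P0 (bmeas_comp mY bs) (bmeas_comp mY bc)).
rewrite [X in 0 < Ex _ X](_ : _ = F \o Y); last by rewrite FE.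
have F0 t : 0 <= F t by apply: Ex_ge0 => w; exact: sqr_ge0.
rewrite lt_neqAle Ex_ge0 ?andbT => [|w]; last exact: F0.
apply/negP => /eqP/esym EF; have [|g mg] := determined_function; last exact: nog mg.
apply: (@determined_all [set t | F t = 0]); last first.
  by apply: (ae_eq0_of_Ex bF _ EF) => w; exact: F0.
move=> t /= Ft.
exists (b t @^-1` [set 1]); first exact: measurable_preimage.
have := ae_eq0_of_Ex (bd t) (fun w => sqr_ge0 _) Ft; apply: filterS => w.
move/eqP; rewrite sqrf_eq0 subr_eq0 => /eqP; rewrite /e indicE /= => <-.
case: (boolP (_ \in _)) => [/set_mem|/negP h] /=.
  by rewrite in_itv/= andbT.
split=> [tY|/eqP]; last by rewrite eq_sym oner_eq0.
by exfalso; apply: h; rewrite mem_set//= in_itv/= tY.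
Qed.

End determination.

(** * The estimator as a ratio of averages over levels *)

Section ranks.
Context (R : realType) d (Omega : measurableType d) (Ys : nat -> Omega -> R).
Variables (n : nat) (w : Omega).
Hypothesis n0 : (0 < n)%N.

Let y (i : 'I_n) := Ys i w.
Let nE : n%:R != 0 :> R. Proof. by rewrite pnatr_eq0 -lt0n. Qed.

Lemma rankR_sum i : (rankR y i)%:R = \sum_(j < n) (y j <= y i)%R%:R :> R.
Proof.
rewrite /rankR -sum1_card natr_sum [LHS]big_mkcond/=; apply: eq_bigr => j _.
by rewrite inE; case: (y j <= y i).
Qed.

Lemma rankL_emp_surv i : (rankL y i)%:R = n%:R * emp_surv Ys n w (y i).
Proof.
rewrite /emp_surv mulVKf// /rankL -sum1_card natr_sum [LHS]big_mkcond/=.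
by apply: eq_bigr => j _; rewrite inE; case: (y i <= y j).
Qed.

Lemma min_rank_sum i k : (minn (rankR y i) (rankR y k))%:R =
  \sum_(j < n) (y j <= y i)%R%:R * (y j <= y k)%R%:R :> R.
Proof.
wlog ik : i k / y i <= y k.
  move=> h; have [/h//|/ltW/h] := leP (y i) (y k).
  by rewrite minnC => ->; apply: eq_bigr => j _; rewrite mulrC.
have rik : (rankR y i <= rankR y k)%N.
  apply: subset_leq_card; apply/fintype.subsetP => j; rewrite !inE => ji.
  exact: le_trans ik.
rewrite (minn_idPl rik) rankR_sum; apply: eq_bigr => j _.
by case: (leP (y j) (y i)) => [ji|_]; rewrite ?mul0r// (le_trans ji ik) mulr1.
Qed.

Lemma sum_rankR : \sum_(i < n) (rankR y i)%:R =
  n%:R ^+ 2 * (n%:R^-1 * \sum_(j < n) emp_surv Ys n w (Ys j w)).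
Proof.
under eq_bigr do rewrite rankR_sum.
rewrite exchange_big/= expr2 -mulrA mulVKf// mulr_sumr; apply: eq_bigr => j _.
by rewrite /emp_surv mulVKf.
Qed.

(** Exchanging the sums turns pairs of a point and its neighbour, for a fixed
    sample level, into the statistic [emp_pair] at that level. *)
Lemma sum_min_rank (M : forall n, 'I_n -> Omega -> 'I_n) :
  \sum_(i < n) (minn (rankR y i) (rankR y (M n i w)))%:R =
  n%:R ^+ 2 * (n%:R^-1 * \sum_(j < n) emp_pair Ys M n w (Ys j w)).
Proof.
under eq_bigr do rewrite min_rank_sum.
rewrite exchange_big/= expr2 -mulrA mulVKf// mulr_sumr; apply: eq_bigr => j _.
by rewrite /emp_pair mulVKf.
Qed.

Lemma Tn_num_pos p (N M : forall n, 'I_n -> Omega -> 'I_n) :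
  Tn_num p.+1 y (fun i => N n i w) (fun i => M n i w) =
  n%:R ^+ 2 * (n%:R^-1 * (\sum_(j < n) emp_pair Ys M n w (Ys j w)) -
               n%:R^-1 * (\sum_(j < n) emp_pair Ys N n w (Ys j w))).
Proof. by rewrite /Tn_num/= sumrB !sum_min_rank mulrBr. Qed.

Lemma Tn_den_pos p (N : forall n, 'I_n -> Omega -> 'I_n) :
  Tn_den p.+1 y (fun i => N n i w) =
  n%:R ^+ 2 * (n%:R^-1 * (\sum_(j < n) emp_surv Ys n w (Ys j w)) -
               n%:R^-1 * (\sum_(j < n) emp_pair Ys N n w (Ys j w))).
Proof. by rewrite /Tn_den/= sumrB sum_rankR sum_min_rank mulrBr. Qed.

Let sum_sqr : \sum_(i < n) (rankL y i)%:R ^+ 2 =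
  n%:R ^+ 3 * (n%:R^-1 * \sum_(j < n) emp_surv Ys n w (Ys j w) ^+ 2).
Proof.
rewrite exprSr -mulrA mulVKf// mulr_sumr; apply: eq_bigr => i _.
by rewrite rankL_emp_surv exprMn.
Qed.

Lemma Tn_num_0 (N M : forall n, 'I_n -> Omega -> 'I_n) :
  Tn_num 0 y (fun i => N n i w) (fun i => M n i w) =
  n%:R ^+ 3 * (n%:R^-1 * (\sum_(j < n) emp_pair Ys M n w (Ys j w)) -
               n%:R^-1 * (\sum_(j < n) emp_surv Ys n w (Ys j w) ^+ 2)).
Proof.
by rewrite /Tn_num/= sumrB sum_sqr -mulr_sumr sum_min_rank mulrBr [in RHS]exprS -!mulrA.
Qed.

Lemma Tn_den_0 (N : forall n, 'I_n -> Omega -> 'I_n) :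
  Tn_den 0 y (fun i => N n i w) =
  n%:R ^+ 3 * (n%:R^-1 * (\sum_(j < n) emp_surv Ys n w (Ys j w)) -
               n%:R^-1 * (\sum_(j < n) emp_surv Ys n w (Ys j w) ^+ 2)).
Proof.
rewrite /Tn_den/= mulrBr -sum_sqr exprSr -mulrA mulVKf// mulr_sumr -sumrB.
by apply: eq_bigr => i _; rewrite rankL_emp_surv; ring.
Qed.

End ranks.

Lemma cvg_ratio (R : realType) (c u v num den : nat -> R) (a b : R) : 0 < b ->
  u @ \oo --> a -> v @ \oo --> b ->
  (forall n, (0 < n)%N -> [/\ c n != 0, num n = c n * u n & den n = c n * v n]) ->
  (\forall n \near \oo, den n != 0) /\ num n / den n @[n --> \oo] --> a / b.
Proof.
move=> b0 ua vb E.
have v0 : \forall n \near \oo, v n != 0.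
  have := vb; move/cvgrPdist_lt => /(_ b b0); apply: filterS => n.
  by apply: contraTneq => ->; rewrite subr0 gtr0_norm// ltxx.
split.
  apply: filterS2 v0 (nbhs_infty_gt 0) => n vn /E[c0 _ ->].
  by rewrite mulf_neq0.
have : u n / v n @[n --> \oo] --> a / b.
  by apply: cvgM => //; apply: cvgV => //; rewrite gt_eqF.
apply: cvg_trans; apply: near_eq_cvg; apply: filterS2 v0 (nbhs_infty_gt 0).
move=> n vn /E[c0 -> ->] /=.
by rewrite invfM mulrACA divff// mul1r.
Qed.

Section transfer.
Context (R : realType) d (Omega : measurableType d) (P : probability Omega R).

Lemma uniform_nearest_comp dS (S : measurableType dS) dS' (S' : measurableType dS')
  k n (h : S -> S') (D : Omega -> S) (x : 'I_n -> Omega -> k.-tuple R)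
  (nu : 'I_n -> Omega -> 'I_n) : measurable_fun [set: S] h ->
  uniform_nearest P D x nu -> uniform_nearest P (h \o D) x nu.
Proof.
move=> mh [mnu E]; split => // B f mB.
by apply: (E (h @^-1` B) f); exact: measurable_preimage.
Qed.

Lemma uniform_nearest_map dS (S : measurableType dS) dS' (S' : measurableType dS')
  k n (h : S -> S') (W : nat -> Omega -> S) (x : 'I_n -> Omega -> k.-tuple R)
  (nu : 'I_n -> Omega -> 'I_n) : measurable_fun [set: S] h ->
  uniform_nearest P (fun w => [tuple W j w | j < n]) x nu ->
  uniform_nearest P (fun w => [tuple h (W j w) | j < n]) x nu.
Proof.
move=> mh /(uniform_nearest_comp (h := fun t : n.-tuple S => [tuple h (tnth t j) | j < n])).
rewrite (_ : _ \o _ = fun w => [tuple h (W j w) | j < n]); last first.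
  by apply/funext => w /=; apply: eq_from_tnth => j; rewrite !tnth_mktuple.
apply; apply/measurable_fun_tnthP => i.
rewrite (_ : _ \o _ = h \o (fun t : n.-tuple S => tnth t i)).
  by apply: measurableT_comp => //; exact: measurable_tnth.
by apply/funext => t /=; rewrite tnth_mktuple.
Qed.

End transfer.

Lemma exists_cond_prob (R : realType) k d0 (Omega0 : measurableType d0)
  (P0 : probability Omega0 R) (Y : Omega0 -> R) (V : Omega0 -> k.-tuple R) (B : set R) :
  measurable_fun [set: Omega0] Y -> measurable_fun [set: Omega0] V -> measurable B ->
  exists g, has_cond_prob P0 Y V B g.
Proof.
move=> mY mV mB.
pose U : {mfun Omega0 >-> k.-tuple R} :=
  HB.pack V (isMeasurableFun.Build _ _ _ _ V mV).
have := @exists_factor _ _ _ P0 _ _ U (fun w => \1_B (Y w)).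
case=> [|w|g [mg g01 gE]].
- by apply: measurableT_comp => //; exact: measurable_indic.
- exact: indic01.
- by exists g.
Qed.

(** * Almost sure convergence of the estimator *)

Section assembly.
Context (R : realType) (p q : nat) d0 (Omega0 : measurableType d0)
  (P0 : probability Omega0 R)
  (Y : {RV P0 >-> R}) (X : {RV P0 >-> p.-tuple R}) (Z : {RV P0 >-> q.-tuple R})
  d (Omega : measurableType d) (P : probability Omega R)
  (Ys : nat -> {RV P >-> R}) (Xs : nat -> {RV P >-> p.-tuple R})
  (Zs : nat -> {RV P >-> q.-tuple R}).
Hypothesis iid : iid_copies P0 P (fun w => (Y w, X w, Z w))
    (fun i w => (Ys i w, Xs i w, Zs i w)).

Let data n w := [tuple (Ys j w, Xs j w, Zs j w) | j < n].

Let V w := [tuple of X w ++ Z w].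
Let Vs i w := [tuple of Xs i w ++ Zs i w].

Let mY : measurable_fun [set: Omega0] Y. Proof. by []. Qed.
Let mX : measurable_fun [set: Omega0] X. Proof. by []. Qed.
Let mYs i : measurable_fun [set: Omega] (Ys i). Proof. by []. Qed.
Let mXs i : measurable_fun [set: Omega] (Xs i). Proof. by []. Qed.
Let mV : measurable_fun [set: Omega0] V. Proof. exact: measurable_catXZ. Qed.
Let mVs i : measurable_fun [set: Omega] (Vs i). Proof. exact: measurable_catXZ. Qed.

Let W := (R * p.-tuple R * q.-tuple R)%type.
Let toYX (t : W) := t.1.
Let toYV (t : W) := (t.1.1, cat_tuple_pair (t.1.2, t.2)).

Let mtoYX : measurable_fun [set: W] toYX. Proof. exact: measurable_fst. Qed.

Let mtoYV : measurable_fun [set: W] toYV.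
Proof.
have m1 : measurable_fun [set: W] (fun t : W => t.1) by exact: measurable_fst.
have m2 : measurable_fun [set: W] (fun t : W => t.2) by exact: measurable_snd.
have m11 : measurable_fun [set: W] (fun t : W => t.1.1).
  exact: measurableT_comp measurable_fst m1.
have m12 : measurable_fun [set: W] (fun t : W => t.1.2).
  exact: measurableT_comp measurable_snd m1.
apply: measurable_fun_pair => //.
apply: (measurableT_comp (@measurable_cat_tuple_pair R p q)).
exact: measurable_fun_pair.
Qed.

Lemma iid_YX : iid_copies P0 P (fun w => (Y w, X w)) (fun i w => (Ys i w, Xs i w)).
Proof. exact: (iid_copies_comp mtoYX iid). Qed.

Lemma iid_YV : iid_copies P0 P (fun w => (Y w, V w)) (fun i w => (Ys i w, Vs i w)).
Proof. exact: (iid_copies_comp mtoYV iid). Qed.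

Lemma iid_Y : iid_copies P0 P Y (fun i => Ys i).
Proof. exact: (iid_copies_comp (@measurable_fst _ _ R (p.-tuple R)) iid_YX). Qed.

Lemma exists_versions k (U : Omega0 -> k.-tuple R) : measurable_fun [set: Omega0] U ->
  exists g : R -> k.-tuple R -> R, forall t, has_cond_prob P0 Y U `[t, +oo[ (g t).
Proof.
move=> mU; have /choice[g gP] := fun t : R => exists_cond_prob P0 mY mU
  (measurable_itv `[t, +oo[ : measurable (`[t, +oo[%classic : set R)).
by exists g.
Qed.

Lemma uniform_nearest_YX n (nu : 'I_n -> Omega -> 'I_n) :
  uniform_nearest P (data n) (fun j w => Xs j w) nu ->
  uniform_nearest P (fun w => [tuple (Ys j w, Xs j w) | j < n]) (fun j w => Xs j w) nu.
Proof. exact: (uniform_nearest_map (W := fun j w => (Ys j w, Xs j w, Zs j w)) mtoYX). Qed.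

Lemma uniform_nearest_YV n (nu : 'I_n -> Omega -> 'I_n) :
  uniform_nearest P (data n) (fun j w => Vs j w) nu ->
  uniform_nearest P (fun w => [tuple (Ys j w, Vs j w) | j < n]) (fun j w => Vs j w) nu.
Proof. exact: (uniform_nearest_map (W := fun j w => (Ys j w, Xs j w, Zs j w)) mtoYV). Qed.

Lemma measurable_surv : measurable_fun [set: R] (surv P0 Y).
Proof.
exact: (measurable_level (@emp_surv_mono _ _ _ (fun i => Ys i)) (emp_surv_cvg mY mYs iid_Y)).
Qed.

End assembly.

Theorem theorem2p2 (R : realType) (p q : nat)
    (d0 : measure_display) (Omega0 : measurableType d0)
    (P0 : probability Omega0 R)
    (Y : {RV P0 >-> R}) (X : {RV P0 >-> p.-tuple R}) (Z : {RV P0 >-> q.-tuple R})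
    (d : measure_display) (Omega : measurableType d) (P : probability Omega R)
    (Ys : nat -> {RV P >-> R}) (Xs : nat -> {RV P >-> p.-tuple R})
    (Zs : nat -> {RV P >-> q.-tuple R})
    (N M : forall n : nat, 'I_n -> Omega -> 'I_n) :
  (0 < q)%N ->
  (forall g : p.-tuple R -> R, measurable_fun [set: p.-tuple R] g ->
     ~ {ae P0, forall w, Y w = g (X w)}) ->
  iid_copies P0 P (fun w => (Y w, X w, Z w))
    (fun i w => (Ys i w, Xs i w, Zs i w)) ->
  (forall n : nat, (2 <= n)%N ->
     let data w := [tuple (Ys j w, Xs j w, Zs j w) | j < n] in
     ((0 < p)%N -> uniform_nearest P data (fun j w => Xs j w) (N n)) /\
     uniform_nearest P data (fun j w => [tuple of Xs j w ++ Zs j w]) (M n)) ->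
  {ae P, forall w,
     let y n (i : 'I_n) := Ys i w in
     (\forall n \near \oo, Tn_den p (y n) (fun i => N n i w) != 0) /\
     Tn_num p (y n) (fun i => N n i w) (fun i => M n i w)
       / Tn_den p (y n) (fun i => N n i w) @[n --> \oo] --> cond_dep Y Z X}.
Proof.
move=> _ nog iid nn.
have mY : measurable_fun [set: Omega0] Y by [].
have mX : measurable_fun [set: Omega0] X by [].
have mYs i : measurable_fun [set: Omega] (Ys i) by [].
have mXs i : measurable_fun [set: Omega] (Xs i) by [].
have mV := @measurable_catXZ _ _ _ _ _ _ X Z.
have mVs i := @measurable_catXZ _ _ _ _ _ _ (Xs i) (Zs i).
have [g gP] := exists_versions Y mV.
have [b bP] := exists_versions Y mX.
have cpV B := @exists_cond_prob _ _ _ _ P0 Y _ B mY mV.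
have cpX B := @exists_cond_prob _ _ _ _ P0 Y _ B mY mX.
have nnV n n2 := uniform_nearest_YV (nn n n2).2.
have iY := @iid_Y R p q d0 Omega0 P0 Y X Z d Omega P Ys Xs Zs iid.
have iYX := @iid_YX R p q d0 Omega0 P0 Y X Z d Omega P Ys Xs Zs iid.
have iYV := @iid_YV R p q d0 Omega0 P0 Y X Z d Omega P Ys Xs Zs iid.
have ms := @measurable_surv R p q d0 Omega0 P0 Y X Z d Omega P Ys Xs Zs iid.
have mgV := measurable_cond_sqr mY mYs mV mVs iYV nnV gP.
have cvgM := emp_pair_avg_cvg mY mYs iY mV mVs iYV nnV cpV gP.
have cvgS := emp_surv_avg_cvg mY mYs iY.
have pos mb := surv_cond_sqr_gt0 mY mX (fun t => let: And3 h _ _ := bP t in h)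
  (fun t => let: And3 _ h _ := bP t in h) (fun t => let: And3 _ _ h := bP t in h) ms mb nog.
(* [u] is the average subtracted from numerator and denominator *)
have lim (c : nat -> R) (u : nat -> Omega -> R) :
    measurable_fun [set: R] (cond_sqr P0 X b) ->
    (forall n, (0 < n)%N -> c n != 0) ->
    {ae P, forall w, u n w @[n --> \oo] --> Ex P0 (cond_sqr P0 X b \o Y)} ->
    (forall n w, (0 < n)%N ->
      Tn_num p (fun i : 'I_n => Ys i w) (fun i => N n i w) (fun i => M n i w) =
      c n * (n%:R^-1 * (\sum_(j < n) emp_pair (fun i => Ys i) M n w (Ys j w)) - u n w) /\
      Tn_den p (fun i : 'I_n => Ys i w) (fun i => N n i w) =
      c n * (n%:R^-1 * (\sum_(j < n) emp_surv (fun i => Ys i) n w (Ys j w)) - u n w)) ->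
    {ae P, forall w, let y n (i : 'I_n) := Ys i w in
     (\forall n \near \oo, Tn_den p (y n) (fun i => N n i w) != 0) /\
     Tn_num p (y n) (fun i => N n i w) (fun i => M n i w)
       / Tn_den p (y n) (fun i => N n i w) @[n --> \oo] --> cond_dep Y Z X}.
  move=> mb c0 cvgu E; rewrite (cond_depE gP bP ms mgV mb).
  apply: filterS3 cvgM cvgS cvgu => w hM hS hu /=.
  apply: (cvg_ratio (c := c) (pos mb) (cvgB hM hu) (cvgB hS hu)) => n n0.
  by have [-> ->] := E n w n0; split => //; exact: c0.
have nz n k : (0 < n)%N -> n%:R ^+ k != 0 :> R.
  by move=> n0; rewrite expf_neq0// pnatr_eq0 -lt0n.
case: p X Xs nog iid nn mX mXs iYX iYV mV mVs g gP b bP cpV cpX nnV mgV cvgM pos lim => [|p]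
  X Xs nog iid nn mX mXs iYX iYV mV mVs g gP b bP cpV cpX nnV mgV cvgM pos lim.
  (* conditioning on the empty vector is trivial *)
  have bE : cond_sqr P0 X b = fun t => surv P0 Y t ^+ 2.
    apply/funext => t; have [_ _ /(_ _ measurableT)] := bP t.
    under eq_fun do rewrite indicT mulr1; rewrite -/(mass P0 Y _) -/(surv P0 Y t) => ->.
    have b0 w : b t (X w) = b t [tuple] by rewrite tuple0.
    under [in RHS]eq_fun do rewrite indicT mulr1 b0.
    by rewrite /cond_sqr; under eq_fun do rewrite b0; rewrite !Ex_cst.
  apply: (lim (fun n => n%:R ^+ 3)
    (fun n w => n%:R^-1 * \sum_(j < n) emp_surv (fun i => Ys i) n w (Ys j w) ^+ 2)).
  - by rewrite bE; exact: measurable_funX.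
  - by move=> n; exact: nz.
  - by rewrite bE; exact: emp_surv_sqr_avg_cvg.
  - by move=> n w n0; split; [exact: (Tn_num_0 _ _ n0)|exact: (Tn_den_0 _ _ n0)].
have nnX n n2 := uniform_nearest_YX ((nn n n2).1 isT).
apply: (lim (fun n => n%:R ^+ 2)
  (fun n w => n%:R^-1 * \sum_(j < n) emp_pair (fun i => Ys i) N n w (Ys j w))).
- exact: (measurable_cond_sqr mY mYs mX mXs iYX nnX bP).
- by move=> n; exact: nz.
- exact: (emp_pair_avg_cvg mY mYs iY mX mXs iYX nnX cpX bP).
- by move=> n w n0; split; [exact: (Tn_num_pos _ _ n0)|exact: (Tn_den_pos _ _ n0)].
Qed.
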